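(* Let $X$ be a metric space with bounded geometry, and let $p\in[1,\infty)$. The following are equivalent: \begin{enumerate} \item[(1)] $X$ has asymptotic dimension zero. \item[(2)] $B^p_u(X)$ is an inductive limit of subalgebras each isometrically isomorphic to an algebra of the form $\bigoplus_{k=1}^N M_{d_k}^p$ with norm $\|(a_1,\ldots,a_N)\|=\max(\|a_1\|,\ldots,\|a_N\|)$, where $N,d_1,\ldots,d_N\in\mathbb{N}$ and $M_d^p$ denotes $B(\ell^p(\{1,\ldots,d\}))$. \item[(3)] $B^p_u(X)$ has cancellation. \end{enumerate}
   Context: A metric space $(X,d)$ has bounded geometry if for any $R>0$ there exists $N_R>0$ such that $|B_R(x)|\le N_R$ for all $x\in X$, where $B_R(x)$ is the closed ball of radius $R$ centered at $x$. For $T\in B(\ell^p(X))$ write $T_{xy}=(T\delta_y)(x)$ and $\mathrm{prop}(T)=\sup\{d(x,y):x,y\in X,\ T_{xy}\neq 0\}\in[0,\infty]$. The $\ell^p$ uniform Roe algebra $B^p_u(X)$ is the operator norm closure in $B(\ell^p(X))$ of the algebra of all bounded operators on $\ell^p(X)$ with finite propagation. Asymptotic dimension zero: for any $r>0$, $X$ decomposes into a collection of pairwise disjoint subsets of uniformly bounded diameter such that $d(A,B)>r$ for all distinct members $A,B$. Equivalently (for bounded geometry spaces), for each $r\geq 0$ the equivalence relation $\sim_r$ generated by $d(x,y)\le r$ has uniformly finite equivalence classes. ''Inductive limit of subalgebras'' means that there is a family of subalgebras of $B^p_u(X)$ of the stated form, upward directed under inclusion (not necessarily a sequence), whose union is norm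 dense in $B^p_u(X)$. Cancellation: idempotents $e,f$ in an algebra $A$ are algebraically equivalent, $e\sim f$, if there exist $x,y\in A$ with $e=xy$, $f=yx$; they are orthogonal, $e\perp f$, if $ef=0=fe$. A Banach algebra $A$ has cancellation of idempotents if whenever $e,f,g,h$ are idempotents in $A$ with $e\perp g$, $f\perp h$, $e\sim f$ and $e+g\sim f+h$, then $g\sim h$. $A$ has cancellation if $M_n(A)$ has cancellation of idempotents for all $n\in\mathbb{N}$. *)

(* Defs.v *)
From HB Require Import structures.
From mathcomp Require Import all_boot all_order all_algebra.
From mathcomp Require Import complex finmap.
From mathcomp Require Import all_classical all_reals all_analysis.
From mathcomp Require Import ring.

Set Implicit Arguments.
Unset Strict Implicit.
Unset Printing Implicit Defensive.

Import Order.TTheory GRing.Theory Num.Theory.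
Import ComplexField.Normc.

Local Open Scope classical_set_scope.
Local Open Scope complex_scope.
Local Open Scope ring_scope.

(* The sum of the |f x|^p over x; T may be any set, countable or not. *)
Definition ell_mass (R : realType) (p : R) (T : choiceType)
    (f : T -> R[i]^o) : \bar R :=
  (\esum_(x in [set: T]) (normc (f x) `^ p)%:E)%E.

Definition ell_pred (R : realType) (p : R) (T : choiceType) :
    {pred T -> R[i]^o} :=
  fun f => `[< (ell_mass p f < +oo)%E >].

(* The proof p1 plays no role in the carrier, but the canonical norm of
   ell p1 T depends on it. *)
Record ell (R : realType) (p : R) (p1 : 1 <= p) (T : choiceType) :=
  Ell { ell_fun :> T -> R[i]^o ; _ : ell_pred p ell_fun }.

Section EllTheory.
Context {R : realType} {p : R} (p1 : 1 <= p) (T : choiceType).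
Local Notation mass := (ell_mass p).

HB.instance Definition _ := [isSub for @ell_fun R p p1 T].
HB.instance Definition _ := [Choice of ell p1 T by <:].

Lemma ell_mass_leP (f : T -> R[i]^o) (c : R) :
  (mass f <= c%:E)%E <->
  (forall F : {fset T}, \sum_(x <- F) normc (f x) `^ p <= c).
Proof.
split=> [h F|h].
  rewrite -lee_fin -sumEFin; apply: le_trans h; apply: esum_ge.
  exists [set` F]; first by split.
  by rewrite fsbig_finite//= set_fsetK.
apply: ge_ereal_sup => _ [A [finA _] <-].
by rewrite fsbig_finite//= sumEFin lee_fin.
Qed.

Lemma ell_mass_ge0 (f : T -> R[i]^o) : (0 <= mass f)%E.
Proof. by apply: esum_ge0 => x _; rewrite lee_fin powR_ge0. Qed.

Lemma p_gt0 : 0 < p. Proof. exact: lt_le_trans p1. Qed.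
Let p0 := p_gt0.

Lemma normc_ge0 (z : R[i]) : 0 <= normc z.
Proof. by case: z => a b; apply: sqrtr_ge0. Qed.

Lemma powRVK (a : R) : 0 <= a -> (a `^ p^-1) `^ p = a.
Proof. by move=> a0; rewrite -powRrM mulVf ?gt_eqF// powRr1. Qed.

Lemma powRKV (a : R) : 0 <= a -> (a `^ p) `^ p^-1 = a.
Proof. by move=> a0; rewrite -powRrM mulfV ?gt_eqF// powRr1. Qed.

Lemma ler_powRp (a b : R) : 0 <= a -> 0 <= b -> (a `^ p <= b `^ p) = (a <= b).
Proof.
move=> a0 b0; apply/idP/idP => ab; last first.
  by apply: ge0_ler_powR => //; rewrite ?nnegrE// ltW.
rewrite -(powRKV a0) -(powRKV b0).
by apply: ge0_ler_powR; rewrite ?nnegrE ?powR_ge0// invr_ge0 ltW.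
Qed.

Lemma minkowski_pointwise (a b s t : R) : 0 < a -> 0 < b -> 0 <= s -> 0 <= t ->
  (s + t) `^ p <= (a + b) `^ p *
    (a / (a + b) * (s `^ p / a `^ p) + b / (a + b) * (t `^ p / b `^ p)).
Proof.
move=> a0 b0 s0 t0; have ab0 : 0 < a + b by rewrite addr_gt0.
have -> : s + t = (a + b) * (a / (a + b) * (s / a) + b / (a + b) * (t / b)).
  by field; rewrite !gt_eqF.
have sa0 : 0 <= s / a by rewrite divr_ge0// ltW.
have tb0 : 0 <= t / b by rewrite divr_ge0// ltW.
have w0 : 0 <= a / (a + b) by rewrite divr_ge0// ltW.
have w1 : a / (a + b) <= 1 by rewrite ler_pdivrMr// mul1r lerDl ltW.
have w2 : b / (a + b) = 1 - a / (a + b).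
  by rewrite -[1](@mulfV _ (a + b)) ?gt_eqF// -mulrBl addrAC subrr add0r.
rewrite powRM ?(ltW ab0)//; last first.
  by rewrite addr_ge0// mulr_ge0// divr_ge0// ltW.
rewrite ler_wpM2l ?powR_ge0//.
have E (u v : R) : 0 <= u -> 0 < v -> u `^ p / v `^ p = (u / v) `^ p.
  move=> u0 v0; rewrite powRM// ?invr_ge0 ?(ltW v0)// -powR_inv1 ?powR_ge0//.
  by rewrite -powRrM mulrN1 -powR_inv1 ?(ltW v0)// -powRrM mulN1r.
rewrite !E// w2.
have := @convex_powR R p p1 (Itv01 w0 w1) (s / a) (t / b).
by apply; rewrite inE/= in_itv/= andbT.
Qed.

Lemma ell_massD (f g : T -> R[i]^o) (a b : R) : 0 < a -> 0 < b ->
  (mass f <= (a `^ p)%:E)%E -> (mass g <= (b `^ p)%:E)%E ->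
  (mass (f + g)%R <= ((a + b) `^ p)%:E)%E.
Proof.
move=> a0 b0 /ell_mass_leP fa /ell_mass_leP gb; apply/ell_mass_leP => F.
have ab0 : 0 < a + b by rewrite addr_gt0.
have ap : 0 < a `^ p by rewrite powR_gt0.
have bp : 0 < b `^ p by rewrite powR_gt0.
apply: (@le_trans _ _ (\sum_(x <- F) (a + b) `^ p *
    (a / (a + b) * (normc (f x) `^ p / a `^ p) +
     b / (a + b) * (normc (g x) `^ p / b `^ p)))).
  apply: ler_sum => x _.
  apply: le_trans (minkowski_pointwise a0 b0 (normc_ge0 _) (normc_ge0 _)).
  by rewrite ler_powRp ?addr_ge0 ?normc_ge0//; exact: le_normcD.
rewrite -mulr_sumr big_split/= -!mulr_sumr -!mulr_suml.
rewrite -[leRHS]mulr1 ler_wpM2l ?powR_ge0//.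
rewrite -[leRHS](_ : a / (a + b) * 1 + b / (a + b) * 1 = 1); last first.
  by rewrite !mulr1 -mulrDl mulfV// gt_eqF.
by rewrite lerD// ler_wpM2l ?divr_ge0 ?(ltW a0) ?(ltW b0) ?(ltW ab0)//
  ler_pdivrMr// mul1r.
Qed.

Lemma ell_massZ (k : R[i]) (f : T -> R[i]^o) (c : R) : (mass f <= c%:E)%E ->
  (mass (k *: f)%R <= (normc k `^ p * c)%:E)%E.
Proof.
move=> /ell_mass_leP fc; apply/ell_mass_leP => F.
rewrite (eq_bigr (fun x => normc k `^ p * normc (f x) `^ p)); last first.
  by move=> x _; rewrite [X in normc X]/(k * f x) normcM powRM ?normc_ge0.
by rewrite -mulr_sumr ler_wpM2l ?powR_ge0.
Qed.

Lemma ell_mass0 : ell_mass p (0 : T -> R[i]^o)%R = 0%E.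
Proof. by apply: esum1 => x _; rewrite normc0 powR0// gt_eqF. Qed.

Lemma ell_predP (f : T -> R[i]^o) :
  (@ell_pred R p T) f <-> exists2 c : R, 0 < c & (mass f <= (c `^ p)%:E)%E.
Proof.
split=> [/asboolP h|[c _ h]]; last by apply/asboolP/(le_lt_trans h)/ltry.
have h0 := ell_mass_ge0 f.
exists ((fine (mass f)) `^ p^-1 + 1).
  by rewrite ltr_wpDl// powR_ge0.
have hf : mass f \is a fin_num by rewrite ge0_fin_numE.
rewrite -(fineK hf) lee_fin -[leLHS]powRVK ?fine_ge0//.
by rewrite ler_powRp ?powR_ge0 ?addr_ge0 ?powR_ge0// lerDl.
Qed.

Lemma ell_closed : GRing.subsemimod_closed (@ell_pred R p T).
Proof.
split; first split.
- by apply/asboolP; rewrite ell_mass0 ltry.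
- move=> f g /ell_predP[a a0 fa] /ell_predP[b b0 gb]; apply/ell_predP.
  by exists (a + b); [rewrite addr_gt0|exact: ell_massD].
- move=> k f /ell_predP[a a0 fa]; apply/asboolP.
  by apply: le_lt_trans (ell_massZ k fa) _; rewrite ltry.
Qed.

HB.instance Definition _ := GRing.SubChoice_isSubLmodule.Build R[i]
  (T -> R[i]^o) (@ell_pred R p T) (ell p1 T) ell_closed.

Definition ell_norm (f : ell p1 T) : R := fine (mass f) `^ p^-1.

Lemma ell_mass_fin (f : ell p1 T) : mass f \is a fin_num.
Proof.
by case: f => f /= /asboolP h; rewrite ge0_fin_numE ?ell_mass_ge0.
Qed.

Lemma ell_norm_ge0 f : 0 <= ell_norm f. Proof. exact: powR_ge0. Qed.

Lemma ell_norm_leP (f : ell p1 T) (c : R) : 0 <= c ->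
  (ell_norm f <= c) = (mass f <= (c `^ p)%:E)%E.
Proof.
move=> c0; have hf := ell_mass_fin f; have f0 := ell_mass_ge0 f.
rewrite -ler_powRp ?ell_norm_ge0// powRVK ?fine_ge0//.
by rewrite -[in RHS](fineK hf) lee_fin.
Qed.

Lemma ell_normZ_le (k : R[i]) f : ell_norm (k *: f) <= normc k * ell_norm f.
Proof.
rewrite ell_norm_leP ?mulr_ge0 ?normc_ge0 ?ell_norm_ge0//.
rewrite powRM ?normc_ge0 ?ell_norm_ge0//; apply: ell_massZ.
by rewrite -ell_norm_leP ?ell_norm_ge0.
Qed.

Lemma ell_normZ (k : R[i]) f : ell_norm (k *: f) = normc k * ell_norm f.
Proof.
apply/eqP; rewrite eq_le ell_normZ_le/=.
have [->|k0] := eqVneq k 0; first by rewrite normc0 mul0r ell_norm_ge0.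
have nk0 : 0 < normc k.
  rewrite lt_neqAle normc_ge0 andbT eq_sym.
  by apply: contra k0 => /eqP/eq0_normc ->.
rewrite -ler_pdivlMl// -normcV.
have E : k^-1 *: (k *: f) = f by rewrite scalerA mulVf// scale1r.
by have := ell_normZ_le k^-1 (k *: f); rewrite E.
Qed.

Lemma ler_ell_normD f g : ell_norm (f + g) <= ell_norm f + ell_norm g.
Proof.
apply/ler_addgt0Pl => e e0.
have e2 : 0 < e / 2 by rewrite divr_gt0.
have -> : e + (ell_norm f + ell_norm g) =
    (ell_norm f + e / 2) + (ell_norm g + e / 2).
  by rewrite addrACA -splitr addrC.
have fe : 0 < ell_norm f + e / 2 by rewrite ltr_wpDl ?ell_norm_ge0.
have ge : 0 < ell_norm g + e / 2 by rewrite ltr_wpDl ?ell_norm_ge0.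
rewrite ell_norm_leP; last exact: ltW (addr_gt0 fe ge).
apply: (@ell_massD f g _ _ fe ge).
  rewrite -(ell_norm_leP _ (ltW fe)).
  by rewrite lerDl ltW.
rewrite -(ell_norm_leP _ (ltW ge)).
by rewrite lerDl ltW.
Qed.

Lemma normc_le_ell_norm (f : ell p1 T) x : normc (f x) <= ell_norm f.
Proof.
have := lexx (ell_norm f); rewrite {1}ell_norm_leP ?ell_norm_ge0//.
move=> /ell_mass_leP /(_ [fset x]%fset); rewrite big_seq_fset1.
by rewrite ler_powRp ?normc_ge0 ?ell_norm_ge0.
Qed.

Lemma ell_norm0_eq0 (f : ell p1 T) : ell_norm f = 0 -> f = 0.
Proof.
move=> f0; apply/val_inj/funext => x /=; apply: eq0_normc.
by apply/eqP; rewrite eq_le normc_ge0 andbT -f0 normc_le_ell_norm.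
Qed.

Lemma normc_nat (n : nat) : normc (n%:R : R[i]) = n%:R.
Proof. by rewrite (@normcMn R 1 n) normc1. Qed.

Lemma ell_normMn (f : ell p1 T) n : ell_norm (f *+ n) = ell_norm f *+ n.
Proof. by rewrite -scaler_nat ell_normZ normc_nat mulr_natl. Qed.

Lemma ell_normN (f : ell p1 T) : ell_norm (- f) = ell_norm f.
Proof. by rewrite -scaleN1r ell_normZ (@normcN R 1) normc1 mul1r. Qed.

HB.instance Definition _ := Num.Zmodule_isNormed.Build R (ell p1 T)
  ler_ell_normD ell_norm0_eq0 ell_normMn ell_normN.

Lemma ell_normE (f : ell p1 T) : `|f| = ell_norm f. Proof. by []. Qed.

Lemma ell_normrZ (k : R[i]) (f : ell p1 T) : `|k *: f| = normc k * `|f|.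
Proof. exact: ell_normZ. Qed.

Lemma ell_addE (f g : ell p1 T) x : (f + g) x = f x + g x.
Proof. by []. Qed.

Lemma ell_scaleE (k : R[i]) (f : ell p1 T) x : (k *: f) x = k * f x.
Proof. by []. Qed.

Lemma ell_oppE (f : ell p1 T) x : (- f) x = - f x.
Proof. by []. Qed.

Lemma ell_sumE (I : Type) (r : seq I) (F : I -> ell p1 T) x :
  (\sum_(i <- r) F i) x = \sum_(i <- r) F i x.
Proof. by elim/big_rec2: _ => // i a b _ <-. Qed.

Lemma delta_subproof (y : T) :
  ell_pred p ((fun x => (x == y)%:R) : T -> R[i]^o).
Proof.
apply/ell_predP; exists 1 => //; apply/ell_mass_leP => F; rewrite powR1.
have E x : normc ((x == y)%:R : R[i]) `^ p = (x == y)%:R.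
  by rewrite normc_nat; case: eqP => _; rewrite ?powR1 ?powR0// gt_eqF// p_gt0.
under eq_bigr do rewrite E.
have -> : \sum_(x <- F) (x == y)%:R = (count (pred1 y) F)%:R :> R.
  rewrite -natr_sum -sum1_count [in RHS]big_mkcond/=; congr (_%:R).
by rewrite count_uniq_mem ?fset_uniq// lern1 leq_b1.
Qed.

Definition delta (y : T) : ell p1 T := Ell p1 (delta_subproof y).

Lemma scale_deltaE (k : R[i]) (z x : T) : (k *: delta z) x = k * (x == z)%:R.
Proof. by []. Qed.

Lemma ell_truncation (v : ell p1 T) (e : R) : 0 < e ->
  exists F : {fset T}, `|v - \sum_(z <- F) v z *: delta z| <= e.
Proof.
move=> e0; have vfin := ell_mass_fin v.
have ep : 0 < e `^ p by rewrite powR_gt0.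
have [_ [A [finA _] <-] hA] := @ub_ereal_sup_adherent _ _ _ ep vfin.
exists (fset_set A); set F := fset_set A.
have {}hA : fine (mass v) - e `^ p < \sum_(z <- F) normc (v z) `^ p.
  move: hA; rewrite fsbig_finite//= -[ereal_sup _]/(mass v) -(fineK vfin).
  by rewrite sumEFin -EFinB lte_fin.
have wE x : (v - \sum_(z <- F) v z *: delta z) x = if x \in F then 0 else v x.
  rewrite ell_addE ell_oppE ell_sumE.
  rewrite (eq_bigr (fun z => v z * (x == z)%:R)); last first.
    by move=> z _; rewrite scale_deltaE.
  case: ifPn => xF.
    rewrite (bigD1_seq x)//= eqxx mulr1 big1 ?addr0 ?subrr//.
    by move=> z zx; rewrite eq_sym (negbTE zx) mulr0.
  rewrite big_seq big1 ?subr0// => z zF.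
  by case: eqP => [xz|]; rewrite ?mulr0//; rewrite -xz (negbTE xF) in zF.
rewrite ell_normE ell_norm_leP ?(ltW e0)//; apply/ell_mass_leP => G.
under eq_bigr do rewrite wE.
rewrite (bigID (mem F))/= big1 => [|x ->]; last first.
  by rewrite normc0 powR0// gt_eqF// p_gt0.
rewrite add0r (eq_bigr (fun x => normc (v x) `^ p)); last first.
  by move=> x /negbTE ->.
have /ell_mass_leP/(_ (G `|` F)%fset) : (mass v <= (fine (mass v))%:E)%E.
  by rewrite fineK.
have -> : \sum_(x <- (G `|` F)%fset) normc (v x) `^ p =
   \sum_(x <- G | x \notin F) normc (v x) `^ p + \sum_(x <- F) normc (v x) `^ p.
  rewrite (bigID (mem F))/= addrC; congr (_ + _).
    rewrite -big_filter -[RHS]big_filter; apply: perm_big.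
    apply: uniq_perm; rewrite ?filter_uniq// => x.
    by rewrite !mem_filter in_fsetU; case: (x \in F); rewrite ?orbF.
  rewrite -big_filter; apply: perm_big.
  apply: uniq_perm; rewrite ?filter_uniq// => x.
  by rewrite !mem_filter in_fsetU; case: (x \in F); rewrite ?orbT.
move=> h; rewrite -(lerD2r (\sum_(z <- F) normc (v z) `^ p)).
by apply: le_trans h _; rewrite -lerBlDl ltW.
Qed.

End EllTheory.

Definition bounded_linear (R : realType) (p : R) (p1 : 1 <= p) (T : choiceType)
    (S : ell p1 T -> ell p1 T) : Prop :=
  linear S /\ exists C : R, forall u, `|S u| <= C * `|u|.

Definition bounded_linear_pred (R : realType) (p : R) (p1 : 1 <= p)
    (T : choiceType) : {pred ell p1 T -> ell p1 T} :=
  fun S => `[< bounded_linear S >].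

(* The algebra B(l^p(T)); its product is composition and its norm `|S| is the
   operator norm opnorm. *)
Record ell_op (R : realType) (p : R) (p1 : 1 <= p) (T : choiceType) := EllOp {
  op_fun :> ell p1 T -> ell p1 T ;
  _ : bounded_linear_pred op_fun }.

Section Operators.
Context {R : realType} {p : R} {p1 : 1 <= p} {T : choiceType}.
Local Notation ellT := (ell p1 T).
Local Notation op := (ell_op p1 T).

HB.instance Definition _ := [isSub for @op_fun R p p1 T].
HB.instance Definition _ := [Choice of ell_op p1 T by <:].

Lemma ell_op_linear (S : op) : linear S.
Proof. by case: S => S /= /asboolP[]. Qed.

HB.instance Definition _ (S : op) :=
  GRing.isLinear.Build R[i] ellT ellT *:%R (op_fun S) (ell_op_linear S).

Lemma ell_op_bounded (S : op) :
  exists2 C : R, 0 <= C & forall u, `|S u| <= C * `|u|.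
Proof.
case: S => S /= /asboolP[_ [C SC]]; exists `|C| => // u.
by apply: le_trans (SC u) _; rewrite ler_wpM2r// ler_norm.
Qed.

Definition opnorm (S : op) : R :=
  inf [set C : R | 0 <= C /\ forall u : ellT, `|S u| <= C * `|u|].

Lemma opnorm_has_inf (S : op) :
  has_inf [set C : R | 0 <= C /\ forall u : ellT, `|S u| <= C * `|u|].
Proof.
split; last by exists 0 => C [].
by have [C C0 SC] := ell_op_bounded S; exists C.
Qed.

Lemma opnorm_ge0 (S : op) : 0 <= opnorm S.
Proof. by apply: lb_le_inf; [case: (opnorm_has_inf S)|move=> C []]. Qed.

Lemma opnorm_le (S : op) (C : R) : 0 <= C ->
  (forall u, `|S u| <= C * `|u|) -> opnorm S <= C.
Proof. by move=> C0 SC; apply: ge_inf => //; case: (opnorm_has_inf S). Qed.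

Lemma opnormP (S : op) u : `|S u| <= opnorm S * `|u|.
Proof.
have [u0|u0] := eqVneq `|u| 0.
  have -> : u = 0 by exact: normr0_eq0.
  by rewrite raddf0 !normr0 mulr0.
have u_gt0 : 0 < `|u| by rewrite lt_neqAle eq_sym u0 normr_ge0.
rewrite -ler_pdivrMr//; apply: lb_le_inf; first by case: (opnorm_has_inf S).
by move=> C [C0 SC]; rewrite ler_pdivrMr.
Qed.

Lemma ell_op_closed : GRing.subsemimod_closed (@bounded_linear_pred R p p1 T).
Proof.
split; first split.
- apply/asboolP; split; last by exists 0 => u; rewrite normr0 mul0r.
  by move=> k u v /=; rewrite scaler0 addr0.
- move=> S S' /asboolP[Sl [C SC]] /asboolP[S'l [C' SC']]; apply/asboolP; split.
    move=> k u v; rewrite -[LHS]/(S (k *: u + v) + S' (k *: u + v)) Sl S'l.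
    by rewrite addrACA -scalerDr.
  exists (C + C') => u; rewrite mulrDl.
  by apply: le_trans (ler_normD _ _) _; rewrite lerD.
- move=> k S /asboolP[Sl [C SC]]; apply/asboolP; split.
    move=> l u v; rewrite -[LHS]/(k *: S (l *: u + v)) Sl scalerDr.
    by rewrite scalerA mulrC -scalerA.
  exists (normc k * C) => u; rewrite -[leLHS]/(`|k *: S u|) ell_normrZ -mulrA.
  by rewrite ler_wpM2l ?normc_ge0.
Qed.

HB.instance Definition _ := GRing.SubChoice_isSubLmodule.Build R[i]
  (ellT -> ellT) (@bounded_linear_pred R p p1 T) (ell_op p1 T) ell_op_closed.

Lemma op_addE (S S' : op) u : (S + S') u = S u + S' u. Proof. by []. Qed.
Lemma op_oppE (S : op) u : (- S) u = - S u. Proof. by []. Qed.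
Lemma op_scaleE (k : R[i]) (S : op) u : (k *: S) u = k *: S u.
Proof. by []. Qed.

Lemma op_one_subproof : bounded_linear_pred (idfun : ellT -> ellT).
Proof. by apply/asboolP; split=> //; exists 1 => u; rewrite mul1r. Qed.

Definition op_one : op := EllOp op_one_subproof.

Lemma op_mul_subproof (S S' : op) :
  bounded_linear_pred (S \o S' : ellT -> ellT).
Proof.
apply/asboolP; split=> [k u v|]; first by rewrite /= !linearP.
exists (opnorm S * opnorm S') => u /=.
apply: le_trans (opnormP _ _) _; rewrite -mulrA ler_wpM2l ?opnorm_ge0//.
exact: opnormP.
Qed.

Definition op_mul (S S' : op) : op := EllOp (op_mul_subproof S S').

Lemma op_mulA : associative op_mul.
Proof. by move=> A B C; apply/val_inj. Qed.
Lemma op_mul1r : left_id op_one op_mul.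
Proof. by move=> A; apply/val_inj. Qed.
Lemma op_mulr1 : right_id op_one op_mul.
Proof. by move=> A; apply/val_inj. Qed.
Lemma op_mulDl : left_distributive op_mul +%R.
Proof. by move=> A B C; apply/val_inj. Qed.
Lemma op_mulDr : right_distributive op_mul +%R.
Proof. by move=> A B C; apply/val_inj/funext => u; exact: raddfD. Qed.

HB.instance Definition _ := GRing.Zmodule_isPzRing.Build (ell_op p1 T)
  op_mulA op_mul1r op_mulr1 op_mulDl op_mulDr.

Lemma op_mulE (S S' : op) u : (S * S') u = S (S' u). Proof. by []. Qed.
Lemma op_oneE u : (1 : op) u = u. Proof. by []. Qed.

Lemma op_scalerAl (k : R[i]) (S S' : op) : k *: (S * S') = (k *: S) * S'.
Proof. by apply/val_inj. Qed.

Lemma op_scalerAr (k : R[i]) (S S' : op) : k *: (S * S') = S * (k *: S').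
Proof.
by apply/val_inj/funext => u; rewrite /= -[RHS]/(S (k *: S' u)) linearZ.
Qed.

Lemma opnormD (S S' : op) : opnorm (S + S') <= opnorm S + opnorm S'.
Proof.
apply: opnorm_le => [|u]; first by rewrite addr_ge0 ?opnorm_ge0.
by rewrite mulrDl; apply: le_trans (ler_normD _ _) _; rewrite lerD ?opnormP.
Qed.

Lemma opnormM (S S' : op) : opnorm (S * S') <= opnorm S * opnorm S'.
Proof.
apply: opnorm_le => [|u]; first by rewrite mulr_ge0 ?opnorm_ge0.
rewrite -mulrA; apply: (le_trans (opnormP S (S' u))).
by rewrite ler_wpM2l ?opnorm_ge0 ?opnormP.
Qed.

Lemma opnorm0_eq0 (S : op) : opnorm S = 0 -> S = 0.
Proof.
move=> S0; apply/val_inj/funext => u; apply: normr0_eq0.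
by apply/eqP; rewrite eq_le normr_ge0 andbT; have := opnormP S u;
   rewrite S0 mul0r.
Qed.

Lemma opnormZ_le (k : R[i]) (S : op) : opnorm (k *: S) <= normc k * opnorm S.
Proof.
apply: opnorm_le => [|u]; first by rewrite mulr_ge0 ?opnorm_ge0 ?normc_ge0.
rewrite -[leLHS]/(`|k *: S u|) ell_normrZ -mulrA.
by rewrite ler_wpM2l ?normc_ge0 ?opnormP.
Qed.

Lemma opnormZ (k : R[i]) (S : op) : opnorm (k *: S) = normc k * opnorm S.
Proof.
apply/eqP; rewrite eq_le opnormZ_le/=.
have [->|k0] := eqVneq k 0; first by rewrite normc0 mul0r opnorm_ge0.
have nk0 : 0 < normc k.
  rewrite lt_neqAle normc_ge0 andbT eq_sym.
  by apply: contra k0 => /eqP/eq0_normc ->.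
rewrite -ler_pdivlMl// -normcV.
have E : k^-1 *: (k *: S) = S by rewrite scalerA mulVf// scale1r.
by have := opnormZ_le k^-1 (k *: S); rewrite E.
Qed.

Lemma opnormMn (S : op) n : opnorm (S *+ n) = opnorm S *+ n.
Proof. by rewrite -scaler_nat opnormZ normc_nat mulr_natl. Qed.

Lemma opnormN (S : op) : opnorm (- S) = opnorm S.
Proof. by rewrite -scaleN1r opnormZ (@normcN R 1) normc1 mul1r. Qed.

HB.instance Definition _ := Num.Zmodule_isNormed.Build R (ell_op p1 T)
  opnormD opnorm0_eq0 opnormMn opnormN.

Lemma op_normE (S : op) : `|S| = opnorm S. Proof. by []. Qed.

Definition op_entry (S : op) (x y : T) : R[i] := S (delta p1 y) x.

Lemma op_mul_entry_neq0 (S S' : op) x y : op_entry (S * S') x y != 0 ->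
  exists z, op_entry S x z != 0 /\ op_entry S' z y != 0.
Proof.
move=> h; apply: contrapT => /forallNP none; move/negP: h; apply.
apply/eqP/eq0_normc/eqP; rewrite eq_le normc_ge0 andbT.
set v := S' (delta p1 y).
apply/ler_addgt0Pl => e e0; rewrite addr0.
have n0 : 0 < opnorm S + 1 by rewrite ltr_wpDl ?opnorm_ge0.
have [F vF] := @ell_truncation R p p1 T v _ (divr_gt0 e0 n0).
have SF : (S (\sum_(z <- F) v z *: delta p1 z)) x = 0.
  rewrite raddf_sum ell_sumE big1// => z _.
  have Sx (k : R[i]) w : S (k *: w) x = k * S w x by rewrite linearZ.
  apply: etrans (Sx (v z) (delta p1 z)) _.
  have [-> | vz] := eqVneq (v z) 0; first by rewrite mul0r.
  have [-> | Sz] := eqVneq (S (delta p1 z) x) 0; first by rewrite mulr0.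
  by case: (none z).
rewrite -[X in normc X]/(S v x).
have -> : S v x = S (v - \sum_(z <- F) v z *: delta p1 z) x.
  by rewrite raddfB ell_addE ell_oppE SF subr0.
apply: le_trans (normc_le_ell_norm _ _) _.
apply: (le_trans (opnormP S _)).
apply: (@le_trans _ _ ((opnorm S + 1) * (e / (opnorm S + 1)))).
  by rewrite ler_pM ?opnorm_ge0// lerDl.
by rewrite mulrCA mulfV ?gt_eqF// mulr1.
Qed.

End Operators.

(* prop(S), a value in [0, +oo]; adjoining 0 to the set fixes prop(0) = 0, the
   supremum of set0 in \bar R being -oo. *)
Definition propagation (R : realType) (p : R) (p1 : 1 <= p) (X : metricType R)
    (S : ell_op p1 X) : \bar R :=
  ereal_sup (0%E |` [set (mdist xy.1 xy.2)%:E |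
                     xy in [set xy : X * X | op_entry S xy.1 xy.2 != 0]]).

Definition finite_propagation (R : realType) (p : R) (p1 : 1 <= p)
    (X : metricType R) (S : ell_op p1 X) : Prop :=
  (propagation S < +oo)%E.

Definition roe_pred (R : realType) (p : R) (p1 : 1 <= p) (X : metricType R) :
    {pred ell_op p1 X} :=
  fun S => `[< forall e : R, 0 < e ->
    exists2 S' : ell_op p1 X, finite_propagation S' & `|S - S'| < e >].

Record uniform_roe (R : realType) (p : R) (p1 : 1 <= p) (X : metricType R) :=
  UniformRoe { roe_op :> ell_op p1 X ; _ : roe_pred roe_op }.

Section UniformRoeTheory.
Context {R : realType} {p : R} {p1 : 1 <= p} {X : metricType R}.
Local Notation op := (ell_op p1 X).

HB.instance Definition _ := [isSub for @roe_op R p p1 X].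
HB.instance Definition _ := [Choice of uniform_roe p1 X by <:].

Lemma finite_propagationP (S : op) : finite_propagation S <->
  exists r : R, forall x y : X, op_entry S x y != 0 -> mdist x y <= r.
Proof.
split=> [h|[r Sr]].
  exists (fine (propagation S)) => x y Sxy.
  have mem : ((mdist x y)%:E <= propagation S)%E.
    by apply: ereal_sup_ubound; right; exists (x, y).
  have p0 : (0 <= propagation S)%E by apply: ereal_sup_ubound; left.
  by rewrite -lee_fin fineK// ge0_fin_numE.
apply: (@le_lt_trans _ _ (Num.max 0 r)%:E); last exact: ltry.
apply: ge_ereal_sup => _ [->|[[x y] /= Sxy <-]]; rewrite lee_fin le_max.
  by rewrite lexx.
by rewrite Sr// orbT.
Qed.

Lemma op_entryD (S S' : op) x y :
  op_entry (S + S') x y = op_entry S x y + op_entry S' x y.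
Proof. by []. Qed.

Lemma op_entryZ (k : R[i]) (S : op) x y :
  op_entry (k *: S) x y = k * op_entry S x y.
Proof. by []. Qed.

Lemma finite_propagation0 : finite_propagation (0 : op).
Proof. by apply/finite_propagationP; exists 0 => x y; rewrite eqxx. Qed.

Lemma finite_propagation1 : finite_propagation (1 : op).
Proof.
apply/finite_propagationP; exists 0 => x y; rewrite /op_entry op_oneE /=.
by have [->|] := eqVneq x y; rewrite ?mdistxx// eqxx.
Qed.

Lemma finite_propagationD (S S' : op) : finite_propagation S ->
  finite_propagation S' -> finite_propagation (S + S').
Proof.
move=> /finite_propagationP[r Sr] /finite_propagationP[r' Sr'].
apply/finite_propagationP; exists (Num.max r r') => x y.
rewrite op_entryD le_max => h.
have [S0|/Sr ->//] := eqVneq (op_entry S x y) 0.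
by rewrite (Sr' x y) ?orbT//; rewrite S0 add0r in h.
Qed.

Lemma finite_propagationZ (k : R[i]) (S : op) :
  finite_propagation S -> finite_propagation (k *: S).
Proof.
move=> /finite_propagationP[r Sr]; apply/finite_propagationP; exists r => x y.
rewrite op_entryZ => h; apply: Sr; apply: contraNN h => /eqP ->.
by rewrite mulr0.
Qed.

Lemma finite_propagationM (S S' : op) : finite_propagation S ->
  finite_propagation S' -> finite_propagation (S * S').
Proof.
move=> /finite_propagationP[r Sr] /finite_propagationP[r' Sr'].
apply/finite_propagationP; exists (r + r') => x y.
move=> /op_mul_entry_neq0[z [/Sr xz /Sr' zy]].
by apply: le_trans (metric_triangle _ z _) _; rewrite lerD.
Qed.

Local Notation roeX := (@roe_pred R p p1 X).

Lemma finite_propagation_roe (S : op) : finite_propagation S -> roeX S.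
Proof.
by move=> h; apply/asboolP => e e0; exists S; rewrite // subrr normr0.
Qed.

Lemma roe_predD (S S' : op) : roeX S -> roeX S' -> roeX (S + S').
Proof.
move=> /asboolP hS /asboolP hS'; apply/asboolP => e e0.
have e2 : 0 < e / 2 by rewrite divr_gt0.
have [A Af AS] := hS _ e2; have [B Bf BS] := hS' _ e2.
exists (A + B); first exact: finite_propagationD.
rewrite opprD addrACA [e]splitr.
exact: le_lt_trans (ler_normD (S - A) (S' - B)) (ltrD AS BS).
Qed.

Lemma mulr_lt_div1 (a b e : R) : 0 <= a -> 0 <= b -> a < e / (b + 1) ->
  a * b < e.
Proof.
move=> a0 b0; rewrite ltr_pdivlMr ?ltr_wpDl// => h.
by apply: le_lt_trans h; rewrite ler_wpM2l// lerDl.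
Qed.

Lemma roe_predZ (k : R[i]) (S : op) : roeX S -> roeX (k *: S).
Proof.
move=> /asboolP hS; apply/asboolP => e e0.
have k1 : 0 < normc k + 1 by rewrite ltr_wpDl ?normc_ge0.
have [A Af AS] := hS _ (divr_gt0 e0 k1).
exists (k *: A); first exact: finite_propagationZ.
rewrite -scalerBr op_normE opnormZ mulrC.
exact: (mulr_lt_div1 (opnorm_ge0 (S - A)) (normc_ge0 k) AS).
Qed.

Lemma roe_predM (S S' : op) : roeX S -> roeX S' -> roeX (S * S').
Proof.
move=> /asboolP hS /asboolP hS'; apply/asboolP => e e0.
have e2 : 0 < e / 2 by rewrite divr_gt0.
have n1 : 0 < `|S'| + 1 by rewrite ltr_wpDl.
have [A Af AS] := hS _ (divr_gt0 e2 n1).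
have n2 : 0 < `|A| + 1 by rewrite ltr_wpDl.
have [B Bf BS] := hS' _ (divr_gt0 e2 n2).
exists (A * B); first exact: finite_propagationM.
have -> : S * S' - A * B = (S - A) * S' + A * (S' - B).
  by rewrite mulrBl mulrBr addrA subrK.
rewrite [e]splitr.
apply: (le_lt_trans (ler_normD ((S - A) * S') (A * (S' - B)))); apply: ltrD.
  apply: (le_lt_trans (opnormM (S - A) S')).
  exact: (mulr_lt_div1 (opnorm_ge0 (S - A)) (opnorm_ge0 S') AS).
apply: (le_lt_trans (opnormM A (S' - B))); rewrite mulrC.
exact: (mulr_lt_div1 (opnorm_ge0 (S' - B)) (opnorm_ge0 A) BS).
Qed.

Lemma roe_subring_closed : GRing.subring_closed roeX.
Proof.
split; first exact/finite_propagation_roe/finite_propagation1.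
  move=> S S' hS hS'; apply: (roe_predD hS).
  by rewrite -scaleN1r; exact: (roe_predZ _ hS').
by move=> S S'; exact: roe_predM.
Qed.

Lemma roe_submod_closed : GRing.subsemimod_closed roeX.
Proof.
split; first split; first exact/finite_propagation_roe/finite_propagation0.
  by move=> S S'; exact: roe_predD.
by move=> k S; exact: roe_predZ.
Qed.

HB.instance Definition _ := GRing.SubChoice_isSubPzRing.Build
  (ell_op p1 X) roeX (uniform_roe p1 X) roe_subring_closed.
HB.instance Definition _ := GRing.SubZmodule_isSubLmodule.Build R[i]
  (ell_op p1 X) roeX (uniform_roe p1 X) roe_submod_closed.

Definition roe_norm (a : uniform_roe p1 X) : R := `|roe_op a|.

Lemma ler_roe_normD a b : roe_norm (a + b) <= roe_norm a + roe_norm b.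
Proof. exact: ler_normD. Qed.
Lemma roe_norm0_eq0 a : roe_norm a = 0 -> a = 0.
Proof. by move=> /normr0_eq0 a0; apply/val_inj. Qed.
Lemma roe_normMn a n : roe_norm (a *+ n) = roe_norm a *+ n.
Proof. by rewrite /roe_norm -[roe_op _]/(val (a *+ n)) raddfMn normrMn. Qed.
Lemma roe_normN a : roe_norm (- a) = roe_norm a.
Proof. exact: normrN. Qed.

HB.instance Definition _ := Num.Zmodule_isNormed.Build R (uniform_roe p1 X)
  ler_roe_normD roe_norm0_eq0 roe_normMn roe_normN.

End UniformRoeTheory.

Definition bounded_geometry (R : realType) (X : metricType R) : Prop :=
  forall r : R, 0 < r ->
    exists N : nat, forall x : X, ([set y : X | mdist x y <= r] #<= `I_N)%card.

Definition set_diam (R : realType) (X : metricType R) (A : set X) : \bar R :=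
  ereal_sup [set (mdist xy.1 xy.2)%:E | xy in A `*` A].

Definition set_dist (R : realType) (X : metricType R) (A B : set X) : \bar R :=
  ereal_inf [set (mdist xy.1 xy.2)%:E | xy in A `*` B].

Definition asymptotic_dimension_zero (R : realType) (X : metricType R) : Prop :=
  forall r : R, 0 < r -> exists P : set (set X),
    [/\ \bigcup_(A in P) A = [set: X],
        trivIset P id,
        exists D : R, forall A, P A -> (set_diam A <= D%:E)%E &
        forall A B, P A -> P B -> A <> B -> (r%:E < set_dist A B)%E].

Section Subalgebras.
Context {R : realType} {p : R} (p1 : 1 <= p) (X : metricType R).
Local Notation Bu := (uniform_roe p1 X).

(* Not required to contain the unit of B^p_u(X). *)
Definition is_subalgebra (D : set Bu) : Prop :=
  [/\ D 0,
      forall a b, D a -> D b -> D (a + b),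
      forall (k : R[i]) a, D a -> D (k *: a) &
      forall a b, D a -> D b -> D (a * b)].

(* M_d^p is ell_op p1 'I_d, and the direct sum of the M_(d k)^p is the type of
   families (a k) with the pointwise operations and the maximum norm. The empty
   sum, the zero algebra, is allowed: it is B^p_u(X) for X empty. *)
Definition isometric_to_matrix_sum (D : set Bu) : Prop :=
  exists (N : nat) (d : 'I_N -> nat)
         (phi : (forall k : 'I_N, ell_op p1 'I_(d k)) -> Bu),
    (forall k, (0 < d k)%N) /\
    [/\ forall a b, phi (fun k => a k + b k) = phi a + phi b,
        forall (c : R[i]) a, phi (fun k => c *: a k) = c *: phi a,
        forall a b, phi (fun k => a k * b k) = phi a * phi b,
        forall a, `|phi a| = \big[Num.max/0]_(k < N) `|a k| &
        range phi = D].

Definition is_inductive_limit_of (K : set Bu -> Prop) : Prop :=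
  exists F : set (set Bu),
    [/\ forall D, F D -> is_subalgebra D /\ K D,
        F !=set0,
        forall D D', F D -> F D' ->
          exists D'', [/\ F D'', D `<=` D'' & D' `<=` D''] &
        forall (a : Bu) (e : R), 0 < e ->
          exists2 b, (\bigcup_(D in F) D) b & `|a - b| < e].

End Subalgebras.

Section Cancellation.
Context (A : pzRingType).

Definition is_idempotent (e : A) : Prop := e * e = e.

Definition alg_equiv (e f : A) : Prop :=
  exists x y : A, e = x * y /\ f = y * x.

Definition orthogonal_idem (e f : A) : Prop := e * f = 0 /\ f * e = 0.

Definition has_idempotent_cancellation : Prop :=
  forall e f g h : A,
    is_idempotent e -> is_idempotent f -> is_idempotent g -> is_idempotent h ->
    orthogonal_idem e g -> orthogonal_idem f h ->
    alg_equiv e f -> alg_equiv (e + g) (f + h) -> alg_equiv g h.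

End Cancellation.

(* The case n = 0 is trivial. *)
Definition has_cancellation (A : pzRingType) : Prop :=
  forall n : nat, has_idempotent_cancellation 'M[A]_n.

(* Main.v *)
Require Import Defs.
From HB Require Import structures.
From mathcomp Require Import all_boot all_order all_algebra.
From mathcomp Require Import complex finmap.
From mathcomp Require Import all_classical all_reals all_analysis.
From mathcomp Require Import ring lra.

(** The three conditions are linked by three independent arguments.

    From asymptotic dimension zero to the inductive limit. At every scale the
    space splits into uniformly finite blocks that are far apart, so an operator
    of finite propagation is block diagonal, with blocks of bounded size. Number
    the points of each block and round the matrix entries to a finite net: only
    finitely many different blocks remain. The operators that are constant on
    blocks of the same kind form a finite direct sum of matrix algebras, and the
    norm is the maximum because an l^p operator that preserves a partition has the
    norm of its worst block. The combinatorial datum is a labelled partition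
    ([frame]): its algebra is a matrix sum ([frame_isometric]), labels can be
    enriched by any finite-valued kernel ([frame_refinement]), and such an
    enrichment gives both directedness ([frames_directed]) and density
    ([frames_dense]).

    From the inductive limit to cancellation. Matrices over a finite sum of matrix
    algebras cancel, because idempotent matrices are classified by their rank and
    ranks add along orthogonal sums. Cancellation survives the limit by the
    stability of idempotents in a complete normed ring: an almost idempotent
    element of a closed subring lies close to an idempotent of that subring
    ([newton_idempotent]), close idempotents are equivalent ([close_equiv]), and an
    equivalence between idempotents of the union is realised in a member of the
    family ([alg_equiv_descends]). The subalgebras need not contain the unit, so
    every inverse is taken in a corner ([corner_inverse]).

    From cancellation to asymptotic dimension zero. If the dimension is positive,
    there are disjoint chains with steps of a fixed length whose endpoints are
    farther and farther apart ([chain_sequence]). Moving every point of a chain to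
    the next one is a partial translation, so the projections onto the chains
    without their last points and without their first points are equivalent. Both
    are completed to the projection onto the union of the chains, by the projection
    onto the set B of last points and onto the set A of first points. Cancellation
    would make these two equivalent, which is impossible because a finite
    propagation operator cannot connect A to B at the far chains
    ([projections_not_equiv]). *)

Set Implicit Arguments.
Unset Strict Implicit.
Unset Printing Implicit Defensive.

Import Order.TTheory GRing.Theory Num.Theory.
Import ComplexField.Normc.

Local Open Scope classical_set_scope.
Local Open Scope complex_scope.
Local Open Scope ring_scope.

(** * Operators on l^p spaces and their matrix entries *)

Section EllOperators.
Context {R : realType} {p : R} {p1 : 1 <= p} {T : choiceType}.
Local Notation ellT := (ell p1 T).
Local Notation op := (ell_op p1 T).
Local Notation mass := (ell_mass p).

Lemma ell_eqP (u v : ellT) : (forall x, u x = v x) -> u = v.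
Proof. by move=> uv; apply/val_inj/funext. Qed.

Lemma ell_exists (f : T -> R[i]^o) (b : R) : 0 <= b ->
  (mass f <= (b `^ p)%:E)%E ->
  {u : ellT | (forall x, u x = f x) & `|u| <= b}.
Proof.
move=> b0 fb.
have fP : ell_pred p f by apply/asboolP/(le_lt_trans fb)/ltry.
by exists (Ell p1 fP); rewrite ?ell_normE ?ell_norm_leP.
Qed.

Lemma ell_op_exists (f : ellT -> T -> R[i]^o) (b : R) : 0 <= b ->
  (forall x k u v, f (k *: u + v) x = k * f u x + f v x) ->
  (forall u, mass (f u) <= ((b * `|u|) `^ p)%:E)%E ->
  {S : op | (forall u x, S u x = f u x) & `|S| <= b}.
Proof.
move=> b0 flin fb.
have gP u : {v : ellT | (forall x, v x = f u x) & `|v| <= b * `|u|}.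
  by apply: ell_exists; rewrite ?mulr_ge0.
pose g u := s2val (gP u).
have gE u x : g u x = f u x by rewrite /g; case: (gP u).
have gb u : `|g u| <= b * `|u| by rewrite /g; case: (gP u).
have gl : bounded_linear_pred g.
  apply/asboolP; split; last by exists b.
  move=> k u v; apply: ell_eqP => x.
  by rewrite gE flin -(gE u) -(gE v).
by exists (EllOp gl) => //; apply: opnorm_le.
Qed.

Lemma op_scale_at (S : op) k u x : S (k *: u) x = k * S u x.
Proof. by rewrite linearZ. Qed.

(** Row x of S sees the tail of v only up to the operator norm, so finitely
    supported truncations of v decide the value. *)
Lemma op_row_eq0 (S : op) (v : ellT) x :
  (forall y, op_entry S x y != 0 -> v y = 0) -> S v x = 0.
Proof.
move=> Sv; apply: eq0_normc.
apply/eqP; rewrite eq_le normc_ge0 andbT.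
apply/ler_addgt0Pl => e e0; rewrite addr0.
have n0 : 0 < opnorm S + 1 by rewrite ltr_wpDl ?opnorm_ge0.
have [F vF] := @ell_truncation R p p1 T v _ (divr_gt0 e0 n0).
have SF : (S (\sum_(z <- F) v z *: delta p1 z)) x = 0.
  rewrite raddf_sum ell_sumE big1// => z _.
  apply: etrans (op_scale_at _ _ _ _) _; rewrite -/(op_entry S x z).
  by have [->|/Sv ->] := eqVneq (op_entry S x z) 0; rewrite ?mulr0 ?mul0r.
have -> : S v x = S (v - \sum_(z <- F) v z *: delta p1 z) x.
  by rewrite raddfB ell_addE ell_oppE SF subr0.
apply: le_trans (normc_le_ell_norm _ _) _.
apply: (le_trans (opnormP S _)).
apply: (@le_trans _ _ ((opnorm S + 1) * (e / (opnorm S + 1)))).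
  by rewrite ler_pM ?opnorm_ge0// lerDl.
by rewrite mulrCA mulfV ?gt_eqF// mulr1.
Qed.

Lemma sum_deltaE (s : seq T) (c : T -> R[i]) x : uniq s ->
  (\sum_(y <- s) c y *: delta p1 y) x = if x \in s then c x else 0.
Proof.
move=> s_uniq; rewrite ell_sumE.
rewrite (eq_bigr (fun y => c y * (x == y)%:R)); last by [].
case: ifPn => xs.
  rewrite (bigD1_seq x)//= eqxx mulr1 big1 ?addr0// => z zx.
  by rewrite eq_sym (negbTE zx) mulr0.
rewrite big_seq big1// => z zs.
by case: eqP => [xz|]; rewrite ?mulr0//; rewrite -xz (negbTE xs) in zs.
Qed.

Lemma op_row_sum (S : op) (v : ellT) x (s : seq T) : uniq s ->
  (forall y, op_entry S x y != 0 -> v y != 0 -> y \in s) ->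
  S v x = \sum_(y <- s) op_entry S x y * v y.
Proof.
move=> s_uniq Ss.
have : S (v - \sum_(y <- s) v y *: delta p1 y) x = 0.
  apply: op_row_eq0 => y Sxy; rewrite ell_addE ell_oppE sum_deltaE//.
  case: ifPn => [_|ys]; first by rewrite subrr.
  rewrite subr0; apply/eqP; apply: contraNT ys; exact: Ss.
rewrite raddfB ell_addE ell_oppE => /eqP; rewrite subr_eq0 => /eqP ->.
rewrite raddf_sum ell_sumE; apply: eq_bigr => y _.
by rewrite mulrC; exact: op_scale_at.
Qed.

Lemma op_eqP (S S' : op) :
  (forall x y, op_entry S x y = op_entry S' x y) -> S = S'.
Proof.
move=> SS'; apply/val_inj/funext => v; apply: ell_eqP => x.
apply/eqP; rewrite -subr_eq0; apply/eqP.
rewrite -[LHS]/((S - S') v x); apply: op_row_eq0 => y.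
by rewrite /op_entry -[_ _ x]/(op_entry S x y - op_entry S' x y) SS' subrr eqxx.
Qed.

Lemma norm_delta_le1 (y : T) : `|delta p1 y| <= 1.
Proof.
rewrite ell_normE ell_norm_leP// powR1; apply/ell_mass_leP => F.
have E x : normc (delta p1 y x) `^ p = (x == y)%:R.
  rewrite [delta p1 y x]/((x == y)%:R) normc_nat; case: eqP => _.
    by rewrite powR1.
  by rewrite powR0// gt_eqF// p_gt0.
under eq_bigr do rewrite E.
have -> : \sum_(x <- F) (x == y)%:R = (count (pred1 y) F)%:R :> R.
  by rewrite -natr_sum -sum1_count [in RHS]big_mkcond/=.
by rewrite count_uniq_mem ?fset_uniq// lern1 leq_b1.
Qed.

Lemma norm_sum_delta_le (s : seq T) (c : T -> R[i]) :
  `|\sum_(y <- s) c y *: delta p1 y| <= \sum_(y <- s) normc (c y).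
Proof.
apply: le_trans (ler_norm_sum _ _ _) _; apply: ler_sum => y _.
by rewrite ell_normrZ ler_piMr ?normc_ge0 ?norm_delta_le1.
Qed.

Lemma op_entry_le (S : op) x y : normc (op_entry S x y) <= `|S|.
Proof.
apply: le_trans (normc_le_ell_norm _ _) _.
apply: le_trans (opnormP _ _) _.
by rewrite ler_piMr ?opnorm_ge0 ?norm_delta_le1.
Qed.

Lemma sum_powR_le_norm (u : ellT) (s : seq T) : uniq s ->
  \sum_(x <- s) normc (u x) `^ p <= `|u| `^ p.
Proof.
move=> s_uniq; have := lexx `|u|; rewrite {1}ell_normE ell_norm_leP//.
move=> /ell_mass_leP /(_ [fset x in s]%fset); apply: le_trans.
rewrite le_eqVlt; apply/orP; left; apply/eqP; apply: perm_big.
by apply: uniq_perm; rewrite ?fset_uniq// => x; rewrite inE.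
Qed.

End EllOperators.

(** * Completeness *)

Section GeometricSequences.
Context {R : realType}.
Local Notation h := (2^-1 : R).

Lemma halfX_ge0 k : 0 <= h ^+ k.
Proof. by rewrite exprn_ge0// invr_ge0. Qed.

Lemma halfX_eventually (c e : R) : 0 < e -> exists k, c * h ^+ k <= e.
Proof.
move=> e0; exists (Num.bound `|c / e|); set k := Num.bound _.
rewrite exprVn ler_pdivrMr ?exprn_gt0// mulrC -ler_pdivrMr//.
apply: (@le_trans _ _ k%:R).
  by apply: le_trans (ler_norm _) _; exact/ltW/archi_boundP.
by rewrite -natrX ler_nat ltnW// ltn_expl.
Qed.

Lemma le_halfX (a b c : R) : (forall k, a <= b + c * h ^+ k) -> a <= b.
Proof.
move=> abc; apply/ler_addgt0Pr => e e0.
have [k ck] := halfX_eventually c e0.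
by apply: le_trans (abc k) _; rewrite lerD2l.
Qed.

(** Completeness is used only for sequences with steps bounded by c / 2^k, whose
    tails are explicit. *)
Lemma geometric_tail (V : zmodType) (nm : V -> R) (u : nat -> V) (c : R) :
  nm 0 = 0 -> (forall a, 0 <= nm a) ->
  (forall a b, nm (a + b) <= nm a + nm b) ->
  (forall k, nm (u k.+1 - u k) <= c * h ^+ k) ->
  forall k j, nm (u (k + j)%N - u k) <= 2 * c * h ^+ k.
Proof.
move=> nm0 nm_ge0 nmD uc k j.
have c0 : 0 <= c by have := uc 0; rewrite expr0 mulr1; apply: le_trans.
apply: (@le_trans _ _ (2 * c * h ^+ k * (1 - h ^+ j))); last first.
  apply: ler_piMr; first by rewrite !mulr_ge0// halfX_ge0.
  by rewrite lerBlDr lerDl halfX_ge0.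
elim: j => [|j IHj]; first by rewrite addn0 subrr nm0 expr0 subrr mulr0.
have -> : u (k + j.+1)%N - u k =
    (u (k + j).+1 - u (k + j)%N) + (u (k + j)%N - u k).
  by rewrite addnS addrA subrK.
apply: le_trans (nmD _ _) _; apply: le_trans (lerD (uc _) IHj) _.
have h2 : h * 2 = 1 by rewrite mulVf.
rewrite exprD [h ^+ j.+1]exprS le_eqVlt; apply/orP; left; apply/eqP.
by field.
Qed.

Lemma real_geometric_limit (z : nat -> R) (c : R) :
  (forall k, `|z k.+1 - z k| <= c * h ^+ k) ->
  {l : R | forall k, `|z k - l| <= 2 * c * h ^+ k}.
Proof.
(* the lower bounds z k - 2 c / 2^k increase and never exceed any upper bound *)
move=> zc; pose E := [set z k - 2 * c * h ^+ k | k in [set: nat]].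
have zd k j : `|z (k + j)%N - z k| <= 2 * c * h ^+ k.
  by apply: (@geometric_tail _ Num.norm) => //; [exact: normr0|exact: ler_normD].
have c0 k : 0 <= 2 * c * h ^+ k.
  by have := zd k 0; rewrite addn0 subrr normr0.
have le_zz k j : z k - 2 * c * h ^+ k <= z j + 2 * c * h ^+ j.
  have [kj|/ltnW jk] := leqP k j.
    have := zd k (j - k)%N; rewrite subnKC// ler_norml => /andP[].
    by rewrite lerBrDr => a _; have := c0 j; lra.
  have := zd j (k - j)%N; rewrite subnKC// ler_norml => /andP[_].
  by have := c0 k; lra.
have Esup : has_sup E.
  split; first by exists (z 0 - 2 * c * h ^+ 0), 0%N.
  by exists (z 0 + 2 * c * h ^+ 0) => _ [k _ <-].
exists (sup E) => k; rewrite ler_distlC; apply/andP; split; last first.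
  by apply: ge_sup => [|_ [j _ <-]]; [case: Esup|exact: le_zz].
by apply: ub_le_sup; [case: Esup|exists k].
Qed.

Lemma normc_ge_Re (z : R[i]) : `|complex.Re z| <= normc z.
Proof.
case: z => a b /=; rewrite -sqrtr_sqr ler_sqrt ?lerDl ?sqr_ge0//.
by rewrite addr_ge0 ?sqr_ge0.
Qed.

Lemma normc_ge_Im (z : R[i]) : `|complex.Im z| <= normc z.
Proof.
case: z => a b /=; rewrite -sqrtr_sqr ler_sqrt ?lerDr ?sqr_ge0//.
by rewrite addr_ge0 ?sqr_ge0.
Qed.

Lemma normc_le_ReIm (z : R[i]) : normc z <= `|complex.Re z| + `|complex.Im z|.
Proof.
case: z => a b /=; rewrite -[leRHS]ger0_norm ?addr_ge0//.
rewrite -sqrtr_sqr ler_sqrt ?sqr_ge0//.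
rewrite sqrrD !real_normK ?num_real// lerD2r lerDl.
by rewrite mulrn_wge0// mulr_ge0.
Qed.

Lemma complex_geometric_limit (z : nat -> R[i]) (c : R) :
  (forall k, normc (z k.+1 - z k) <= c * h ^+ k) ->
  {l : R[i] | forall k, normc (z k - l) <= 4 * c * h ^+ k}.
Proof.
move=> zc.
have [|a az] := @real_geometric_limit (fun k => complex.Re (z k)) c.
  by move=> k; rewrite -raddfB; exact: le_trans (normc_ge_Re _) (zc k).
have [|b bz] := @real_geometric_limit (fun k => complex.Im (z k)) c.
  by move=> k; rewrite -raddfB; exact: le_trans (normc_ge_Im _) (zc k).
exists (a +i* b) => k; apply: le_trans (normc_le_ReIm _) _.
by rewrite !raddfB/=; have := az k; have := bz k; lra.
Qed.

End GeometricSequences.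

Section OperatorCompleteness.
Context {R : realType} {p : R} {p1 : 1 <= p} {T : choiceType}.
Local Notation h := (2^-1 : R).

Lemma norm_truncation_le (v : ell p1 T) (F : {fset T}) :
  `|\sum_(x <- F) v x *: delta p1 x| <= `|v|.
Proof.
rewrite ell_normE ell_norm_leP//; apply/ell_mass_leP => G.
under eq_bigr do rewrite sum_deltaE ?fset_uniq//.
apply: (@le_trans _ _ (\sum_(x <- G) normc (v x) `^ p)); last first.
  exact: sum_powR_le_norm.
apply: ler_sum => x _; case: ifP => // _.
by rewrite normc0 powR0 ?powR_ge0// gt_eqF// p_gt0.
Qed.

(** Fatou for a geometric pointwise limit: finitely many coordinates of w are
    approximated simultaneously by truncations of the v j. *)
Lemma ell_mass_limit_le (v : nat -> ell p1 T) (w : T -> R[i]^o) (b : R)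
    (c : T -> R) :
  (forall j, `|v j| <= b) ->
  (forall j x, normc (v j x - w x) <= c x * h ^+ j) ->
  (ell_mass p w <= (b `^ p)%:E)%E.
Proof.
move=> vb vw; apply/ell_mass_leP => F.
have b0 : 0 <= b by apply: le_trans (vb 0%N).
pose wF := \sum_(x <- F) w x *: delta p1 x.
have -> : \sum_(x <- F) normc (w x) `^ p = \sum_(x <- F) normc (wF x) `^ p.
  by rewrite big_seq [RHS]big_seq; apply: eq_bigr => x xF;
    rewrite sum_deltaE ?fset_uniq// xF.
apply: le_trans (sum_powR_le_norm _ (fset_uniq F)) _.
rewrite (ler_powRp p1)//; apply: (@le_halfX _ _ _ (\sum_(x <- F) c x)) => j.
have -> : wF = \sum_(x <- F) v j x *: delta p1 x +
    \sum_(x <- F) (w x - v j x) *: delta p1 x.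
  by rewrite -big_split; apply: eq_bigr => x _ /=; rewrite -scalerDl addrC subrK.
apply: le_trans (ler_normD _ _) _; apply: lerD.
  exact: le_trans (norm_truncation_le _ _) (vb j).
apply: le_trans (norm_sum_delta_le _ _) _; rewrite mulr_suml.
by apply: ler_sum => x _; rewrite -normcN opprB.
Qed.

(** The entrywise limit w of u k v is linear in v, and the bound of
    [ell_mass_limit_le] on the differences u k v - u (k + j) v is uniform in j. *)
Lemma ell_op_complete (u : nat -> ell_op p1 T) (c : R) :
  (forall k, `|u k.+1 - u k| <= c * h ^+ k) ->
  exists l b, forall k, `|u k - l| <= b * h ^+ k.
Proof.
move=> uc.
have c0 : 0 <= c by have := uc 0; rewrite expr0 mulr1; apply: le_trans.
have ud k j : `|u (k + j)%N - u k| <= 2 * c * h ^+ k.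
  by apply: (@geometric_tail _ _ Num.norm) => //; [exact: normr0|exact: ler_normD].
have limP v x : {l : R[i] |
    forall k, normc (u k v x - l) <= 4 * (c * `|v|) * h ^+ k}.
  apply: complex_geometric_limit => k.
  have -> : u k.+1 v x - u k v x = (u k.+1 - u k) v x by [].
  apply: le_trans (normc_le_ell_norm _ _) _.
  apply: le_trans (opnormP _ _) _.
  by rewrite mulrAC ler_wpM2r//; exact: uc.
have [w [b wE]] : exists w (b : ell p1 T -> R),
    forall v x k, normc (u k v x - w v x) <= b v * h ^+ k.
  exists (fun v x => projT1 (limP v x)), (fun v => 4 * (c * `|v|)) => v x k.
  exact: (projT2 (limP v x)).
have w_lin x k f g : w (k *: f + g) x = k * w f x + w g x.
  apply/eqP; rewrite -subr_eq0; apply/eqP/eq0_normc/eqP.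
  rewrite eq_le normc_ge0 andbT.
  apply: (@le_halfX _ _ _ (b (k *: f + g) + normc k * b f + b g)) => j.
  rewrite add0r.
  have -> : w (k *: f + g) x - (k * w f x + w g x) =
      - (u j (k *: f + g) x - w (k *: f + g) x) +
      k * (u j f x - w f x) + (u j g x - w g x).
    have -> : u j (k *: f + g) x = k * u j f x + u j g x by rewrite linearP.
    by rewrite mulrBr; ring.
  rewrite !mulrDl; apply: le_trans (le_normcD _ _) _.
  apply: lerD; last exact: wE.
  apply: le_trans (le_normcD _ _) _; apply: lerD.
    by rewrite normcN; exact: wE.
  rewrite normcM -[X in _ <= X]mulrA; apply: ler_wpM2l; first exact: normc_ge0.
  exact: wE.
have w_near k v : (ell_mass p (fun x => (u k v x - w v x)%R : R[i]^o) <=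
    ((2 * c * h ^+ k * `|v|) `^ p)%:E)%E.
  apply: (@ell_mass_limit_le (fun j => u k v - u (k + j)%N v) _ _
    (fun=> b v * h ^+ k)) => j.
    rewrite -[_ - _]/((u k - u (k + j)%N) v).
    apply: le_trans (opnormP _ _) _; rewrite ler_wpM2r//.
    by rewrite -op_normE distrC.
  move=> x; rewrite -mulrA -exprD -normcN.
  apply: le_trans (wE v x (k + j)%N).
  rewrite le_eqVlt; apply/orP; left; apply/eqP; congr (normc _).
  rewrite ell_addE ell_oppE; move: (u k v x) (u _ v x) (w v x) => a a' a''.
  by ring.
(* the difference between u 0 and the limit is the operator that is bounded *)
have [l lE _] : {l : ell_op p1 T | (forall v x, l v x = u 0 v x - w v x) &
    `|l| <= 2 * c}.
  apply: ell_op_exists; first by rewrite mulr_ge0.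
    move=> x k f g; rewrite w_lin.
    have -> : u 0 (k *: f + g) x = k * u 0 f x + u 0 g x by rewrite linearP.
    by ring.
  by move=> v; have := w_near 0 v; rewrite expr0 mulr1.
exists (u 0 - l), (2 * c) => k; apply: opnorm_le => [|v].
  by rewrite !mulr_ge0// halfX_ge0.
rewrite ell_normE ell_norm_leP; last by rewrite !mulr_ge0// halfX_ge0.
apply: le_trans (w_near k v); rewrite le_eqVlt; apply/orP; left; apply/eqP.
congr (ell_mass p _); apply/funext => x.
rewrite -[LHS]/(u k v x - (u 0 v x - l v x)) lE; congr (_ - _).
by rewrite opprB addrCA subrr addr0.
Qed.

End OperatorCompleteness.

(** * Idempotents in complete normed rings *)

(** Completeness is stated for geometrically convergent sequences: this suffices
    for the Neumann series and for Newton's iteration, and it passes to matrices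
    entry by entry. *)
Record complete_norm (R : realType) (B : pzRingType) (nm : B -> R) : Prop := {
  cnorm0 : nm 0 = 0;
  cnorm_ge0 : forall a, 0 <= nm a;
  cnorm_eq0 : forall a, nm a = 0 -> a = 0;
  cnormN : forall a, nm (- a) = nm a;
  cnormD : forall a b, nm (a + b) <= nm a + nm b;
  cnormM : forall a b, nm (a * b) <= nm a * nm b;
  cnorm_complete : forall (u : nat -> B) (c : R),
    (forall k, nm (u k.+1 - u k) <= c * 2^-1 ^+ k) ->
    exists l b, forall k, nm (u k - l) <= b * 2^-1 ^+ k }.

(** A notion without unit, so that the corners of a closed subring are closed
    subrings again. *)
Record closed_subring (R : realType) (B : pzRingType) (nm : B -> R)
    (S : set B) : Prop := {
  csub_B : forall a b, S a -> S b -> S (a - b);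
  csub_M : forall a b, S a -> S b -> S (a * b);
  csub_lim : forall (u : nat -> B) (l : B) (b : R),
    (forall k, S (u k)) -> (forall k, nm (u k - l) <= b * 2^-1 ^+ k) -> S l }.

Definition alg_equiv_in (B : pzRingType) (S : set B) (e f : B) : Prop :=
  exists x y, [/\ S x, S y, e = x * y & f = y * x].

Definition cancellation_in (B : pzRingType) (S : set B) : Prop :=
  forall e f g h, S e -> S f -> S g -> S h ->
    is_idempotent e -> is_idempotent f -> is_idempotent g -> is_idempotent h ->
    orthogonal_idem e g -> orthogonal_idem f h ->
    alg_equiv_in S e f -> alg_equiv_in S (e + g) (f + h) ->
    alg_equiv_in S g h.

Section Idempotents.
Context {B : pzRingType}.

Lemma alg_equiv_sym (e f : B) : alg_equiv e f -> alg_equiv f e.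
Proof. by move=> [x [y [-> ->]]]; exists y, x. Qed.

Lemma alg_equiv_trans (e f g : B) : is_idempotent e -> is_idempotent g ->
  alg_equiv e f -> alg_equiv f g -> alg_equiv e g.
Proof.
move=> ee gg [x [y [exy fyx]]] [u [v [fuv gvu]]].
exists (x * u), (v * y); split.
  by rewrite -ee {1}exy -mulrA exy [y * _]mulrA -fyx fuv !mulrA.
by rewrite -gg {1}gvu -mulrA gvu [u * _]mulrA -fuv fyx !mulrA.
Qed.

Lemma orthogonal_idemD (e g : B) : is_idempotent e -> is_idempotent g ->
  orthogonal_idem e g -> is_idempotent (e + g).
Proof.
rewrite /is_idempotent => ee gg [eg ge].
by rewrite mulrDl !mulrDr ee gg eg ge addr0 add0r.
Qed.

(** An equivalence can be compressed to the corners of its two idempotents. *)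
Lemma alg_equiv_corner (e f : B) :
  is_idempotent e -> is_idempotent f -> alg_equiv e f ->
  exists x y : B, [/\ e = x * y, f = y * x, e * x * f = x & f * y * e = y].
Proof.
move=> ee ff [x [y [exy fyx]]]; exists (e * x * f), (f * y * e).
have xfy : x * f * y = e by rewrite fyx mulrA -exy -mulrA -exy ee.
have yex : y * e * x = f by rewrite exy mulrA -fyx -mulrA -fyx ff.
split.
- have -> : e * x * f * (f * y * e) = e * (x * f * y) * e.
    by rewrite !mulrA -[_ * f * f]mulrA ff.
  by rewrite xfy !ee.
- have -> : f * y * e * (e * x * f) = f * (y * e * x) * f.
    by rewrite !mulrA -[_ * e * e]mulrA ee.
  by rewrite yex !ff.
- by rewrite !mulrA ee -mulrA ff.
- by rewrite !mulrA ff -mulrA ee.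
Qed.

End Idempotents.

Section CompleteNormedRing.
Context {R : realType} {B : pzRingType} {nm : B -> R}.
Hypothesis nmP : complete_norm nm.
Local Notation h := (2^-1 : R).
Local Notation closed := (closed_subring nm).

Let nm0 := cnorm0 nmP.
Let nm_ge0 := cnorm_ge0 nmP.
Let nmN := cnormN nmP.
Let nmD := cnormD nmP.
Let nmM := cnormM nmP.

Local Lemma nmB a b : nm (a - b) <= nm a + nm b.
Proof. by apply: le_trans (nmD _ _) _; rewrite nmN. Qed.

Local Lemma nm_distC a b : nm (a - b) = nm (b - a).
Proof. by rewrite -nmN opprB. Qed.

Local Lemma nm_near a b (d : R) : nm (a - b) <= d -> nm a <= nm b + d.
Proof.
by move=> abd; rewrite -{1}(subrK b a) addrC; apply: le_trans (nmD _ _) _;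
  rewrite lerD2l.
Qed.

Local Lemma nmM_le a b (s t : R) : nm a <= s -> nm b <= t -> nm (a * b) <= s * t.
Proof. by move=> ? ?; apply: le_trans (nmM _ _) _; apply: ler_pM. Qed.

Lemma limit_unique (u : nat -> B) l l' (b b' : R) :
  (forall k, nm (u k - l) <= b * h ^+ k) ->
  (forall k, nm (u k - l') <= b' * h ^+ k) -> l = l'.
Proof.
move=> ul ul'; apply/eqP; rewrite -subr_eq0; apply/eqP/(cnorm_eq0 nmP)/eqP.
rewrite eq_le nm_ge0 andbT; apply: (@le_halfX _ _ _ (b + b')) => k.
have -> : l - l' = (u k - l') - (u k - l) by rewrite opprB [RHS]addrC addrA subrK.
apply: le_trans (nmB _ _) _; rewrite add0r mulrDl addrC.
by apply: lerD.
Qed.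

Lemma limit_mull a (u : nat -> B) l (b : R) :
  (forall k, nm (u k - l) <= b * h ^+ k) ->
  forall k, nm (a * u k - a * l) <= nm a * b * h ^+ k.
Proof. by move=> ul k; rewrite -mulrBr -mulrA; apply: nmM_le. Qed.

Lemma limit_mulr a (u : nat -> B) l (b : R) :
  (forall k, nm (u k - l) <= b * h ^+ k) ->
  forall k, nm (u k * a - l * a) <= nm a * b * h ^+ k.
Proof. by move=> ul k; rewrite -mulrBl -mulrA [leRHS]mulrC; apply: nmM_le. Qed.

Lemma csub_0 (S : set B) a : closed S -> S a -> S 0.
Proof. by move=> cS Sa; rewrite -(subrr a); exact: (csub_B cS). Qed.

Lemma csub_D (S : set B) a b : closed S -> S a -> S b -> S (a + b).
Proof.
move=> cS Sa Sb; rewrite -(opprK b) -(sub0r b).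
by apply: (csub_B cS Sa); apply: (csub_B cS) => //; exact: csub_0 Sb.
Qed.

(** The Neumann series e + t + t^2 + .. inverts e - t inside the corner eBe, and
    stays in every closed subring that contains e and t, with or without unit. *)
Lemma corner_inverse (S : set B) e t : closed S -> S e -> S t ->
  is_idempotent e -> e * t = t -> t * e = t -> nm t <= h ->
  exists c, [/\ S c, e * c = c, (e - t) * c = e & c * (e - t) = e].
Proof.
move=> cS Se St ee et te th.
pose u := fix u k := if k is k'.+1 then e + t * u k' else e.
have uS k : u k.+1 = e + t * u k by [].
have Su k : S (u k).
  by elim: k => // k IHk; rewrite uS; apply: csub_D => //; exact: (csub_M cS).
have eu k : e * u k = u k.
  by elim: k => // k IHk; rewrite uS mulrDr mulrA et ee.
have ue k : u k * e = u k.
  by elim: k => // k IHk; rewrite uS mulrDl -mulrA IHk ee.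
have ut k : u k * t = t * u k.
  elim: k => [|k IHk]; first by rewrite /= te.
  by rewrite uS mulrDl mulrDr et te -mulrA IHk.
have uD k : nm (u k.+1 - u k) <= 1 * h ^+ k.
  elim: k => [|k IHk]; first by rewrite /= te addrC addKr expr0; lra.
  have -> : u k.+2 - u k.+1 = t * (u k.+1 - u k).
    by rewrite [u k.+2]uS [in X in _ - X]uS opprD addrACA subrr add0r mulrBr.
  by rewrite exprS mulrCA; apply: nmM_le.
have [c [b uc]] := cnorm_complete nmP uD.
have Sc : S c := csub_lim cS Su uc.
have ec : e * c = c.
  apply: (limit_unique _ uc).
  by move=> k; rewrite -[u k]eu; exact: (limit_mull e uc).
have ce : c * e = c.
  apply: (limit_unique _ uc).
  by move=> k; rewrite -[u k]ue; exact: (limit_mulr e uc).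
have ct : c * t = t * c.
  apply: (limit_unique (limit_mulr t uc)).
  by move=> k; rewrite ut; exact: (limit_mull t uc).
have ctc : c = e + t * c.
  apply: (@limit_unique (fun k => u k.+1) _ _ (b * h) (nm t * b)) => k.
    by rewrite -mulrA -exprS.
  by rewrite uS opprD addrACA subrr add0r; exact: (limit_mull t uc).
have ctce : c - t * c = e by rewrite {1}ctc addrK.
by exists c; split; rewrite // ?mulrBl ?mulrBr ?ec ?ce ?ct.
Qed.

(** If x y is close to e and y x is close to f, then x and y become an
    equivalence once y is multiplied by the inverse of x y in the corner of e; the
    inverse of y x in the corner of f shows that the product in the other order is
    all of f. *)
Lemma near_equiv (S : set B) e f x y : closed S -> S e -> S f -> S x -> S y ->
  is_idempotent e -> is_idempotent f ->
  e * x = x -> x * f = x -> f * y = y -> y * e = y ->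
  nm (e - x * y) <= h -> nm (f - y * x) <= h -> alg_equiv_in S e f.
Proof.
move=> cS Se Sf Sx Sy ee ff ex xf fy ye near_e near_f.
have [|||||||c [Sc _ xyc cxy]] := @corner_inverse S e (e - x * y) => //.
- by apply: (csub_B cS) => //; apply: (csub_M cS).
- by rewrite mulrBr ee mulrA ex.
- by rewrite mulrBl ee -mulrA ye.
have [|||||||d [Sd _ yxd _]] := @corner_inverse S f (f - y * x) => //.
- by apply: (csub_B cS) => //; apply: (csub_M cS).
- by rewrite mulrBr ff mulrA fy.
- by rewrite mulrBl ff -mulrA xf.
rewrite opprB addrCA subrr addr0 in xyc cxy; rewrite opprB addrCA subrr addr0 in yxd.
exists x, (y * c); split => //; first exact: (csub_M cS).
  by rewrite mulrA.
rewrite -[in RHS]xf -[in RHS]yxd !mulrA -[y * c * x * y]mulrA.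
by rewrite -[y * c * _]mulrA cxy ye.
Qed.

(** Idempotents closer than a distance that depends on e alone are equivalent,
    through e * f and f * e. *)
Lemma close_equiv e : is_idempotent e -> exists2 d : R, 0 < d &
  forall f, is_idempotent f -> nm (f - e) <= d -> alg_equiv e f.
Proof.
move=> ee; pose m := nm e + 1.
have m0 : 1 <= m by rewrite lerDr.
have m_gt0 : 0 < m by apply: lt_le_trans m0.
exists (h / m ^+ 2); first by rewrite divr_gt0 ?exprn_gt0.
move=> f ff fe.
have d1 : h / m ^+ 2 <= 1.
  rewrite ler_pdivrMr ?exprn_gt0// mul1r.
  by apply: (@le_trans _ _ 1); [lra|exact: exprn_ege1].
have fm : nm f <= m by apply: le_trans (nm_near fe) _; rewrite lerD2l.
have em : nm e <= m by rewrite lerDl.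
have bound a b : nm a <= m -> nm (b - a) <= h / m ^+ 2 ->
    nm (a * (a - b) * a) <= h.
  move=> am ba; apply: (@le_trans _ _ (m * (h / m ^+ 2) * m)).
    by apply: nmM_le => //; apply: nmM_le => //; rewrite nm_distC.
  by rewrite le_eqVlt; apply/orP; left; apply/eqP; field; rewrite gt_eqF.
have [x [y [_ _ -> ->]]] : alg_equiv_in setT e f; last by exists x, y.
apply: (@near_equiv setT e f (e * f) (f * e)); rewrite ?mulrA ?ee ?ff//.
- by rewrite -mulrA ff.
- by rewrite -mulrA ee.
- have -> : e - e * f * f * e = e * (e - f) * e.
    by rewrite -[e * f * f]mulrA ff mulrBr mulrBl ee ee.
  exact: bound.
- have -> : f - f * e * e * f = f * (f - e) * f.
    by rewrite -[f * e * e]mulrA ee mulrBr mulrBl ff ff.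
  by apply: bound => //; rewrite nm_distC.
Qed.

(** Newton's iteration for a^2 = a. With c = a^2 - a and w = 2 a - 1 the next
    iterate is a - w c, whose defect is c' = w^2 c^2 - 4 c^2 = 4 c^3 - 3 c^2,
    and 2 (a - w c) - 1 = w - 2 w c. For d <= 1/16 the defects halve at each step
    and the norms of w stay below 2 k. *)
Lemma newton_idempotent (S : set B) a (k d : R) : closed S -> S a ->
  nm (a + a - 1) <= k -> nm (a * a - a) <= d -> d <= 1 / 16 ->
  exists e, [/\ S e, is_idempotent e & nm (e - a) <= 4 * k * d].
Proof.
move=> cS Sa ak ad d16.
have d0 : 0 <= d := le_trans (nm_ge0 _) ad.
have k0 : 0 <= k := le_trans (nm_ge0 _) ak.
pose w b : B := b + b - 1; pose c b : B := b * b - b.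
pose next b := b - w b * c b.
have bc b : GRing.comm b (c b) by apply: commrB => //; apply: commrM.
have bw b : GRing.comm b (w b).
  by apply: commrB; [apply: commrD|apply: commr1].
have wc b : GRing.comm (w b) (c b).
  by apply: commrB; [apply: commrM|]; apply: commr_sym.
have ww b : w b * w b = 1 + c b *+ 4.
  rewrite /w /c -mulr2n mulrnBl mulrBl mulrBr mul1r mulr1 opprB.
  have -> : b *+ 2 * (b *+ 2) = (b * b) *+ 4.
    by rewrite mulrnAl mulrnAr -mulrnA.
  rewrite (mulrnDr b 2 2); move: (b *+ 2) (_ *+ 4) => x y.
  by rewrite opprD !addrA [LHS](ACl (3*1*2*4)).
have c_next b : c (next b) = c b * c b + c b * c b * c b *+ 4 - c b * c b *+ 4.
  rewrite /next; set v := w b * c b.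
  have bv : v * b = b * v by apply: commr_sym; apply: commrM.
  have wv : w b * v = c b + c b * c b *+ 4.
    by rewrite mulrA ww mulrDl mul1r mulrnAl.
  have vv : v * v = c b * c b + c b * c b * c b *+ 4.
    by rewrite {1}/v wc -mulrA wv mulrDr mulrnAr mulrA.
  have -> : c (b - v) = c b - w b * v + v * v.
    rewrite /c /w !mulrBl mul1r mulrDl !mulrBr bv !opprB opprD !addrA.
    by rewrite [RHS](ACl (1*4*6*5*3*2)).
  by rewrite wv opprD addrA subrr add0r vv addrC.
have w_next b : w (next b) = w b - (w b * c b) *+ 2.
  by rewrite /w /next mulr2n opprD !addrA [LHS](ACl (1*3*5*2*4)).
pose u := fix u j := if j is j'.+1 then next (u j') else a.
have uS j : u j.+1 = next (u j) by [].
have Sw b : S b -> S (w b * c b).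
  move=> Sb; have Sc : S (c b) by apply: (csub_B cS) => //; exact: (csub_M cS).
  rewrite /w mulrBl mul1r mulrDl; apply: (csub_B cS) => //.
  by apply: csub_D => //; exact: (csub_M cS).
have Su j : S (u j).
  by elim: j => // j IHj; rewrite uS; apply: (csub_B cS) => //; exact: Sw.
have hX j : 0 <= h ^+ j <= 1.
  by rewrite halfX_ge0 exprn_ile1//; lra.
have c_le j : nm (c (u j)) <= d * h ^+ j.
  elim: j => [|j IHj]; first by rewrite expr0 mulr1.
  rewrite uS c_next; set t := c (u j) in IHj *.
  have [t0 t1] := andP (hX j).
  have nmn x n : nm (x *+ n) <= nm x *+ n.
    elim: n => [|n IHn]; first by rewrite !mulr0n nm0.
    by rewrite !mulrS; apply: le_trans (nmD _ _) _; rewrite lerD2l.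
  pose s := d * h ^+ j; rewrite -/s in IHj.
  have s0 : 0 <= s by rewrite mulr_ge0.
  have sd : s <= 1 / 16 by apply: le_trans d16; rewrite ler_piMr.
  have tt : nm (t * t) <= s * s by apply: nmM_le.
  have ttt : nm (t * t * t) <= s * s * s by apply: nmM_le.
  apply: le_trans (nmB _ _) _; apply: le_trans (lerD (nmD _ _) (nmn _ _)) _.
  have := nmn (t * t * t) 4; rewrite exprS.
  have -> : d * (h * h ^+ j) = s * h by rewrite /s; ring.
  have ss : s * s <= s * (1 / 16) by apply: ler_wpM2l.
  have sss : s * s * s <= s * (1 / 16) * (1 / 16).
    by apply: ler_pM => //; exact: mulr_ge0.
  by move: tt ttt; lra.
have w_le j : nm (w (u j)) <= k * (2 - h ^+ j).
  elim: j => [|j IHj]; first by rewrite expr0; move: ak; rewrite /w/=; lra.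
  rewrite uS w_next; apply: le_trans (nmB _ _) _.
  have [t0 t1] := andP (hX j).
  have wcj := nmM_le IHj (c_le j).
  have DC : nm ((w (u j) * c (u j)) *+ 2) <=
      nm (w (u j) * c (u j)) + nm (w (u j) * c (u j)).
    by rewrite mulr2n; apply: nmD.
  rewrite exprS; move: IHj wcj t0 t1 DC; move: (h ^+ j) => t.
  set W := nm _; set C := nm _; set D := nm _ => IHj wcj t0 t1 DC.
  apply: (@le_trans _ _ (k * ((2 - t) * (1 + 2 * (d * t))))); first by lra.
  have dt : d * t <= 1 / 16 * t by apply: ler_wpM2r.
  have dtt : 0 <= d * t * t by rewrite !mulr_ge0.
  by apply: ler_wpM2l => //; lra.
have u_step j : nm (u j.+1 - u j) <= 2 * k * d * h ^+ j.
  have -> : u j.+1 - u j = - (w (u j) * c (u j)).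
    by rewrite uS /next addrAC subrr add0r.
  rewrite nmN; have [t0 t1] := andP (hX j).
  apply: (@le_trans _ _ ((k * 2) * (d * h ^+ j))); last by lra.
  apply: nmM_le => //; apply: le_trans (w_le j) _.
  by apply: ler_wpM2l => //; lra.
have [e [b ue]] := cnorm_complete nmP u_step.
have ea : nm (e - a) <= 4 * k * d.
  apply: (@le_halfX _ _ _ b) => j.
  have -> : e - a = (u j - u 0) - (u j - e).
    by rewrite opprB [RHS]addrC addrA subrK.
  apply: le_trans (nmB _ _) _; apply: lerD => //.
  have := geometric_tail nm0 nm_ge0 nmD u_step 0 j.
  by rewrite add0n expr0 => tail; apply: (le_trans tail); lra.
exists e; split => //; first exact: (csub_lim cS) ue.
pose m := nm e + `|b|.
have um j : nm (u j) <= m.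
  apply: le_trans (nm_near (ue j)) _; rewrite lerD2l.
  apply: (@le_trans _ _ (`|b| * h ^+ j)).
    by rewrite ler_wpM2r ?halfX_ge0 ?ler_norm.
  by rewrite ler_piMr//; have [] := andP (hX j).
apply: (@limit_unique (fun j => u j * u j) _ _ (m * b + b * nm e) (d + b)) => j.
  have -> : u j * u j - e * e = u j * (u j - e) + (u j - e) * e.
    by rewrite mulrBr mulrBl addrA subrK.
  apply: le_trans (nmD _ _) _; rewrite [leRHS]mulrDl; apply: lerD.
    by rewrite -mulrA; apply: nmM_le.
  by rewrite mulrAC; apply: nmM_le.
have -> : u j * u j - e = c (u j) + (u j - e) by rewrite /c addrA subrK.
by apply: le_trans (nmD _ _) _; rewrite [leRHS]mulrDl; apply: lerD.
Qed.

(** The distance d is independent of the subring: m bounds the norm of 2 a - 1 and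
    the Lipschitz constant of a^2 - a near e, so d m bounds the defect of a and
    4 m (d m) the error of Newton's iteration. *)
Lemma approx_idempotent e (eps : R) : is_idempotent e -> 0 < eps ->
  exists2 d : R, 0 < d & forall (S : set B) a, closed S -> S a ->
    nm (a - e) <= d ->
    exists e', [/\ S e', is_idempotent e' & nm (e' - e) <= eps].
Proof.
move=> ee eps0; pose m := 2 * nm e + 3 + nm 1.
have m3 : 3 <= m by rewrite /m; have := nm_ge0 e; have := nm_ge0 1; lra.
have m0 : 0 < m by lra.
pose d := Num.min (1 / (16 * m)) (eps / (8 * (m * m))).
have d1 : d * m <= 1 / 16.
  rewrite -ler_pdivlMr// (_ : 1 / 16 / m = 1 / (16 * m)) ?ge_min ?lexx//.
  by field; rewrite gt_eqF.
have d2 : d * (m * m) <= eps / 8.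
  rewrite -ler_pdivlMr ?mulr_gt0//.
  rewrite (_ : eps / 8 / (m * m) = eps / (8 * (m * m))) ?ge_min ?lexx ?orbT//.
  by field; rewrite gt_eqF.
have d0 : 0 < d.
  by rewrite lt_min !divr_gt0 ?mulr_gt0//; lra.
exists d => // S a cS Sa ae.
have dm : d <= d * m by rewrite ler_peMr ?ltW//; lra.
have am := nm_near ae.
have e0 := nm_ge0 e.
have defect : nm (a * a - a) <= d * m.
  have -> : a * a - a = (a - e) * a + e * (a - e) - (a - e).
    by rewrite mulrBl mulrBr ee addrA subrK opprB addrA subrK.
  apply: (@le_trans _ _ (d * (nm e + d) + nm e * d + d)); last first.
    have : d * (2 * nm e + 1 + d) <= d * m.
      by rewrite ler_wpM2l ?(ltW d0)// /m; have := nm_ge0 1; lra.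
    by lra.
  apply: le_trans (nmB _ _) _; apply: lerD => //.
  by apply: le_trans (nmD _ _) _; apply: lerD; apply: nmM_le.
have slope : nm (a + a - 1) <= m.
  apply: le_trans (nmB _ _) _; have := nmD a a; rewrite /m; lra.
have [e' [Se' e'e' e'a]] := newton_idempotent cS Sa slope defect d1.
exists e'; split => //.
have -> : e' - e = (e' - a) + (a - e) by rewrite addrA subrK.
apply: le_trans (nmD _ _) _; have mm : d <= d * (m * m).
  by rewrite mulrA; apply: (le_trans dm); rewrite ler_peMr ?mulr_ge0 ?ltW//; lra.
by lra.
Qed.

(** g is moved into the corner orthogonal to e' before it is made idempotent:
    the elements s of S with e' s = 0 = s e' form a closed subring again. *)
Lemma approx_orthogonal_pair e g (eps : R) :
  is_idempotent e -> is_idempotent g -> orthogonal_idem e g -> 0 < eps ->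
  exists2 d : R, 0 < d & forall (S : set B) a b, closed S -> S a -> S b ->
    nm (a - e) <= d -> nm (b - g) <= d ->
    exists e' g', [/\ S e' /\ S g', is_idempotent e' /\ is_idempotent g',
      orthogonal_idem e' g', nm (e' - e) <= eps & nm (g' - g) <= eps].
Proof.
move=> ee gg [eg ge] eps0.
have [dg dg0 dgP] := approx_idempotent gg eps0.
pose E := nm e + 1; pose Q := nm 1 + E; pose G := nm g.
have e0 := nm_ge0 e; have g0 := nm_ge0 g; have n10 := nm_ge0 1.
have E0 : 0 <= E by rewrite /E; lra.
have Q0 : 0 <= Q by rewrite /Q; lra.
pose M := Q * Q + 2 * G + G * E + 1.
have M0 : 0 < M.
  by rewrite /M; have := mulr_ge0 g0 E0; have := mulr_ge0 Q0 Q0; rewrite /G; lra.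
pose eta := Num.min 1 (dg / M).
have eta0 : 0 < eta by rewrite lt_min ltr01 divr_gt0.
have etaM : eta * M <= dg by rewrite -ler_pdivlMr// ge_min lexx orbT.
have eta1 : eta <= 1 by rewrite ge_min lexx.
have [|de de0 deP] := @approx_idempotent e (Num.min eps eta) ee.
  by rewrite lt_min eps0.
exists (Num.min de eta); first by rewrite lt_min de0.
move=> S a b cS Sa Sb.
rewrite le_min => /andP[ae _]; rewrite le_min => /andP[_ bg].
have [e' [Se' e'e']] := deP S a cS Sa ae.
rewrite le_min => /andP[e'e e'eta].
pose S' := [set s | S s /\ (e' * s = 0 /\ s * e' = 0)].
have cS' : closed S'.
  split.
  - move=> x y [Sx [ex xe]] [Sy [ey ye]]; split; first exact: (csub_B cS).
    by rewrite mulrBr mulrBl ex ey xe ye subrr.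
  - move=> x y [Sx [ex xe]] [Sy [ey ye]]; split; first exact: (csub_M cS).
    by rewrite mulrA ex mul0r -mulrA ye mulr0.
  - move=> u l c Su ul; split; first by apply: (csub_lim cS) ul => k; case: (Su k).
    split.
      apply: (@limit_unique (fun=> 0) _ _ (nm e' * c) 0) => k.
        by have [_ [<- _]] := Su k; apply: limit_mull.
      by rewrite subrr nm0 mul0r.
    apply: (@limit_unique (fun=> 0) _ _ (nm e' * c) 0) => k.
      by have [_ [_ <-]] := Su k; apply: limit_mulr.
    by rewrite subrr nm0 mul0r.
pose q x := (1 - e') * x * (1 - e').
have qE x : q x = x - e' * x - (x - e' * x) * e'.
  by rewrite /q [(1 - e') * x]mulrBl mul1r mulrBr mulr1.
have ke : e' * (1 - e') = 0 by rewrite mulrBr mulr1 e'e' subrr.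
have ek : (1 - e') * e' = 0 by rewrite mulrBl mul1r e'e' subrr.
have Sq x : S x -> S' (q x).
  move=> Sx; have S1 : S (x - e' * x).
    by apply: (csub_B cS) => //; apply: (csub_M cS).
  split; first by rewrite qE; apply: (csub_B cS) => //; apply: (csub_M cS).
  split; first by rewrite /q !mulrA ke !mul0r.
  by rewrite /q -(mulr0 ((1 - e') * x)) -ek mulrA.
have e'E : nm e' <= E.
  by apply: le_trans (nm_near e'eta) _; rewrite lerD2l.
have qb : nm (q b - g) <= dg.
  have e'g : e' * g = (e' - e) * g by rewrite mulrBl eg subr0.
  have ge' : g * e' = g * (e' - e) by rewrite mulrBr ge subr0.
  have -> : q b - g = q (b - g) - (e' * g + (g * e' - e' * g * e')).
    have <- : q g - g = - (e' * g + (g * e' - e' * g * e')).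
      have -> : q g = g - (e' * g + (g * e' - e' * g * e')).
        by rewrite qE [(g - _) * e']mulrBl -addrA -opprD.
      by rewrite addrAC subrr add0r.
    have -> : q (b - g) = q b - q g.
      by rewrite /q; move: (1 - e') => k; rewrite mulrBr mulrBl.
    by rewrite addrA subrK.
  have s1 : nm (q (b - g)) <= Q * eta * Q.
    have k1 : nm (1 - e') <= Q by apply: le_trans (nmB _ _) _; rewrite lerD2l.
    by rewrite /q; apply: (nmM_le _ k1); apply: nmM_le.
  have s2 : nm (e' * g) <= eta * G by rewrite e'g; apply: nmM_le.
  have s3 : nm (g * e') <= G * eta by rewrite ge'; apply: nmM_le.
  have s4 : nm (e' * g * e') <= eta * G * E by apply: nmM_le.
  apply: le_trans etaM; apply: le_trans (nmB _ _) _.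
  apply: le_trans (lerD s1 (nmD _ _)) _.
  have s5 := nmB (g * e') (e' * g * e').
  by rewrite /M; lra.
have [g' [[Sg' [eg' ge']] g'g' g'g]] := dgP S' (q b) cS' (Sq b Sb) qb.
by exists e', g'; split.
Qed.

Section DirectedUnion.
Variable F : set (set B).
Hypothesis F_closed : forall S, F S -> closed S.
Hypothesis F_directed : forall S S', F S -> F S' ->
  exists S'', [/\ F S'', S `<=` S'' & S' `<=` S''].
Hypothesis F_dense : forall a (eps : R), 0 < eps ->
  exists S a', [/\ F S, S a' & nm (a' - a) <= eps].

Lemma approx_above S a (eps : R) : F S -> 0 < eps ->
  exists S' a', [/\ F S', S `<=` S', S' a' & nm (a' - a) <= eps].
Proof.
move=> FS eps0; have [S1 [a' [FS1 S1a' a'a]]] := F_dense a eps0.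
have [S' [FS' SS' S1S']] := F_directed FS FS1.
by exists S', a'; split => //; exact: S1S'.
Qed.

(** An equivalence in the whole ring between idempotents of S is realised in a
    larger member of F: cut approximants of x and y down to the corners of e and
    f and correct them with the Neumann series. *)
Lemma alg_equiv_descends S e f : F S -> S e -> S f ->
  is_idempotent e -> is_idempotent f -> alg_equiv e f ->
  exists S', [/\ F S', S `<=` S' & alg_equiv_in S' e f].
Proof.
move=> FS Se Sf ee ff /(alg_equiv_corner ee ff)[x [y [exy fyx exf fye]]].
pose k := nm e * nm f + 1; pose m := nm x + nm y + 1.
have x0 := nm_ge0 x; have y0 := nm_ge0 y.
have k0 : 0 < k by rewrite ltr_wpDl// mulr_ge0.
have m1 : 1 <= m by rewrite /m; lra.
have m0 : 0 < m by lra.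
pose t := h / m.
have t0 : 0 < t by rewrite divr_gt0//; lra.
have t1 : t <= 1 by rewrite ler_pdivrMr// mul1r; lra.
have tm : t * m = h by rewrite /t divfK// gt_eqF.
have tk0 : 0 < t / k by rewrite divr_gt0.
have [S1 [x1 [FS1 SS1 S1x xx]]] := approx_above x FS tk0.
have [S' [y1 [FS' S1S' S'y yy]]] := approx_above y FS1 tk0.
have cS' := F_closed FS'.
have S'x := S1S' _ S1x; have S'e := S1S' _ (SS1 _ Se).
have S'f := S1S' _ (SS1 _ Sf).
exists S'; split => //; first by move=> a /SS1/S1S'.
have cut a b z z1 : a * z * b = z -> nm a * nm b <= k -> nm (z1 - z) <= t / k ->
    nm (a * z1 * b - z) <= t.
  move=> azb abk zz; rewrite -azb -mulrBl -mulrBr.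
  apply: (@le_trans _ _ (nm a * (t / k) * nm b)).
    by apply: nmM_le => //; apply: nmM_le.
  rewrite mulrAC; apply: (@le_trans _ _ (k * (t / k))).
    by apply: ler_wpM2r => //; apply: ltW.
  by rewrite mulrC divfK// gt_eqF.
have xt : nm (e * x1 * f - x) <= t by apply: cut; rewrite ?lerDl.
have yt : nm (f * y1 * e - y) <= t.
  by apply: cut; rewrite // mulrC lerDl.
have near a b a1 b1 : nm (a1 - a) <= t -> nm (b1 - b) <= t ->
    nm a + nm b + 1 <= m -> nm (a * b - a1 * b1) <= h.
  move=> aa bb abm; have -> : a * b - a1 * b1 = (a - a1) * b1 + a * (b - b1).
    by rewrite mulrBl mulrBr [RHS]addrC addrA subrK.
  apply: le_trans (nmD _ _) _.
  have s1 : nm ((a - a1) * b1) <= t * (nm b + t).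
    by apply: nmM_le; [rewrite nm_distC|apply: nm_near].
  have s2 : nm (a * (b - b1)) <= nm a * t.
    by apply: nmM_le => //; rewrite nm_distC.
  have tt : t * (nm a + nm b + t) <= t * m.
    by apply: ler_wpM2l; [exact: ltW|lra].
  by rewrite -tm; lra.
apply: (near_equiv cS' S'e S'f (x := e * x1 * f) (y := f * y1 * e)) => //.
- by apply: (csub_M cS') => //; apply: (csub_M cS').
- by apply: (csub_M cS') => //; apply: (csub_M cS').
- by rewrite !mulrA ee.
- by rewrite -mulrA ff.
- by rewrite !mulrA ff.
- by rewrite -mulrA ee.
- by rewrite {1}exy; apply: near.
- by rewrite {1}fyx; apply: near => //; rewrite /m; lra.
Qed.

(** Approximate the two orthogonal pairs by orthogonal pairs e', g' and f', k' in
    one member of F. The approximants are equivalent to the original idempotents,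
    hence e' to f' and e' + g' to f' + k'; in a larger member of F these
    equivalences hold as well, and cancellation there makes g' and k' equivalent. *)
Theorem cancellation_directed_union :
  (forall S, F S -> cancellation_in S) -> has_idempotent_cancellation B.
Proof.
move=> F_cancel e f g h' ee ff gg hh eg fh e_f eg_fh.
have approx_pair a b : is_idempotent a -> is_idempotent b ->
    orthogonal_idem a b -> forall S, F S ->
    exists S' a' b', [/\ F S', S `<=` S', S' a' /\ S' b',
      is_idempotent a' /\ is_idempotent b' & orthogonal_idem a' b' /\
      [/\ alg_equiv a a', alg_equiv b b' & alg_equiv (a + b) (a' + b')]].
  move=> aa bb ab S FS; have [da da0 daP] := close_equiv aa.
  have [db db0 dbP] := close_equiv bb.
  have [ds ds0 dsP] := close_equiv (orthogonal_idemD aa bb ab).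
  pose eps := Num.min (Num.min da db) (ds / 2).
  have eps0 : 0 < eps by rewrite !lt_min da0 db0 divr_gt0.
  have [d d0 dP] := approx_orthogonal_pair aa bb ab eps0.
  have [S1 [a1 [FS1 SS1 S1a aa1]]] := approx_above a FS d0.
  have [S' [b1 [FS' S1S' S'b bb1]]] := approx_above b FS1 d0.
  have [a' [b' [S'ab [a'a' b'b'] a'b']]] :=
    dP S' a1 b1 (F_closed FS') (S1S' _ S1a) S'b aa1 bb1.
  rewrite !le_min => /andP[/andP[aea _] aes] /andP[/andP[_ beb] bes].
  exists S', a', b'; split => //; first by move=> z /SS1/S1S'.
  split => //; split; [exact: daP|exact: dbP|].
  apply: dsP; first exact: orthogonal_idemD.
  by rewrite opprD addrACA; apply: le_trans (nmD _ _) _; lra.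
have [S0 [_ [FS0 _ _]]] := F_dense 0 ltr01.
have [S1 [e' [g' [FS1 _ [S1e S1g] [e'e' g'g'] [e'g' [e_e' g_g' eg_eg']]]]]] :=
  approx_pair e g ee gg eg S0 FS0.
have [S2 [f' [k' [FS2 S12 [S2f S2k] [f'f' k'k'] [f'k' [f_f' h_k' fh_fk']]]]]] :=
  approx_pair f h' ff hh fh S1 FS1.
have egs := orthogonal_idemD e'e' g'g' e'g'.
have fks := orthogonal_idemD f'f' k'k' f'k'.
have e'_f' : alg_equiv e' f'.
  apply: (alg_equiv_trans e'e' f'f' (alg_equiv_sym e_e')).
  exact: (alg_equiv_trans ee f'f' e_f f_f').
have s_s' : alg_equiv (e' + g') (f' + k').
  apply: (alg_equiv_trans egs fks (alg_equiv_sym eg_eg')).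
  exact: (alg_equiv_trans (orthogonal_idemD ee gg eg) fks eg_fh fh_fk').
have S2e := S12 _ S1e; have S2g := S12 _ S1g.
have [S3 [FS3 S23 e'_f'3]] := alg_equiv_descends FS2 S2e S2f e'e' f'f' e'_f'.
have cS2 := F_closed FS2.
have [S4 [FS4 S24 s_s'4]] :=
  alg_equiv_descends FS2 (csub_D cS2 S2e S2g) (csub_D cS2 S2f S2k) egs fks s_s'.
have [S5 [FS5 S35 S45]] := F_directed FS3 FS4.
have widen S S' a b : S `<=` S' -> alg_equiv_in S a b -> alg_equiv_in S' a b.
  by move=> SS' [x [y [Sx Sy -> ->]]]; exists x, y; split=> //; exact: SS'.
have S25 : S2 `<=` S5 by move=> z /S23/S35.
have [x [y [_ _ gxy kyx]]] : alg_equiv_in S5 g' k'.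
  apply: (F_cancel S5 FS5 e' f' g' k') => //; try exact: S25.
    exact: widen e'_f'3.
  exact: widen s_s'4.
apply: (alg_equiv_trans gg hh g_g').
apply: (alg_equiv_trans g'g' hh _ (alg_equiv_sym h_k')).
by exists x, y.
Qed.

End DirectedUnion.

End CompleteNormedRing.

(** * Idempotent matrices and matrix algebras *)

Section MatrixCancellation.
Context {K : fieldType} {m : nat}.
Implicit Types e f g : 'M[K]_m.

Lemma idempotent_factor e : is_idempotent e ->
  exists (c : 'M[K]_(m, \rank e)) (r : 'M[K]_(\rank e, m)),
    e = c *m r /\ r *m c = 1%:M.
Proof.
move=> ee; move: (mulmx_base e) (col_base_full e) (row_base_free e).
move: (col_base e) (row_base e) => c r cr c_full r_free; exists c, r.
split => //; apply: (row_full_inj c_full); apply: (row_free_inj r_free).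
by rewrite mulmxA cr -mulmxA cr mulmx1 cr; exact: ee.
Qed.

(** Idempotents of the same rank factor through the same space. *)
Lemma alg_equiv_rank e f : is_idempotent e -> is_idempotent f ->
  \rank e = \rank f -> alg_equiv e f.
Proof.
move=> ee ff; have [c' [r' [fE rc']]] := idempotent_factor ff.
have [c [r [eE rc]]] := idempotent_factor ee; move: c r eE rc.
move: (\rank e) => k c r eE rc kf; subst k.
exists (c *m r'), (c' *m r); split.
  by rewrite -[RHS]/(_ *m _) mulmxA -[c *m r' *m c']mulmxA rc' mulmx1.
by rewrite -[RHS]/(_ *m _) mulmxA -[c' *m r *m c]mulmxA rc mulmx1.
Qed.

Lemma rank_alg_equiv e f : is_idempotent e -> alg_equiv e f ->
  (\rank e <= \rank f)%N.
Proof.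
move=> ee [x [y [exy fyx]]].
have -> : e = x *m f *m y.
  by rewrite -[LHS]ee {1 2}exy fyx -[LHS]/(_ *m _) -![_ * _]/(_ *m _) !mulmxA.
exact: leq_trans (mxrankM_maxl _ _) (mxrankM_maxr _ _).
Qed.

Lemma rank_orthogonalD e g : is_idempotent e -> is_idempotent g ->
  orthogonal_idem e g -> \rank (e + g)%R = (\rank e + \rank g)%N.
Proof.
move=> ee gg [eg ge].
have e_sub : (e <= (e + g)%R)%MS.
  have := submxMl e (e + g).
  by rewrite mulmxDr [e *m e]ee [e *m g]eg addr0.
have g_sub : (g <= (e + g)%R)%MS.
  have := submxMl g (e + g).
  by rewrite mulmxDr [g *m e]ge [g *m g]gg add0r.
have -> : \rank (e + g)%R = \rank (e + g)%MS.
  by apply/eqP; rewrite eqn_leq !mxrankS ?addmx_sub_adds// addsmx_sub e_sub.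
apply: mxrank_disjoint_sum.
have /submxP[a aE] := capmxSl e g; have /submxP[b bE] := capmxSr e g.
have -> : (e :&: g)%MS = (e :&: g)%MS *m e.
  by rewrite {2}aE -mulmxA [e *m e]ee -aE.
by rewrite bE -mulmxA [g *m e]ge mulmx0.
Qed.

(** The rank is additive on orthogonal idempotents and decides equivalence. *)
Lemma mx_cancellation : has_idempotent_cancellation 'M[K]_m.
Proof.
move=> e f g k ee ff gg kk eg fk e_f s_t.
have rank_eq (a b : 'M[K]_m) : is_idempotent a -> is_idempotent b -> alg_equiv a b ->
    \rank a = \rank b.
  move=> aa bb ab; apply/eqP; rewrite eqn_leq (rank_alg_equiv aa ab).
  exact: rank_alg_equiv bb (alg_equiv_sym ab).
apply: alg_equiv_rank => //.
apply/eqP; rewrite -(eqn_add2l (\rank e)) -rank_orthogonalD//.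
rewrite (rank_eq _ _ ee ff e_f) -rank_orthogonalD//; apply/eqP.
by apply: rank_eq => //; apply: orthogonal_idemD.
Qed.

End MatrixCancellation.

(** Cancellation is checked componentwise in a product of rings; the witnesses
    of the components are collected by choice. *)
Lemma cancellation_in_product (I : Type) (C : I -> pzRingType) (B : pzRingType)
    (Theta : (forall k, C k) -> B) :
  (forall k, has_idempotent_cancellation (C k)) ->
  (forall a b, Theta (fun k => a k + b k) = Theta a + Theta b) ->
  (forall a b, Theta (fun k => a k * b k) = Theta a * Theta b) ->
  injective Theta -> cancellation_in (range Theta).
Proof.
move=> C_cancel thD thM th_inj _ _ _ _ [e _ <-] [f _ <-] [g _ <-] [t _ <-].
have th0 : Theta (fun=> 0) = 0.
  apply: (addrI (Theta (fun=> 0))); rewrite -thD addr0; congr (Theta _).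
  by apply: functional_extensionality_dep => k; rewrite addr0.
have at_k a b : Theta a = Theta b -> forall k, a k = b k.
  by move=> /th_inj ->.
rewrite /is_idempotent -!thM -!thD => /at_k ee /at_k ff /at_k gg /at_k tt.
rewrite /orthogonal_idem -!thM -th0.
move=> [/at_k eg /at_k ge] [/at_k ft /at_k tf].
move=> [_ [_ [[x _ <-] [y _ <-]]]]; rewrite -!thM => /at_k exy /at_k fyx.
move=> [_ [_ [[u _ <-] [v _ <-]]]]; rewrite -!thM => /at_k suv /at_k svu.
have gt k : {zw : C k * C k | g k = zw.1 * zw.2 /\ t k = zw.2 * zw.1}.
  apply: cid; have [||||||||z [w [gzw twz]]] :=
    C_cancel k (e k) (f k) (g k) (t k).
  - exact: ee.
  - exact: ff.
  - exact: gg.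
  - exact: tt.
  - by split; [exact: eg|exact: ge].
  - by split; [exact: ft|exact: tf].
  - by exists (x k), (y k); split; [exact: exy|exact: fyx].
  - by exists (u k), (v k); split; [exact: suv|exact: svu].
  - by exists (z, w).
exists (Theta (fun k => (projT1 (gt k)).1)), (Theta (fun k => (projT1 (gt k)).2)).
split; [exact: imageT|exact: imageT| |]; rewrite -thM;
  by congr (Theta _); apply: functional_extensionality_dep => k;
    case: (projT2 (gt k)).
Qed.

Arguments op_entry : simpl never.

Section FiniteDimensional.
Context {R : realType} {p : R} {p1 : 1 <= p}.

Section Units.
Context {T : choiceType}.

Lemma op_unit_subproof (a b : T) :
  bounded_linear_pred (fun u : ell p1 T => u b *: delta p1 a).
Proof.
apply/asboolP; split; last first.
  exists 1 => u; rewrite mul1r ell_normrZ.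
  apply: le_trans (normc_le_ell_norm u b).
  by rewrite ler_piMr ?normc_ge0// norm_delta_le1.
by move=> k u v; rewrite scalerA -scalerDl.
Qed.

Definition op_unit (a b : T) : ell_op p1 T := EllOp (op_unit_subproof a b).

Lemma op_entry_unit a b x y :
  op_entry (op_unit a b) x y = (x == a)%:R * (b == y)%:R.
Proof. by rewrite mulrC. Qed.

Lemma op_entry_add (S S' : ell_op p1 T) x y :
  op_entry (S + S') x y = op_entry S x y + op_entry S' x y.
Proof. by []. Qed.

Lemma op_entry_scale k (S : ell_op p1 T) x y :
  op_entry (k *: S) x y = k * op_entry S x y.
Proof. by []. Qed.

Lemma op_entry_sum (I : Type) (r : seq I) (S : I -> ell_op p1 T) x y :
  op_entry (\sum_(i <- r) S i) x y = \sum_(i <- r) op_entry (S i) x y.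
Proof.
by elim/big_rec2: _ => // i z S' _ <-.
Qed.

End Units.

Context {d : nat}.
Implicit Types (S : ell_op p1 'I_d) (m : 'M[R[i]]_d).

Definition op_of_mx m : ell_op p1 'I_d :=
  \sum_i \sum_j m i j *: op_unit i j.

Lemma op_entry_of_mx m i j : op_entry (op_of_mx m) i j = m i j.
Proof.
have E k : op_entry (\sum_l m k l *: op_unit k l) i j = (i == k)%:R * m k j.
  rewrite op_entry_sum (bigD1 j)//= big1 ?addr0 => [|l lj].
    by rewrite op_entry_scale op_entry_unit eqxx mulr1 mulrC.
  by rewrite op_entry_scale op_entry_unit (negbTE lj) !mulr0.
rewrite /op_of_mx op_entry_sum (eq_bigr _ (fun k _ => E k)).
rewrite (bigD1 i)//= big1 ?addr0 => [|k ki]; first by rewrite eqxx mul1r.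
by rewrite eq_sym (negbTE ki) mul0r.
Qed.

Lemma op_entryM S S' i j :
  op_entry (S * S') i j = \sum_k op_entry S i k * op_entry S' k j.
Proof.
rewrite [LHS](@op_row_sum _ _ _ _ S (S' (delta p1 j)) i (enum 'I_d)).
- by rewrite big_enum.
- exact: enum_uniq.
- by move=> k _ _; rewrite mem_enum.
Qed.

Lemma op_of_mxD m m' : op_of_mx (m + m') = op_of_mx m + op_of_mx m'.
Proof. by apply: op_eqP => i j; rewrite op_entry_add !op_entry_of_mx mxE. Qed.

Lemma op_of_mxM m m' : op_of_mx (m *m m') = op_of_mx m * op_of_mx m'.
Proof.
apply: op_eqP => i j; rewrite op_entryM op_entry_of_mx mxE.
by apply: eq_bigr => k _; rewrite !op_entry_of_mx.
Qed.

Lemma op_of_mx_inj : injective op_of_mx.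
Proof.
by move=> m m' mm'; apply/matrixP => i j; rewrite -!op_entry_of_mx mm'.
Qed.

End FiniteDimensional.

(** * Matrices over the uniform Roe algebra *)

Section MatrixNorm.
Context {R : realType} {A : pzRingType} {nm : A -> R} {n : nat}.
Hypothesis nmP : complete_norm nm.

(** The sum of the norms of the entries is submultiplicative for every size, which
    spares the choice of an operator norm on matrices over A. *)
Definition mx_norm1 (a : 'M[A]_n) : R := \sum_i \sum_j nm (a i j).

Definition mx_over (D : set A) : set 'M[A]_n := [set a | forall i j, D (a i j)].

Lemma mx_norm1_entry (a : 'M[A]_n) i j : nm (a i j) <= mx_norm1 a.
Proof.
rewrite /mx_norm1 (bigD1 i)//= (bigD1 j)//= -addrA lerDl.
have nm_ge0 := cnorm_ge0 nmP.
by rewrite addr_ge0// sumr_ge0// => k _; rewrite sumr_ge0.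
Qed.

Lemma mx_norm1_bound (a : 'M[A]_n) (b : 'I_n -> 'I_n -> R) (c : R) :
  (forall i j, nm (a i j) <= b i j * c) ->
  mx_norm1 a <= (\sum_i \sum_j b i j) * c.
Proof.
move=> ab; rewrite mulr_suml; apply: ler_sum => i _.
by rewrite mulr_suml; apply: ler_sum => j _.
Qed.

Lemma nm_sum (I : Type) (r : seq I) (F : I -> A) :
  nm (\sum_(i <- r) F i) <= \sum_(i <- r) nm (F i).
Proof.
elim/big_rec2: _ => [|i x y _ yx]; first by rewrite (cnorm0 nmP).
by apply: le_trans (cnormD nmP _ _) _; rewrite lerD2l.
Qed.

Lemma mx_norm1_complete : complete_norm mx_norm1.
Proof.
have nm_ge0 := cnorm_ge0 nmP.
split.
- by rewrite /mx_norm1 big1// => i _; rewrite big1// => j _;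
    rewrite mxE (cnorm0 nmP).
- by move=> a; rewrite sumr_ge0// => i _; rewrite sumr_ge0.
- move=> a a0; apply/matrixP => i j; rewrite mxE; apply: (cnorm_eq0 nmP).
  by apply/eqP; rewrite eq_le nm_ge0 andbT -a0 mx_norm1_entry.
- move=> a; apply: eq_bigr => i _; apply: eq_bigr => j _.
  by rewrite mxE (cnormN nmP).
- move=> a b; rewrite -big_split; apply: ler_sum => i _ /=.
  rewrite -big_split; apply: ler_sum => j _ /=.
  by rewrite mxE; exact: cnormD nmP _ _.
- move=> a b; rewrite mulr_suml; apply: ler_sum => i _ /=.
  apply: (@le_trans _ _ (\sum_j \sum_k nm (a i k) * nm (b k j))).
    apply: ler_sum => j _; rewrite mxE; apply: le_trans (nm_sum _ _) _.
    by apply: ler_sum => k _; exact: cnormM nmP _ _.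
  rewrite exchange_big mulr_suml; apply: ler_sum => k _ /=.
  rewrite -mulr_sumr ler_wpM2l// /mx_norm1 [leRHS](bigD1 k)//= lerDl.
  by rewrite sumr_ge0// => l _; rewrite sumr_ge0.
- move=> u c uc.
  have lim ij : {lb : A * R |
      forall k, nm (u k ij.1 ij.2 - lb.1) <= lb.2 * 2^-1 ^+ k}.
    apply: cid.
    have [k|l [b lb]] := @cnorm_complete _ _ _ nmP (fun k => u k ij.1 ij.2) c.
      apply: le_trans (uc k).
      by have := mx_norm1_entry (u k.+1 - u k) ij.1 ij.2; rewrite !mxE.
    by exists (l, b).
  exists (\matrix_(i, j) (projT1 (lim (i, j))).1).
  exists (\sum_i \sum_j (projT1 (lim (i, j))).2) => k.
  apply: mx_norm1_bound => i j; rewrite !mxE.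
  exact: (projT2 (lim (i, j))).
Qed.

Lemma mx_over_closed (D : set A) : closed_subring nm D ->
  closed_subring mx_norm1 (mx_over D).
Proof.
move=> cD; split.
- by move=> a b Da Db i j; rewrite !mxE; apply: (csub_B cD).
- move=> a b Da Db i j; rewrite mxE.
  have D0 : D 0 := csub_0 cD (Da i j).
  elim/big_ind: _ => // [x y Dx Dy|k _]; first exact: (csub_D cD).
  exact: (csub_M cD).
- move=> u l b Du ul i j; apply: (csub_lim cD (u := fun k => u k i j) (b := b)).
    by move=> k; exact: Du.
  move=> k; apply: le_trans (ul k).
  by have := mx_norm1_entry (u k - l) i j; rewrite !mxE.
Qed.

(** Finitely many entries are approximated in one member of the family, by
    directedness. *)
Lemma mx_over_dense (F : set (set A)) :
  (forall D D', F D -> F D' -> exists D'', [/\ F D'', D `<=` D'' & D' `<=` D'']) ->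
  (forall a (eps : R), 0 < eps ->
    exists D a', [/\ F D, D a' & nm (a' - a) <= eps]) ->
  forall (a : 'M[A]_n) (eps : R), 0 < eps ->
  exists D a', [/\ F D, mx_over D a' & mx_norm1 (a' - a) <= eps].
Proof.
move=> F_dir F_dense a eps eps0.
pose c : R := (n * n)%:R; have c0 : 0 < c + 1 by rewrite ltr_wpDl.
pose eta := eps / (c + 1); have eta0 : 0 < eta by rewrite divr_gt0.
have [D [FD Da]] : exists D, F D /\ forall ij, ij \in enum {: 'I_n * 'I_n} ->
    exists2 b, D b & nm (b - a ij.1 ij.2) <= eta.
  elim: (enum _) => [|ij s [D [FD Ds]]].
    by have [D [_ [FD _ _]]] := F_dense 0 eps eps0; exists D.
  have [D' [b [FD' D'b ba]]] := F_dense (a ij.1 ij.2) eta eta0.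
  have [D'' [FD'' DD'' D'D'']] := F_dir _ _ FD FD'.
  exists D''; split => // kl; rewrite inE => /orP[/eqP ->|/Ds[b' Db' b'a]].
    by exists b => //; exact: D'D''.
  by exists b' => //; exact: DD''.
have pick ij : {b : A | D b /\ nm (b - a ij.1 ij.2) <= eta}.
  by apply: cid; have [|b] := Da ij; [rewrite mem_enum|exists b].
exists D, (\matrix_(i, j) projT1 (pick (i, j))); split => //.
  by move=> i j; rewrite mxE; case: (projT2 (pick (i, j))).
apply: (@le_trans _ _ ((\sum_(i < n) \sum_(j < n) 1) * eta)).
  apply: mx_norm1_bound => i j; rewrite mul1r !mxE.
  by case: (projT2 (pick (i, j))).
have -> : \sum_(i < n) \sum_(j < n) 1 = c :> R.
  by rewrite !sumr_const !card_ord -mulrnA.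
apply: (@le_trans _ _ ((c + 1) * eta)); first by rewrite ler_wpM2r ?ltW// ltrDl.
by rewrite /eta mulrC divfK// gt_eqF.
Qed.

End MatrixNorm.

(** * From inductive limits to cancellation *)

Section RoeCancellation.
Context {R : realType} {p : R} {p1 : 1 <= p} {X : metricType R}.
Local Notation Bu := (uniform_roe p1 X).
Local Notation nm := (fun a : Bu => `|a|).

Lemma roe_complete_norm : complete_norm nm.
Proof.
split.
- exact: normr0.
- exact: normr_ge0.
- exact: normr0_eq0.
- exact: normrN.
- exact: ler_normD.
- by move=> a b; exact: opnormM.
move=> u c uc.
have [l [b ub]] := @ell_op_complete _ _ p1 X (fun k => roe_op (u k)) c uc.
have lP : roe_pred l.
  apply/asboolP => e e0; have e2 : 0 < e / 2 by rewrite divr_gt0.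
  have [k bk] := halfX_eventually b e2.
  have : roe_pred (roe_op (u k)) by case: (u k).
  move=> /asboolP /(_ _ e2) [S fS uS]; exists S => //.
  have ule : `|roe_op (u k) - l| <= e / 2 := le_trans (ub k) bk.
  have -> : l - S = (roe_op (u k) - S) - (roe_op (u k) - l).
    by rewrite opprB [RHS]addrC addrA subrK.
  apply: le_lt_trans (ler_normB _ _) _; rewrite [e]splitr.
  exact: ltr_leD uS ule.
pose z : Bu := UniformRoe lP.
have zE k : `|u k - z| = `|roe_op (u k) - l| by [].
by exists z, b => k; rewrite zE.
Qed.

Section MatrixSum.
Variables (N : nat) (d : 'I_N -> nat).
Local Notation msum := (forall k : 'I_N, ell_op p1 'I_(d k)).
Variable phi : msum -> Bu.
Hypothesis phiD : forall a b, phi (fun k => a k + b k) = phi a + phi b.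
Hypothesis phiZ : forall (c : R[i]) a, phi (fun k => c *: a k) = c *: phi a.
Hypothesis phiM : forall a b, phi (fun k => a k * b k) = phi a * phi b.
Hypothesis phi_norm : forall a, `|phi a| = \big[Num.max/0]_(k < N) `|a k|.

Lemma msum_component_le a k : `|a k| <= `|phi a|.
Proof. by rewrite phi_norm; apply: le_bigmax. Qed.

Lemma msumB a b : phi (fun k => a k - b k) = phi a - phi b.
Proof.
rewrite -scaleN1r -phiZ -phiD; congr (phi _).
by apply: functional_extensionality_dep => k; rewrite scaleN1r.
Qed.

Lemma msum_inj : injective phi.
Proof.
move=> a b ab; apply: functional_extensionality_dep => k.
apply/eqP; rewrite -subr_eq0 -normr_eq0 eq_le normr_ge0 andbT.
by have := msum_component_le (fun k => a k - b k) k; rewrite msumB ab subrr normr0.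
Qed.

Lemma msum_sum (J : Type) (s : seq J) (F : J -> msum) :
  phi (fun k => \sum_(l <- s) F l k) = \sum_(l <- s) phi (F l).
Proof.
elim: s => [|l s IHs].
  rewrite big_nil -[RHS](scale0r (phi (fun=> 0))) -phiZ; congr (phi _).
  by apply: functional_extensionality_dep => k; rewrite big_nil scaler0.
rewrite big_cons -IHs -phiD; congr (phi _).
by apply: functional_extensionality_dep => k; rewrite big_cons.
Qed.

(** The range is an isometric copy of a finite sum of complete spaces. *)
Lemma msum_closed : closed_subring nm (range phi).
Proof.
split.
- by move=> _ _ [a _ <-] [b _ <-]; rewrite -msumB; exact: imageT.
- by move=> _ _ [a _ <-] [b _ <-]; rewrite -phiM; exact: imageT.
move=> u l b phi_u ul.
have aP k : {a | phi a = u k}.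
  by apply: cid; have [a _ <-] := phi_u k; exists a.
pose a k := projT1 (aP k).
have aE k : phi (a k) = u k := projT2 (aP k).
have b0 : 0 <= b by have := ul 0; rewrite expr0 mulr1; apply: le_trans.
have u_step k : `|u k.+1 - u k| <= (2 * b) * 2^-1 ^+ k.
  have -> : u k.+1 - u k = (u k.+1 - l) - (u k - l).
    by rewrite opprB addrA subrK.
  apply: le_trans (ler_normB _ _) _; apply: le_trans (lerD (ul _) (ul _)) _.
  have -> : 2 * b * 2^-1 ^+ k = b * 2^-1 ^+ k + b * 2^-1 ^+ k by ring.
  rewrite lerD2r ler_wpM2l// exprS; apply: ler_piMl; first exact: halfX_ge0.
  by rewrite invf_le1// ler1n.
have limP j : {lb : ell_op p1 'I_(d j) * R |
    forall k, `|a k j - lb.1| <= lb.2 * 2^-1 ^+ k}.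
  apply: cid; have [k|z [c zc]] := @ell_op_complete _ _ _ _ (a^~ j) (2 * b).
    apply: le_trans (u_step k); rewrite -!aE -msumB.
    exact: (msum_component_le (fun j => a k.+1 j - a k j)).
  by exists (z, c).
pose z j := (projT1 (limP j)).1; pose c j := `|(projT1 (limP j)).2|.
have -> : l = phi z; last exact: imageT.
apply: (limit_unique roe_complete_norm ul (b' := \sum_j c j)) => k.
rewrite -aE -msumB phi_norm; apply: bigmax_le => [|j _].
  apply: mulr_ge0; last exact: halfX_ge0.
  by apply: sumr_ge0 => j _; exact: normr_ge0.
apply: le_trans (projT2 (limP j) k) _; apply: ler_wpM2r; first exact: halfX_ge0.
apply: le_trans (ler_norm _) _; rewrite (bigD1 j)//= lerDl.
by apply: sumr_ge0 => i _; exact: normr_ge0.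
Qed.

Section MatricesOverSum.
Variable n : nat.

(** An n by n matrix over the sum is, in each component, an n by n matrix of
    d k by d k blocks. *)
Definition mx_block k (m : 'M[R[i]]_(n * d k)) (i j : 'I_n) : 'M[R[i]]_(d k) :=
  \matrix_(s, t) m (mxvec_index i s) (mxvec_index j t).

Lemma mx_blockM k (m m' : 'M[R[i]]_(n * d k)) i j :
  mx_block (m *m m') i j = \sum_l mx_block m i l *m mx_block m' l j.
Proof.
apply/matrixP => s t; rewrite summxE !mxE.
transitivity (\sum_(z : 'I_n * 'I_(d k)) m (mxvec_index i s)
    (mxvec_index z.1 z.2) * m' (mxvec_index z.1 z.2) (mxvec_index j t)).
  by rewrite (reindex _ (curry_mxvec_bij n (d k))); apply: eq_bigr => -[l r] _.
rewrite -(pair_bigA _ (fun l r =>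
  m (mxvec_index i s) (mxvec_index l r) * m' (mxvec_index l r) (mxvec_index j t))).
by apply: eq_bigr => l _; rewrite !mxE; apply: eq_bigr => r _; rewrite !mxE.
Qed.

Definition mx_of_blocks (m : forall k, 'M[R[i]]_(n * d k)) : 'M[Bu]_n :=
  \matrix_(i, j) phi (fun k => op_of_mx (mx_block (m k) i j)).

Lemma mx_over_msum : mx_over (range phi) = range mx_of_blocks.
Proof.
apply/seteqP; split => [a phi_a|_ [m _ <-] i j]; last first.
  by rewrite mxE; exact: imageT.
have bP ij : {b | phi b = a ij.1 ij.2}.
  by apply: cid; have [b _ <-] := phi_a ij.1 ij.2; exists b.
pose b i j := projT1 (bP (i, j)).
have bE i j : phi (b i j) = a i j := projT2 (bP (i, j)).
pose split k (x : 'I_(n * d k)) : 'I_n * 'I_(d k) :=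
  enum_val (cast_ord (esym (mxvec_cast n (d k))) x).
have splitK k i s : split k (mxvec_index i s) = (i, s).
  by rewrite /split /mxvec_index cast_ordK enum_rankK.
exists (fun k => \matrix_(x, y)
  op_entry (b (split k x).1 (split k y).1 k) (split k x).2 (split k y).2) => //.
apply/matrixP => i j; rewrite mxE -bE; congr (phi _).
apply: functional_extensionality_dep => k; apply: op_eqP => s t.
by rewrite op_entry_of_mx !mxE !splitK.
Qed.

Lemma msum_cancellation : cancellation_in (mx_over (n := n) (range phi)).
Proof.
rewrite mx_over_msum.
apply: (@cancellation_in_product _ (fun k => 'M[R[i]]_(n * d k) : pzRingType)).
- by move=> k; exact: mx_cancellation.
- move=> a b; apply/matrixP => i j; rewrite !mxE -phiD; congr (phi _).
  apply: functional_extensionality_dep => k; rewrite -op_of_mxD.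
  by congr op_of_mx; apply/matrixP => s t; rewrite !mxE.
- move=> a b; apply/matrixP => i j; rewrite !mxE.
  transitivity (\sum_l phi (fun k =>
      op_of_mx (mx_block (a k) i l) * op_of_mx (mx_block (b k) l j))).
    rewrite -msum_sum; congr (phi _).
    apply: functional_extensionality_dep => k.
    rewrite [mx_block _ i j]mx_blockM; apply: op_eqP => s t.
    rewrite op_entry_of_mx op_entry_sum summxE; apply: eq_bigr => l _.
    by rewrite -op_of_mxM op_entry_of_mx.
  by apply: eq_bigr => l _; rewrite !mxE -phiM.
- move=> a b ab; apply: functional_extensionality_dep => k.
  apply/matrixP => x y; case/mxvec_indexP: x => i s; case/mxvec_indexP: y => j t.
  have := congr1 (fun m : 'M[Bu]_n => m i j) ab; rewrite !mxE.
  move=> /msum_inj /(congr1 (fun f => f k)) /op_of_mx_inj /matrixP /(_ s t).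
  by rewrite !mxE.
Qed.

End MatricesOverSum.
End MatrixSum.

(** Matrices over the approximating subalgebras form a directed family of closed
    subrings with cancellation that is dense in the matrices over B^p_u(X). *)
Lemma limit_cancellation :
  is_inductive_limit_of (@isometric_to_matrix_sum R p p1 X) ->
  has_cancellation Bu.
Proof.
move=> [F [F_sum F_n0 F_dir F_dense]] n.
have nmP := mx_norm1_complete (n := n) roe_complete_norm.
apply: (@cancellation_directed_union _ _ _ nmP (mx_over (n := n) @` F)).
- move=> _ [D FD <-]; apply: (mx_over_closed roe_complete_norm).
  have [_ [N [d [phi [_ [phiD phiZ phiM phi_norm <-]]]]]] := F_sum D FD.
  exact: msum_closed.
- move=> _ _ [D FD <-] [D' FD' <-].
  have [D'' [FD'' DD'' D'D'']] := F_dir D D' FD FD'.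
  exists (mx_over D''); split; first by exists D''.
    by move=> a Da i j; exact: DD''.
  by move=> a Da i j; exact: D'D''.
- move=> a e e0.
  have [b c c0|D [a' [FD Da' a'a]]] :=
    mx_over_dense (nm := nm) F_dir _ a e0.
    have [b' [D FD Db'] bb'] := F_dense b c c0.
    exists D, b'; split; [exact: FD|exact: Db'|].
    by rewrite distrC; exact: ltW bb'.
  by exists (mx_over D), a'; split; [exists D|exact: Da'|exact: a'a].
- move=> _ [D FD <-].
  have [_ [N [d [phi [_ [phiD phiZ phiM phi_norm <-]]]]]] := F_sum D FD.
  exact: msum_cancellation.
Qed.

End RoeCancellation.

(** * Partial translations *)

Section Translations.
Context {R : realType} {p : R} {p1 : 1 <= p}.

(** Injectivity on the domain makes composition with s a contraction. *)
Lemma partial_composition (T : choiceType) (Z : set T) (s : T -> T) :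
  (forall x y, Z x -> Z y -> s x = s y -> x = y) ->
  {S : ell_op p1 T | forall u x, S u x = if x \in Z then u (s x) else 0}.
Proof.
move=> s_inj.
have [||u|S SE _] := @ell_op_exists R p p1 T
  (fun u x => if x \in Z then u (s x) else 0) 1 => //.
- by move=> x k u v; case: ifP => _; rewrite ?mulr0 ?addr0.
- rewrite mul1r; apply/ell_mass_leP => F.
  have -> : \sum_(x <- F) normc (if x \in Z then u (s x) else 0) `^ p =
      \sum_(y <- [seq s x | x <- F & x \in Z]) normc (u y) `^ p.
    rewrite big_map big_filter [RHS]big_mkcond; apply: eq_bigr => x _.
    by case: ifP => // _; rewrite normc0 powR0// gt_eqF// p_gt0.
  apply: sum_powR_le_norm; rewrite map_inj_in_uniq ?filter_uniq//.
  move=> x y; rewrite !mem_filter => /andP[/set_mem Zx _] /andP[/set_mem Zy _].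
  exact: s_inj.
- by exists S.
Qed.

Context {X : metricType R}.
Local Notation Bu := (uniform_roe p1 X).

Lemma roe_eqP (a b : Bu) : (forall u x, roe_op a u x = roe_op b u x) -> a = b.
Proof.
by move=> ab; apply/val_inj/val_inj/funext => u; apply: ell_eqP => x; exact: ab.
Qed.

Lemma roe_mulE (a b : Bu) u x : roe_op (a * b) u x = roe_op a (roe_op b u) x.
Proof. by []. Qed.

Lemma roe_addE (a b : Bu) u x : roe_op (a + b) u x = roe_op a u x + roe_op b u x.
Proof. by []. Qed.

Lemma roe_scaleE (k : R[i]) (a : Bu) u x : roe_op (k *: a) u x = k * roe_op a u x.
Proof. by []. Qed.

Lemma partial_translation (Z : set X) (s : X -> X) (r : R) :
  (forall x y, Z x -> Z y -> s x = s y -> x = y) ->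
  (forall x, Z x -> mdist x (s x) <= r) ->
  {a : Bu | forall u x, roe_op a u x = if x \in Z then u (s x) else 0}.
Proof.
move=> s_inj s_near; have [S SE] := partial_composition s_inj.
have fS : finite_propagation S.
  apply/finite_propagationP; exists r => x y; rewrite /op_entry SE.
  case: ifPn => [|_]; last by rewrite eqxx.
  rewrite in_setE => /s_near xsx.
  rewrite -[delta p1 y (s x)]/((s x == y)%:R).
  by have [<-//|_] := eqVneq (s x) y; rewrite eqxx.
by exists (UniformRoe (finite_propagation_roe fS)).
Qed.

Lemma coordinate_projection (Z : set X) :
  {a : Bu | forall u x, roe_op a u x = if x \in Z then u x else 0}.
Proof.
by apply: (@partial_translation Z id 0) => // x _; rewrite mdistxx.
Qed.

Lemma scalar_cancellation (A : pzRingType) :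
  has_idempotent_cancellation 'M[A]_1 -> has_idempotent_cancellation A.
Proof.
move=> cancel1 e f g h ee ff gg hh [eg ge] [fh hf] [x [y [exy fyx]]].
move=> [u [v [suv svu]]]; pose c (a : A) : 'M[A]_1 := const_mx a.
have cM a b : c a * c b = c (a * b).
  by apply/matrixP => i j; rewrite !mxE big_ord1 !mxE.
have cD a b : c a + c b = c (a + b) by apply/matrixP => i j; rewrite !mxE.
have c0 : c 0 = 0 by apply/matrixP => i j; rewrite !mxE.
have [||||||||z [w [gzw hwz]]] := cancel1 (c e) (c f) (c g) (c h).
- by rewrite /is_idempotent cM ee.
- by rewrite /is_idempotent cM ff.
- by rewrite /is_idempotent cM gg.
- by rewrite /is_idempotent cM hh.
- by rewrite /orthogonal_idem !cM eg ge c0.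
- by rewrite /orthogonal_idem !cM fh hf c0.
- by exists (c x), (c y); rewrite !cM exy fyx.
- by exists (c u), (c v); rewrite !cD !cM suv svu.
exists (z ord0 ord0), (w ord0 ord0); split.
  have := congr1 (fun m : 'M[A]_1 => m ord0 ord0) gzw.
  by rewrite [LHS]mxE [RHS]mxE big_ord1.
have := congr1 (fun m : 'M[A]_1 => m ord0 ord0) hwz.
by rewrite [LHS]mxE [RHS]mxE big_ord1.
Qed.

(** An equivalence between two coordinate projections moves each point of A to
    points of B at bounded distance, up to a small error: the diagonal entries of
    P_A = y P_B x are 1, whereas a finite propagation approximant of y contributes
    nothing at a point of A that is far from B. *)
Lemma projections_not_equiv (A B : set X) (pA pB : Bu) :
  (forall u x, roe_op pA u x = if x \in A then u x else 0) ->
  (forall u x, roe_op pB u x = if x \in B then u x else 0) ->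
  (forall r : R, exists2 a, A a & forall b, B b -> r < mdist a b) ->
  ~ alg_equiv pB pA.
Proof.
move=> pAE pBE far [x [y [pBxy pAyx]]].
have pAA : pA * pA = pA.
  by apply: roe_eqP => u z; rewrite roe_mulE !pAE; case: (_ \in _).
have pA_factor : pA = y * (pB * x).
  transitivity (y * x * (y * x)); first by rewrite -pAyx pAA.
  by rewrite pBxy !mulrA.
pose t := roe_op (pB * x).
have t1 : 0 < `|t| + 1 by rewrite ltr_wpDl.
have : roe_pred (roe_op y) by case: (y).
move=> /asboolP /(_ _ (divr_gt0 ltr01 t1)) [y' fy' yy'].
have /finite_propagationP[r y'r] := fy'.
have [a Aa a_far] := far r.
have y't : op_entry (y' * t) a a = 0.
  apply/eqP; apply/negP => /negP /op_mul_entry_neq0 [z [y'z]].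
  rewrite /op_entry /t roe_mulE pBE; case: ifPn => [|_]; last by rewrite eqxx.
  by rewrite in_setE => /a_far; rewrite ltNge y'r.
have pAaa : op_entry (roe_op pA) a a = 1.
  rewrite /op_entry pAE mem_set//.
  by rewrite -[delta p1 a a]/((a == a)%:R) eqxx.
have split_a : op_entry (roe_op pA) a a = op_entry ((roe_op y - y') * t) a a.
  have -> : (roe_op y - y') * t = roe_op pA - y' * t.
    by rewrite mulrBl pA_factor.
  by rewrite -[RHS]/(op_entry (roe_op pA) a a - op_entry (y' * t) a a) y't subr0.
have : normc (op_entry ((roe_op y - y') * t) a a) < 1.
  apply: le_lt_trans (op_entry_le _ _ _) _.
  apply: le_lt_trans (opnormM _ _) _.
  exact: mulr_lt_div1 (opnorm_ge0 _) (opnorm_ge0 t) yy'.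
by rewrite -split_a pAaa normc1 ltxx.
Qed.

(** With s a translation from Y \ B onto Y \ A, the projections onto Y \ B and
    Y \ A are equivalent, and adding those onto B and A gives the same P_Y:
    cancellation would make P_B and P_A equivalent. *)
Lemma translation_breaks_cancellation (Y A B : set X) (s t : X -> X) (r : R) :
  has_cancellation Bu -> A `<=` Y -> B `<=` Y ->
  (forall x, (Y `\` B) x -> (Y `\` A) (s x)) ->
  (forall x, (Y `\` A) x -> (Y `\` B) (t x)) ->
  (forall x, (Y `\` B) x -> t (s x) = x) ->
  (forall x, (Y `\` A) x -> s (t x) = x) ->
  (forall x, (Y `\` B) x -> mdist x (s x) <= r) ->
  ~ (forall r : R, exists2 a, A a & forall b, B b -> r < mdist a b).
Proof.
move=> /(_ 1) /scalar_cancellation cancelB AY BY sAB tBA ts st s_near far.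
have [pA pAE] := coordinate_projection A.
have [pB pBE] := coordinate_projection B.
have [pE pEE] := coordinate_projection (Y `\` B).
have [pF pFE] := coordinate_projection (Y `\` A).
have [|//|U UE] := @partial_translation (Y `\` B) s r.
  by move=> x y Ex Ey sxy; rewrite -(ts x Ex) sxy ts.
have [||V VE] := @partial_translation (Y `\` A) t r.
- by move=> x y Ex Ey txy; rewrite -(st x Ex) txy st.
- by move=> x Fx; rewrite metric_sym -{2}(st x Fx); apply: s_near; exact: tBA.
apply: (projections_not_equiv pAE pBE far).
have E_B x : x \in Y `\` B -> (x \in B) = false.
  by rewrite in_setE => -[_ nBx]; apply/negP; rewrite in_setE.
have F_A x : x \in Y `\` A -> (x \in A) = false.
  by rewrite in_setE => -[_ nAx]; apply/negP; rewrite in_setE.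
apply: (cancelB pE pF pB pA).
- by apply: roe_eqP => u x; rewrite roe_mulE !pEE; case: (_ \in _).
- by apply: roe_eqP => u x; rewrite roe_mulE !pFE; case: (_ \in _).
- by apply: roe_eqP => u x; rewrite roe_mulE !pBE; case: (_ \in _).
- by apply: roe_eqP => u x; rewrite roe_mulE !pAE; case: (_ \in _).
- split; apply: roe_eqP => u x; rewrite roe_mulE ?pEE ?pBE ?pEE ?pBE.
    by case: ifPn => // /E_B ->.
  by case: (x \in B) (E_B x) => //; case: ifP => // _ /(_ isT).
- split; apply: roe_eqP => u x; rewrite roe_mulE ?pFE ?pAE ?pFE ?pAE.
    by case: ifPn => // /F_A ->.
  by case: (x \in A) (F_A x) => //; case: ifP => // _ /(_ isT).
- exists U, V; split; apply: roe_eqP => u x; rewrite roe_mulE ?UE ?VE ?UE ?VE.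
    rewrite pEE; case: ifPn => //; rewrite in_setE => Ex.
    by rewrite mem_set ?ts//; exact: sAB.
  rewrite pFE; case: ifPn => //; rewrite in_setE => Fx.
  by rewrite mem_set ?st//; exact: tBA.
- have -> : pE + pB = pF + pA.
    apply: roe_eqP => u x.
    rewrite !roe_addE pEE pBE pFE pAE.
    have half Z : Z `<=` Y -> (if x \in Y `\` Z then u x else 0) +
        (if x \in Z then u x else 0) = if x \in Y then u x else 0.
      move=> ZY; have [Zx|nZx] := pselect (Z x).
        rewrite [x \in Y `\` Z]memNset; last by case.
        by rewrite add0r !mem_set//; exact: ZY.
      rewrite [x \in Z]memNset// addr0.
      have [Yx|nYx] := pselect (Y x); first by rewrite !mem_set.
      by rewrite !memNset//; case.
    by rewrite !half.
  exists (pF + pA), (pF + pA); have pp : (pF + pA) * (pF + pA) = pF + pA.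
    have FA : orthogonal_idem pF pA.
      split; apply: roe_eqP => u x; rewrite roe_mulE ?pFE ?pAE ?pFE ?pAE.
        by case: ifPn => // /F_A ->.
      by case: (x \in A) (F_A x) => //; case: ifP => // _ /(_ isT).
    apply: orthogonal_idemD => //; apply: roe_eqP => u x.
      by rewrite roe_mulE !pFE; case: (_ \in _).
    by rewrite roe_mulE !pAE; case: (_ \in _).
  by rewrite pp.
Qed.

End Translations.

(** * Long chains in spaces of positive asymptotic dimension *)

Section Chains.
Context {R : realType} {X : metricType R}.

Definition near_rel (r : R) : rel X := fun x y => mdist x y <= r.

Lemma asdim0_of_bounded_chains :
  (forall r : R, 0 < r -> exists D : R, forall x s,
    path (near_rel r) x s -> mdist x (last x s) <= D) ->
  asymptotic_dimension_zero X.
Proof.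
move=> bounded r r0; have r1 : 0 < r + 1 by rewrite addr_gt0.
have [D xD] := bounded _ r1; pose e := near_rel (r + 1).
pose conn x := [set y | exists2 s, path e x s & last x s = y].
have conn_refl x : conn x x by exists [::].
have conn_trans x y z : conn x y -> conn y z -> conn x z.
  move=> [s xs <-] [t yt <-]; exists (s ++ t); last by rewrite last_cat.
  by rewrite cat_path xs.
have e_sym : symmetric e by move=> x y; rewrite /e /near_rel metric_sym.
have conn_sym x y : conn x y -> conn y x.
  move=> [s xs <-]; exists (rev (belast x s)).
    rewrite rev_path; apply: sub_path xs => a b; by rewrite e_sym.
  by case: s xs => //= a s _; rewrite rev_cons last_rcons.
have conn_eq x y : conn x y -> conn x = conn y.
  move=> xy; apply/seteqP; split => z.
    exact: (conn_trans _ _ _ (conn_sym _ _ xy)).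
  exact: (conn_trans _ _ _ xy).
exists (range conn); split.
- by apply/seteqP; split => // x _; exists (conn x) => //; exists x.
- move=> _ _ [x _ <-] [y _ <-] [z [xz yz]].
  by rewrite (conn_eq x z xz) (conn_eq y z yz).
- exists D => _ [x _ <-]; apply: ge_ereal_sup => _ [[y z] /= [xy xz] <-].
  have [s ys <-] := conn_trans _ _ _ (conn_sym _ _ xy) xz.
  by rewrite lee_fin; exact: xD.
- move=> _ _ [x _ <-] [y _ <-] xy.
  apply: (@lt_le_trans _ _ (r + 1)%:E); first by rewrite lte_fin ltrDl.
  apply: le_ereal_inf_tmp => _ [[a b] /= [xa yb] <-]; rewrite lee_fin ltW//.
  rewrite ltNge; apply/negP => ab; apply: xy.
  have xb : conn x b.
    apply: (conn_trans _ _ _ xa); exists [:: b] => //=.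
    by rewrite /e /near_rel ab.
  by rewrite (conn_eq x b xb) (conn_eq y b yb).
Qed.

(** If chains avoiding the ball of radius rho about o moved by at most n, then
    cutting a chain at its first and last visits to that ball would bound every
    chain. *)
Lemma far_chains : ~ asymptotic_dimension_zero X ->
  exists2 r : R, 0 < r & forall o (rho n : R), exists x s,
    [/\ path (near_rel r) x s, uniq (x :: s),
        forall z, z \in x :: s -> rho < mdist o z & n < mdist x (last x s)].
Proof.
move=> asdimN; have {}asdimN : exists2 r : R, 0 < r &
    forall D : R, exists x s, path (near_rel r) x s /\ D < mdist x (last x s).
  apply: contrapT => none; apply: asdimN; apply: asdim0_of_bounded_chains.
  move=> r r0; apply: contrapT => unbounded; apply: none; exists r => // D.
  apply: contrapT => noneD; apply: unbounded; exists D => x s xs.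
  by rewrite leNgt; apply/negP => Dx; apply: noneD; exists x, s.
have [r r0 long] := asdimN; exists r => // o rho n.
apply: contrapT => none.
have avoid x s : path (near_rel r) x s ->
    (forall z, z \in x :: s -> rho < mdist o z) -> mdist x (last x s) <= n.
  move=> xs; case/shortenP: xs => s' xs' us' sub far.
  rewrite leNgt; apply/negP => nx; apply: none; exists x, s'; split => //.
  move=> z; rewrite inE => zs; apply: far; rewrite inE.
  by case/orP: zs => [->//|/sub ->]; rewrite orbT.
have hit x s : path (near_rel r) x s ->
    (exists2 z, z \in x :: s & mdist o z <= rho) ->
    mdist o x <= `|rho| + `|n| + r.
  move=> xs [z zs oz].
  have [ox|ox] := leP (mdist o x) rho.
    have := ler_norm rho; have := normr_ge0 n; lra.
  have {zs} : has (fun y => mdist o y <= rho) s.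
    move: zs; rewrite inE => /orP[/eqP zx|zs]; last by apply/hasP; exists z.
    by rewrite zx leNgt ox in oz.
  move=> s_hits; case: (split_find s_hits) xs => {oz}z s1 s2 oz hs1.
  rewrite cat_path rcons_path => /andP[/andP[xs1 s1z] _].
  have xn : mdist x (last x s1) <= n.
    apply: avoid => // w; rewrite inE => /orP[/eqP ->//|ws1].
    by rewrite ltNge; apply: contra hs1 => ow; apply/hasP; exists w.
  have t1 := metric_triangle o z x; have t2 := metric_triangle z (last x s1) x.
  rewrite metric_sym in xn; rewrite /near_rel metric_sym in s1z.
  have := ler_norm rho; have := ler_norm n; lra.
have [x [s [xs Dx]]] := long (2 * (`|rho| + `|n| + r)).
have [[z zs oz]|far] := pselect (exists2 z, z \in x :: s & mdist o z <= rho).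
  have ox := hit x s xs (ex_intro2 _ _ z zs oz).
  have oy : mdist o (last x s) <= `|rho| + `|n| + r.
    apply: (hit (last x s) (rev (belast x s))).
      rewrite rev_path; apply: sub_path xs => a b.
      by rewrite /near_rel metric_sym.
    exists z => //; rewrite -[_ :: _]rev_rcons -lastI mem_rev.
    exact: zs.
  have := metric_triangle x o (last x s).
  by rewrite (metric_sym x o); lra.
have : mdist x (last x s) <= n.
  apply: avoid => // z zs; rewrite ltNge; apply/negP => oz.
  by apply: far; exists z.
have := normr_ge0 rho; have := ler_norm n; have := normr_ge0 n; lra.
Qed.

(** With rho 0 = 0, the radius rho (n + 1) adds to rho n the distances from o to
    all the points of chain n and 1. Each chain is taken outside the ball of
    radius rho n, hence at distance more than n from all the earlier ones. *)
Lemma chain_sequence : ~ asymptotic_dimension_zero X ->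
  exists (r : R) (x : nat -> X) (s : nat -> seq X), (forall n,
    [/\ path (near_rel r) (x n) (s n), uniq (x n :: s n) &
        n%:R < mdist (x n) (last (x n) (s n))]) /\
    forall i j z w, (i < j)%N -> z \in x i :: s i -> w \in x j :: s j ->
      j%:R < mdist z w.
Proof.
move=> asdimN; have [ o _] : exists o : X, True.
  apply: contrapT => empty; apply: asdimN; apply: asdim0_of_bounded_chains.
  by move=> r _; exists 0 => x; case: empty; exists x.
have [r _ far] := far_chains asdimN.
have /choice [c cP] : forall q : R * R, exists c : X * seq X,
    [/\ path (near_rel r) c.1 c.2, uniq (c.1 :: c.2),
      forall z, z \in c.1 :: c.2 -> q.1 < mdist o z &
      q.2 < mdist c.1 (last c.1 c.2)].
  by move=> q; have [x [s xs]] := far o q.1 q.2; exists (x, s).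
pose chain rho n := c (rho, n%:R).
pose mem rho n := (chain rho n).1 :: (chain rho n).2.
pose rho := fix rho n := if n is n'.+1
  then rho n' + \sum_(z <- mem (rho n') n') mdist o z + 1 else 0.
have rhoS n : rho n.+1 = rho n + \sum_(z <- mem (rho n) n) mdist o z + 1 by [].
pose C n := chain (rho n) n.
have mem_le n z : z \in mem (rho n) n ->
    mdist o z <= \sum_(z <- mem (rho n) n) mdist o z.
  move=> zn; rewrite (perm_big _ (perm_to_rem zn)) big_cons lerDl.
  by apply: sumr_ge0 => w _; exact: mdist_ge0.
have sum_ge0 n : 0 <= \sum_(z <- mem (rho n) n) mdist o z.
  by apply: sumr_ge0 => w _; exact: mdist_ge0.
have rho_n n : n%:R <= rho n.
  elim: n => // n IHn; rewrite rhoS -natr1.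
  by have := sum_ge0 n; lra.
have rho_far i j z : (i < j)%N -> z \in mem (rho i) i ->
    mdist o z + j%:R <= rho j.
  elim: j => // j IHj; rewrite ltnS leq_eqVlt rhoS -natr1.
  move=> /orP[/eqP <-|ij] zi.
    by have := rho_n i; have := mem_le i z zi; lra.
  by have := IHj ij zi; have := sum_ge0 j; lra.
exists r, (fun n => (C n).1), (fun n => (C n).2); split.
  by move=> n; have [] := cP (rho n, n%:R).
move=> i j z w ij zi wj; have := rho_far i j z ij zi.
have [_ _ /(_ w wj)/= ow _] := cP (rho j, j%:R).
by have := metric_triangle o z w; lra.
Qed.

Lemma next_last (x : X) s : uniq (x :: s) -> next (x :: s) (last x s) = x.
Proof.
move=> us; rewrite next_nth mem_last index_last//.
by rewrite nth_default.
Qed.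

Lemma near_next (r : R) x s z : path (near_rel r) x s -> uniq (x :: s) ->
  z \in x :: s -> z != last x s -> near_rel r z (next (x :: s) z).
Proof.
move=> xs us zs zl; rewrite next_nth zs.
have zi : (index z (x :: s) < size s)%N.
  have : (index z (x :: s) < (size s).+1)%N.
    by rewrite -[(size s).+1]/(size (x :: s)) index_mem.
  rewrite ltnS leq_eqVlt => /orP[/eqP zi|//].
  move/eqP: zl; case; rewrite -[LHS](nth_index x zs) zi.
  exact: (nth_last x (x :: s)).
by have /(pathP x)/(_ _ zi) := xs; rewrite nth_index.
Qed.

(** The translation s sends each point of a chain to the next one; as the cyclic
    successor it is a permutation of the chain, whose only long step leads from
    the last point, in B, to the first one, in A. *)
Lemma cancellation_asdim0 (p : R) (p1 : 1 <= p) :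
  has_cancellation (uniform_roe p1 X) -> asymptotic_dimension_zero X.
Proof.
move=> cancel; apply: contrapT => /chain_sequence[r [x [s [chainP far]]]].
pose c n := x n :: s n.
pose Y := [set z | exists n, z \in c n].
pose A := [set x n | n in [set: nat]].
pose B := [set last (x n) (s n) | n in [set: nat]].
have c_uniq n : uniq (c n) by have [] := chainP n.
have disjoint m n z : z \in c m -> z \in c n -> m = n.
  have lt i j : (i < j)%N -> z \in c i -> z \in c j -> False.
    by move=> ij zi zj; have := far i j z z ij zi zj; rewrite mdistxx ltNge ler0n.
  by move=> zm zn; case: (ltngtP m n) => // /lt; [case/(_ zm zn)|case/(_ zn zm)].
have [ix ixP] : exists ix : X -> nat, forall n z, z \in c n -> ix z = n.
  have /choice[ix ixP] : forall z, exists m, forall n, z \in c n -> m = n.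
    move=> z; have [[m zm]|noz] := pselect (exists m, z \in c m).
      by exists m => n; exact: disjoint.
    by exists 0 => n zn; case: noz; exists n.
  by exists ix => n z; exact: ixP.
pose sg z := next (c (ix z)) z; pose tg z := prev (c (ix z)) z.
have sgE n z : z \in c n -> sg z = next (c n) z by move=> zn; rewrite /sg (ixP n).
have tgE n z : z \in c n -> tg z = prev (c n) z by move=> zn; rewrite /tg (ixP n).
have xc n : x n \in c n by exact: mem_head.
have lc n : last (x n) (s n) \in c n by exact: mem_last.
have tsg z : Y z -> tg (sg z) = z.
  move=> [n zn]; rewrite (sgE n z zn) (tgE n) ?mem_next//.
  by rewrite prev_next.
have stg z : Y z -> sg (tg z) = z.
  move=> [n zn]; rewrite (tgE n z zn) (sgE n) ?mem_prev//.
  by rewrite next_prev.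
have sgY z : Y z -> Y (sg z).
  by move=> [n zn]; exists n; rewrite (sgE n z zn) mem_next.
have tgY z : Y z -> Y (tg z).
  by move=> [n zn]; exists n; rewrite (tgE n z zn) mem_prev.
have sg_last n : sg (last (x n) (s n)) = x n 
  by rewrite (sgE n _ (lc n)); exact: (next_last (c_uniq n)).
have tg_head n : tg (x n) = last (x n) (s n).
  by rewrite -{1}sg_last tsg//; exists n.
apply: (@translation_breaks_cancellation _ _ p1 X Y A B sg tg r) => //.
- by move=> _ [n _ <-]; exists n.
- by move=> _ [n _ <-]; exists n.
- move=> z [Yz nBz]; split; first exact: sgY.
  move=> [n _ xn]; apply: nBz; exists n => //.
  by rewrite -tg_head xn tsg.
- move=> z [Yz nAz]; split; first exact: tgY.
  move=> [n _ ln]; apply: nAz; exists n => //.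
  by rewrite -sg_last ln stg.
- by move=> z [Yz _]; exact: tsg.
- by move=> z [Yz _]; exact: stg.
- move=> z [[n zn] nBz]; rewrite (sgE n z zn).
  have [xs us _] := chainP n; apply: near_next => //.
  by apply/eqP => zl; apply: nBz; exists n.
move=> t; pose n := Num.bound `|t|.
have tn : t < n%:R.
  by apply: le_lt_trans (ler_norm t) _; exact: archi_boundP.
exists (x n); first by exists n.
move=> _ [m _ <-]; apply: (lt_trans tn).
case: (ltngtP n m) => [nm|mn|->]; last by have [] := chainP m.
  apply: (@lt_trans _ _ m%:R); first by rewrite ltr_nat.
  exact: (far n m).
by rewrite metric_sym; exact: (far m n).
Qed.

End Chains.

(** * Block diagonal operators *)

Section Blocks.
Context {R : realType} {p : R} {p1 : 1 <= p}.
Let p0 : 0 < p := lt_le_trans ltr01 p1.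

Lemma fin_powR_norm (T : finType) (u : ell p1 T) :
  `|u| `^ p = \sum_x normc (u x) `^ p.
Proof.
apply/eqP; rewrite eq_le; apply/andP; split; last first.
  exact: sum_powR_le_norm (index_enum_uniq T).
have s0 : 0 <= \sum_x normc (u x) `^ p by apply: sumr_ge0 => x _; exact: powR_ge0.
rewrite -(powRVK p1 s0) (ler_powRp p1) ?powR_ge0//.
rewrite ell_normE ell_norm_leP ?powR_ge0//; apply/ell_mass_leP => F.
rewrite (powRVK p1 s0).
rewrite [leRHS](bigID (mem F))/= -[leLHS]addr0; apply: lerD.
  rewrite le_eqVlt; apply/orP; left; apply/eqP; rewrite -[RHS]big_filter.
  apply: perm_big; apply: uniq_perm.
  - exact: fset_uniq.
  - by rewrite filter_uniq// index_enum_uniq.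
  by move=> x; rewrite mem_filter mem_index_enum andbT.
by apply: sumr_ge0 => x _; exact: powR_ge0.
Qed.

Lemma norm_sum_delta_powR (T : choiceType) (s : seq T) (c : T -> R[i]) : uniq s ->
  `|\sum_(y <- s) c y *: delta p1 y| `^ p <= \sum_(y <- s) normc (c y) `^ p.
Proof.
move=> s_uniq.
have s0 : 0 <= \sum_(y <- s) normc (c y) `^ p.
  by apply: sumr_ge0 => x _; exact: powR_ge0.
rewrite -(powRVK p1 s0) (ler_powRp p1) ?powR_ge0//.
rewrite ell_normE ell_norm_leP ?powR_ge0//; apply/ell_mass_leP => F.
rewrite (powRVK p1 s0).
under eq_bigr do rewrite sum_deltaE//.
rewrite (bigID (mem s))/= [X in _ + X]big1 ?addr0; last first.
  by move=> x /negbTE ->; rewrite normc0 powR0// gt_eqF.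
rewrite (eq_bigr (fun x => normc (c x) `^ p)) => [|x ->//].
rewrite [leRHS](bigID (mem F))/= -[leLHS]addr0; apply: lerD.
  rewrite le_eqVlt; apply/orP; left; apply/eqP.
  rewrite -[LHS]big_filter -[RHS]big_filter.
  apply: perm_big; apply: uniq_perm; rewrite ?fset_uniq ?filter_uniq//.
  by move=> x; rewrite !mem_filter andbC.
by apply: sumr_ge0 => x _; exact: powR_ge0.
Qed.

(** A bound that holds on every class of a partition into finite classes holds
    globally: a finite set of points meets finitely many classes. *)
Lemma class_domination (T : choiceType) (cls : T -> seq T)
    (f : T -> R[i]^o) (u : ell p1 T) (b : R) :
  (forall x, uniq (cls x)) -> (forall x, x \in cls x) ->
  (forall x y, y \in cls x -> cls y =i cls x) -> 0 <= b ->
  (forall x, \sum_(y <- cls x) normc (f y) `^ p <=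
    b `^ p * \sum_(y <- cls x) normc (u y) `^ p) ->
  (ell_mass p f <= ((b * `|u|) `^ p)%:E)%E.
Proof.
move=> cls_uniq cls_self cls_eq b0 fu; apply/ell_mass_leP => F.
have bp0 : 0 <= b `^ p := powR_ge0 b p.
suff [G [G_uniq _ FG]] : exists G : seq T, [/\ uniq G,
    forall z, z \in G -> exists2 x, x \in (F : seq T) & z \in cls x &
    \sum_(x <- F) normc (f x) `^ p <= b `^ p * \sum_(y <- G) normc (u y) `^ p].
  apply: (le_trans FG); rewrite powRM//; apply: ler_wpM2l => //.
  exact: sum_powR_le_norm.
move: (F : seq T) (fset_uniq F) => {F} F.
have [n] := ubnP (size F); elim: n F => // n IHn [|x F] szF F_uniq.
  by exists [::]; split => //; rewrite !big_nil mulr0.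
have [||G [G_uniq GF FG]] := IHn [seq y <- F | y \notin cls x].
- by apply: (@leq_ltn_trans (size F)); rewrite ?size_filter ?count_size.
- by rewrite filter_uniq//; case/andP: F_uniq.
have disj z : z \in G -> z \notin cls x.
  move=> /GF[y]; rewrite mem_filter => /andP[yx _] zy.
  by apply: contra yx => zx; rewrite -(cls_eq _ _ zx) (cls_eq _ _ zy).
exists (cls x ++ G); split.
- rewrite cat_uniq cls_uniq G_uniq andbT/=; apply/hasPn => z; exact: disj.
- move=> z; rewrite mem_cat => /orP[zx|/GF[y]].
    by exists x; rewrite ?mem_head.
  by rewrite mem_filter => /andP[_ yF] zy; exists y; rewrite // inE yF orbT.
rewrite big_cat mulrDr (bigID (mem (cls x)))/=; apply: lerD; last first.
  rewrite big_cons cls_self/=; apply: le_trans FG.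
  by rewrite big_filter.
apply: le_trans (fu x).
rewrite [leRHS](bigID (mem (x :: F)))/= -[leLHS]addr0; apply: lerD.
  rewrite le_eqVlt; apply/orP; left; apply/eqP.
  rewrite -[LHS]big_filter -[RHS]big_filter.
  apply: perm_big; apply: uniq_perm; rewrite ?filter_uniq//.
  by move=> z; rewrite !mem_filter andbC.
by apply: sumr_ge0 => z _; exact: powR_ge0.
Qed.

End Blocks.

Section BlockSum.
Context {R : realType} {p : R} {p1 : 1 <= p} {X : metricType R}.
Local Notation Bu := (uniform_roe p1 X).
Let p0 : 0 < p := lt_le_trans ltr01 p1.

Variables (N : nat) (d : 'I_N -> nat) (kind : X -> 'I_N) (r : R).
(* [pt x k i] is the point with label [i] in the block of [x], if that block is
   of kind [k]. *)
Variable pt : X -> forall k, 'I_(d k) -> option X.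
Hypothesis pt_kind : forall x k (i : 'I_(d k)), isSome (pt x i) = (k == kind x).
Hypothesis pt_self : forall x, exists i : 'I_(d (kind x)), pt x i = Some x.
Hypothesis pt_block : forall x k (i : 'I_(d k)) y, pt x i = Some y ->
  kind y = kind x /\ forall k' (j : 'I_(d k')), pt y j = pt x j.
Hypothesis pt_inj : forall x k (i j : 'I_(d k)) y,
  pt x i = Some y -> pt x j = Some y -> i = j.
Hypothesis pt_near : forall x k (i : 'I_(d k)) y,
  pt x i = Some y -> mdist x y <= r.
Hypothesis kind_surj : forall k, exists x, kind x = k.
Local Notation msum := (forall k : 'I_N, ell_op p1 'I_(d k)).

Definition block x k : seq X := pmap (pt x (k := k)) (enum 'I_(d k)).

Lemma block_mem x k y : reflect (exists i : 'I_(d k), pt x i = Some y)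
  (y \in block x k).
Proof.
rewrite mem_pmap; apply: (iffP mapP) => [[i _ ->]|[i xy]]; first by exists i.
by exists i; rewrite ?mem_enum.
Qed.

Lemma block_uniq x k : uniq (block x k).
Proof.
rewrite /block; elim: (enum _) (enum_uniq 'I_(d k)) => //= i s IHs /andP[is_ us].
case xi: (pt x i) => [y|] /=; last exact: IHs.
rewrite IHs// andbT mem_pmap; apply/mapP => -[j js xj].
by move: is_; rewrite (pt_inj xi (esym xj)) js.
Qed.

Lemma sum_block x k (h : X -> R) :
  \sum_(y <- block x k) h y = \sum_(i < d k) oapp h 0 (pt x i).
Proof. by rewrite big_pmap big_enum. Qed.

(** The restriction of a vector to the block of x, transported to labels; it
    vanishes if that block is of another kind. *)
Definition block_restriction x k (u : ell p1 X) : ell p1 'I_(d k) :=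
  \sum_(i <- enum 'I_(d k)) oapp (ell_fun u) 0 (pt x i) *: delta p1 i.

Lemma block_restrictionE x k u (i : 'I_(d k)) :
  block_restriction x k u i = oapp (ell_fun u) 0 (pt x i).
Proof. by rewrite sum_deltaE ?enum_uniq// mem_enum. Qed.

Lemma norm_block_restriction x k u :
  `|block_restriction x k u| `^ p = \sum_(y <- block x k) normc (u y) `^ p.
Proof.
rewrite fin_powR_norm sum_block; apply: eq_bigr => i _.
rewrite block_restrictionE; case: (pt x i) => [//|].
by rewrite /oapp normc0 powR0// gt_eqF.
Qed.

Lemma norm_block_restriction_le x k u : `|block_restriction x k u| <= `|u|.
Proof.
rewrite -(ler_powRp p1 (normr_ge0 _) (normr_ge0 _)) norm_block_restriction.
by apply: sum_powR_le_norm; exact: block_uniq.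
Qed.

Lemma block_restriction_eq x k (i : 'I_(d k)) y :
  pt x i = Some y -> block_restriction y = block_restriction x.
Proof.
move=> xy; have [_ pt_y] := pt_block xy.
apply: functional_extensionality_dep => k'; apply/funext => u.
by apply: ell_eqP => j; rewrite !block_restrictionE pt_y.
Qed.

Lemma block_restriction0 x k u : k != kind x -> block_restriction x k u = 0.
Proof.
move=> kx; apply: ell_eqP => i; rewrite block_restrictionE.
by have := pt_kind x i; rewrite (negbTE kx); case: (pt x i).
Qed.

Definition own_label x : 'I_(d (kind x)) := projT1 (cid (pt_self x)).

Lemma own_labelE x : pt x (own_label x) = Some x.
Proof. exact: (projT2 (cid (pt_self x))). Qed.

Definition block_sum_fun (a : msum) (u : ell p1 X) (x : X) : R[i]^o :=
  a (kind x) (block_restriction x (kind x) u) (own_label x).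

Lemma block_sum_funE a u y k (i : 'I_(d k)) : pt y i = Some y ->
  block_sum_fun a u y = a k (block_restriction y k u) i.
Proof.
move=> yi; have ky : k = kind y by apply/eqP; rewrite -(pt_kind y i) yi.
move: i yi; rewrite ky => i yi.
by rewrite -(pt_inj (own_labelE y) yi).
Qed.

(** The defining property: on each block the operator acts as the matrix of the
    kind of that block. *)
Lemma block_sum_block a u x k (i : 'I_(d k)) :
  oapp (block_sum_fun a u) 0 (pt x i) = a k (block_restriction x k u) i.
Proof.
case xi: (pt x i) => [y|] /=.
  rewrite (@block_sum_funE _ _ _ _ i); first by rewrite (block_restriction_eq xi).
  by have [_ ->] := pt_block xi.
have /block_restriction0 -> : k != kind x by rewrite -(pt_kind x i) xi.
by rewrite raddf0.
Qed.

(** The l^p mass is the sum of the masses of the blocks. *)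
Lemma block_sum_mass a u :
  (ell_mass p (block_sum_fun a u) <=
    ((\big[Num.max/0]_(k < N) `|a k| * `|u|) `^ p)%:E)%E.
Proof.
set b := \big[Num.max/0]_(k < N) `|a k|.
have b0 : 0 <= b by exact: bigmax_ge_id.
apply: (@class_domination _ _ p1 _ (fun x => block x (kind x))) => //.
- by move=> x; exact: block_uniq.
- by move=> x; apply/block_mem; exact: pt_self.
- move=> x y /block_mem[i xy] z; have [kxy pt_y] := pt_block xy.
  rewrite kxy; apply/block_mem/block_mem => -[j jz]; exists j.
    by rewrite -pt_y.
  by rewrite pt_y.
move=> x; rewrite -norm_block_restriction sum_block.
rewrite (eq_bigr (fun i => normc (a (kind x)
    (block_restriction x (kind x) u) i) `^ p)); last first.
  move=> i _; rewrite -block_sum_block; case: (pt x i) => [//|].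
  by rewrite /oapp normc0 powR0// gt_eqF.
rewrite -fin_powR_norm -powRM//; rewrite (ler_powRp p1) ?mulr_ge0//.
apply: le_trans (opnormP _ _) _; apply: ler_wpM2r => //.
exact: (le_bigmax _ (fun k => `|a k|)).
Qed.

Lemma block_sum_op_exists a :
  {S : ell_op p1 X | (forall u x, S u x = block_sum_fun a u x) &
    `|S| <= \big[Num.max/0]_(k < N) `|a k|}.
Proof.
apply: ell_op_exists.
- exact: bigmax_ge_id.
- move=> x k u v; rewrite /block_sum_fun.
  have -> : block_restriction x (kind x) (k *: u + v) =
      k *: block_restriction x (kind x) u + block_restriction x (kind x) v.
    apply: ell_eqP => i; rewrite ell_addE ell_scaleE !block_restrictionE.
    by case: (pt x i) => //=; rewrite mulr0 addr0.
  by rewrite linearP.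
- exact: block_sum_mass.
Qed.

Definition block_sum_op a : ell_op p1 X := s2val (block_sum_op_exists a).

Lemma block_sum_opE a u x : block_sum_op a u x = block_sum_fun a u x.
Proof. exact: (s2valP (block_sum_op_exists a)). Qed.

Lemma block_restriction_sum a u x k :
  block_restriction x k (block_sum_op a u) = a k (block_restriction x k u).
Proof.
apply: ell_eqP => i; rewrite -block_sum_block block_restrictionE.
by case: (pt x i) => //= y; exact: block_sum_opE.
Qed.

Lemma block_extension k (w : ell p1 'I_(d k)) x : kind x = k ->
  exists2 u : ell p1 X, block_restriction x k u = w & `|u| <= `|w|.
Proof.
move=> kx; have pt_some (i : 'I_(d k)) : exists y, pt x i = Some y.
  by have := pt_kind x i; rewrite kx eqxx; case: (pt x i) => // y _; exists y.
pose c y := if [pick i : 'I_(d k) | pt x i == Some y] is Some i then w i else 0.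
have cE (i : 'I_(d k)) y : pt x i = Some y -> c y = w i.
  move=> xi; rewrite /c; case: pickP => [j /eqP xj|/(_ i)].
    by rewrite (pt_inj xj xi).
  by rewrite xi eqxx.
exists (\sum_(y <- block x k) c y *: delta p1 y).
  apply: ell_eqP => i; rewrite block_restrictionE.
  have [y xi] := pt_some i; rewrite xi /= sum_deltaE ?block_uniq//.
  by rewrite (cE i)//; case: block_mem => // -[]; exists i.
rewrite -(ler_powRp p1 (normr_ge0 _) (normr_ge0 _)).
apply: le_trans (norm_sum_delta_powR _ (block_uniq x k)) _.
rewrite sum_block fin_powR_norm; apply: ler_sum => i _.
by have [y xi] := pt_some i; rewrite xi /= (cE i).
Qed.

(** Every kind is realised by a block, and a vector on that block tests the
    component of a. *)
Lemma norm_block_sum_op a : `|block_sum_op a| = \big[Num.max/0]_(k < N) `|a k|.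
Proof.
apply/eqP; rewrite eq_le; apply/andP; split.
  exact: (s2valP' (block_sum_op_exists a)).
apply: bigmax_le => // k _; apply: opnorm_le => // w.
have [x kx] := kind_surj k; have [u uw uw_le] := block_extension w kx.
rewrite -{1}uw -block_restriction_sum.
apply: le_trans (norm_block_restriction_le _ _ _) _.
apply: le_trans (opnormP _ _) _.
by apply: ler_wpM2l => //; exact: opnorm_ge0.
Qed.

Lemma block_sum_roe a : roe_pred (block_sum_op a).
Proof.
apply/finite_propagation_roe/finite_propagationP; exists r => x y.
rewrite /op_entry block_sum_opE /block_sum_fun.
have [/existsP[i /eqP xi] _|none] :=
    boolP [exists i : 'I_(d (kind x)), pt x i == Some y].
  exact: pt_near xi.
have -> : block_restriction x (kind x) (delta p1 y) = 0.
  apply: ell_eqP => i; rewrite block_restrictionE.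
  case xi: (pt x i) => [z|//]; rewrite /= -[LHS]/((z == y)%:R).
  case: eqP => // zy; case/existsP: none.
  by exists i; rewrite xi zy.
by rewrite raddf0 eqxx.
Qed.

Lemma block_sum_exists a :
  {S : Bu | forall u x, roe_op S u x = block_sum_fun a u x &
    `|S| = \big[Num.max/0]_(k < N) `|a k|}.
Proof.
exists (UniformRoe (block_sum_roe a)); first exact: block_sum_opE.
exact: norm_block_sum_op.
Qed.

Definition block_sum a : Bu := s2val (block_sum_exists a).

Lemma block_sumE a u x : roe_op (block_sum a) u x = block_sum_fun a u x.
Proof. exact: (s2valP (block_sum_exists a)). Qed.

Lemma norm_block_sum a : `|block_sum a| = \big[Num.max/0]_(k < N) `|a k|.
Proof. exact: (s2valP' (block_sum_exists a)). Qed.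

Lemma op_entry_block_sum a x k (i j : 'I_(d k)) y z :
  pt x i = Some y -> pt x j = Some z ->
  op_entry (block_sum a) y z = op_entry (a k) i j.
Proof.
move=> xi xj; have [_ pt_y] := pt_block xi.
rewrite {1}/op_entry [LHS]block_sumE (@block_sum_funE _ _ _ _ i) ?pt_y//.
congr (a k _ i); apply: ell_eqP => l; rewrite block_restrictionE pt_y.
rewrite -[RHS]/((l == j)%:R); case: (eqVneq l j) => [->|lj].
  by rewrite xj /= -[LHS]/((z == z)%:R) eqxx.
case xl: (pt x l) => [w|//]; rewrite /= -[LHS]/((w == z)%:R).
case: eqP => // wz; rewrite wz in xl.
by rewrite (pt_inj xl xj) eqxx in lj.
Qed.

Lemma op_entry_block_sum_off a y z : z \notin block y (kind y) ->
  op_entry (block_sum a) y z = 0.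
Proof.
move=> yz; rewrite /op_entry [LHS]block_sumE /block_sum_fun.
have -> : block_restriction y (kind y) (delta p1 z) = 0; last by rewrite raddf0.
apply: ell_eqP => i; rewrite block_restrictionE.
case yi: (pt y i) => [w|//]; rewrite /= -[LHS]/((w == z)%:R).
case: eqP => // wz; case/block_mem: yz; exists i.
by rewrite yi wz.
Qed.

(** The intrinsic description of the range of [block_sum]. *)
Definition block_algebra : set Bu := [set T : Bu |
  (forall y z, op_entry T y z != 0 -> z \in block y (kind y)) /\
  forall k (i j : 'I_(d k)) x y z x' y' z',
    pt x i = Some y -> pt x j = Some z ->
    pt x' i = Some y' -> pt x' j = Some z' ->
    op_entry T y z = op_entry T y' z'].

Lemma range_block_sum : range block_sum = block_algebra.
Proof.
apply/seteqP; split => [_ [a _ <-]|T [T_block T_inv]].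
  split=> [y z|k i j x y z x' y' z' xi xj xi' xj'].
    by apply: contraNT => /op_entry_block_sum_off ->.
  by rewrite (op_entry_block_sum a xi xj) (op_entry_block_sum a xi' xj').
pose base k := projT1 (cid (kind_surj k)).
have kind_base k : kind (base k) = k by exact: (projT2 (cid (kind_surj k))).
have base_some k (i : 'I_(d k)) : exists y, pt (base k) i = Some y.
  have := pt_kind (base k) i; rewrite kind_base eqxx.
  by case: (pt _ i) => // y _; exists y.
pose y_ k (i : 'I_(d k)) := projT1 (cid (base_some k i)).
have y_E k (i : 'I_(d k)) : pt (base k) i = Some (y_ k i).
  exact: (projT2 (cid (base_some k i))).
exists (fun k => op_of_mx (\matrix_(i, j) op_entry T (y_ k i) (y_ k j))) => //.
apply/val_inj; apply: op_eqP => y z.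
rewrite -[op_entry (\val _) y z]/(op_entry (roe_op (block_sum _)) y z).
have [/block_mem[j yj]|yz] := boolP (z \in block y (kind y)).
  rewrite (op_entry_block_sum _ (own_labelE y) yj) op_entry_of_mx mxE.
  exact: (T_inv _ _ _ _ _ _ _ _ _ (y_E _ _) (y_E _ _) (own_labelE y) yj).
rewrite op_entry_block_sum_off//; apply/esym/eqP.
by apply: contraNT yz; exact: T_block.
Qed.

Lemma block_algebra_isometric : (forall k, (0 < d k)%N) ->
  isometric_to_matrix_sum block_algebra.
Proof.
move=> d_gt0; exists N, d, block_sum; split => //; split.
- move=> a b; apply: roe_eqP => u x; apply: etrans (block_sumE _ _ _) _.
  apply: esym; apply: etrans (roe_addE _ _ _ _) _.
  exact: (congr2 +%R (block_sumE a u x) (block_sumE b u x)).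
- move=> c a; apply: roe_eqP => u x; apply: etrans (block_sumE _ _ _) _.
  apply: esym; apply: etrans (roe_scaleE _ _ _ _) _.
  exact: (congr1 ( *%R c) (block_sumE a u x)).
- move=> a b; apply: roe_eqP => u x; apply: etrans (block_sumE _ _ _) _.
  apply: esym; apply: etrans (roe_mulE _ _ _ _) _.
  apply: etrans (block_sumE _ _ _) _; rewrite /block_sum_fun.
  have -> : roe_op (block_sum b) u = block_sum_op b u.
    apply: ell_eqP => y; apply: etrans (block_sumE b u y) _.
    by rewrite block_sum_opE.
  by rewrite block_restriction_sum.
- exact: norm_block_sum.
- exact: range_block_sum.
Qed.

End BlockSum.

Lemma isometric_subalgebra (R : realType) (p : R) (p1 : 1 <= p)
    (X : metricType R) (D : set (uniform_roe p1 X)) :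
  isometric_to_matrix_sum D -> is_subalgebra D.
Proof.
move=> [N [d [phi [_ [phiD phiZ phiM _ <-]]]]]; split.
- by exists (fun=> 0) => //; apply: (addrI (phi (fun=> 0)));
    rewrite -phiD addr0; congr (phi _);
    apply: functional_extensionality_dep => k; rewrite addr0.
- by move=> _ _ [a _ <-] [b _ <-]; rewrite -phiD; exact: imageT.
- by move=> c _ [a _ <-]; rewrite -phiZ; exact: imageT.
- by move=> _ _ [a _ <-] [b _ <-]; rewrite -phiM; exact: imageT.
Qed.

(** * Labelled partitions *)

Section Frames.
Context {R : realType} {p : R} {p1 : 1 <= p} {X : metricType R}.
Local Notation Bu := (uniform_roe p1 X).

(** Injectivity on classes makes the point with a given label unique. *)
Lemma class_lookup (L : finType) (E : X -> X -> Prop) (l : X -> L) :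
  (forall x y, E x y -> E y x) -> (forall x y z, E x y -> E y z -> E x z) ->
  (forall x y, E x y -> l x = l y -> x = y) ->
  exists lft : X -> L -> option X,
    forall x j y, lft x j = Some y <-> E x y /\ l y = j.
Proof.
move=> E_sym E_trans l_inj.
have /choice[f fP] : forall xj : X * L, exists o : option X,
    forall y, o = Some y <-> E xj.1 y /\ l y = xj.2.
  move=> [x j] /=; have [[y [xy yj]]|none] := pselect (exists y, E x y /\ l y = j).
    exists (Some y) => z; split => [[<-]//|[xz zj]]; congr Some.
    apply: l_inj; last by rewrite yj zj.
    exact: E_trans (E_sym _ _ xy) xz.
  by exists None => y; split => // xy; case: none; exists y.
by exists (fun x j => f (x, j)) => x j y; exact: fP.
Qed.

(** A controlled equivalence relation whose classes are read off by finitely many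
    labels: labels are injective on classes, and two classes that share a label
    carry the same labels. *)
Record frame (L : finType) (E : X -> X -> Prop) (l : X -> L) (r : R) : Prop := {
  frame_refl : forall x, E x x;
  frame_sym : forall x y, E x y -> E y x;
  frame_trans : forall x y z, E x y -> E y z -> E x z;
  frame_near : forall x y, E x y -> mdist x y <= r;
  frame_inj : forall x y, E x y -> l x = l y -> x = y;
  frame_lift : forall x y x', E x y -> l x' = l x ->
    exists y', E x' y' /\ l y' = l y }.

Definition frame_algebra (L : finType) (E : X -> X -> Prop) (l : X -> L) :
    set Bu :=
  [set T : Bu | (forall x y, op_entry T x y != 0 -> E x y) /\
    forall x y x' y', E x y -> E x' y' -> l x = l x' -> l y = l y' ->
      op_entry T x y = op_entry T x' y'].

(** The kind of a class is its set of labels. By the lifting property two kinds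
    that meet coincide, so kind and label form the index of a matrix unit. *)
Lemma frame_isometric (L : finType) E (l : X -> L) r : frame E l r ->
  isometric_to_matrix_sum (frame_algebra E l).
Proof.
move=> [E_refl E_sym E_trans E_near l_inj l_lift].
have [lft lftP] := class_lookup E_sym E_trans l_inj.
have lft_self x : lft x (l x) = Some x by apply/lftP.
have lft_E x y : E x y -> lft y = lft x.
  move=> xy; apply/funext => j; case xj: (lft x j) => [z|].
    have [xz zj] := (lftP _ _ _).1 xj; apply/lftP; split => //.
    exact: E_trans (E_sym _ _ xy) xz.
  case yj: (lft y j) => [z|//]; have [yz zj] := (lftP _ _ _).1 yj.
  suff: lft x j = Some z by rewrite xj.
  by apply/lftP; split => //; exact: E_trans xy yz.
pose labels x := [set j | isSome (lft x j)]%SET.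
have labels_E x y : E x y -> labels y = labels x.
  by move=> xy; rewrite /labels (lft_E _ _ xy).
have labels_l x y : l x = l y -> labels x = labels y.
  suff sub a b : l a = l b -> (labels a \subset labels b)%SET.
    by move=> xy; apply/eqP; rewrite finset.eqEsubset !sub.
  move=> ab; apply/fintype.subsetP => j; rewrite !inE.
  case aj: (lft a j) => [z|//] _; have [az zj] := (lftP _ _ _).1 aj.
  have [z' [bz' z'z]] := l_lift _ _ _ az (esym ab).
  by rewrite ((lftP b j z').2 _)// z'z.
have labels_meet x y j : j \in labels x -> j \in labels y -> labels x = labels y.
  rewrite !inE; case xj: (lft x j) => [a|//] _; case yj: (lft y j) => [b|//] _.
  have [xa aj] := (lftP _ _ _).1 xj; have [yb bj] := (lftP _ _ _).1 yj.
  rewrite -(labels_E _ _ xa) -(labels_E _ _ yb); apply: labels_l.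
  by rewrite aj bj.
pose kinds := [set K : {set L} | `[< exists x, labels x = K >]]%SET.
have labels_kind x : labels x \in kinds by rewrite inE; apply/asboolP; exists x.
have /choice[kind kindP] : forall x, exists k : 'I_#|kinds|, enum_val k = labels x.
  by move=> x; exists (enum_rank_in (labels_kind x) (labels x));
    rewrite enum_rankK_in.
have kind_surj k : exists x, kind x = k.
  have : enum_val k \in kinds by exact: enum_valP.
  rewrite inE => /asboolP[x xk]; exists x; apply: enum_val_inj.
  by rewrite kindP xk.
pose d (k : 'I_#|kinds|) := #|(enum_val k : {set L})|.
pose pt x (k : 'I_#|kinds|) (i : 'I_(d k)) := lft x (enum_val i).
have own x : l x \in (enum_val (kind x) : {set L}).
  by rewrite kindP inE lft_self.
have rank_of_label k (j : L) : j \in (enum_val k : {set L}) ->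
    exists i : 'I_(d k), enum_val i = j.
  by move=> jk; exists (enum_rank_in jk j); rewrite enum_rankK_in.
have pt_kind x k (i : 'I_(d k)) : isSome (pt x k i) = (k == kind x).
  have ik : enum_val i \in (enum_val k : {set L}) := enum_valP i.
  rewrite /pt; move: (enum_val i) ik => j jk.
  have [z zk] := kind_surj k.
  apply/idP/eqP => [xj|kx]; last by move: jk; rewrite kx kindP inE.
  apply: enum_val_inj; rewrite kindP -zk kindP.
  by apply: (@labels_meet _ _ j); [rewrite -kindP zk|rewrite inE].
have pt_self x : exists i : 'I_(d (kind x)), pt x (kind x) i = Some x.
  by have [i il] := rank_of_label _ _ (own x); exists i; rewrite /pt il lft_self.
have pt_block x k (i : 'I_(d k)) y : pt x k i = Some y ->
    kind y = kind x /\ forall k' (j : 'I_(d k')), pt y k' j = pt x k' j.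
  move=> /lftP[xy _]; split; last by move=> k' j; rewrite /pt (lft_E _ _ xy).
  by apply: enum_val_inj; rewrite !kindP (labels_E _ _ xy).
have pt_inj x k (i j : 'I_(d k)) y :
    pt x k i = Some y -> pt x k j = Some y -> i = j.
  move=> /lftP[_ yi] /lftP[_ yj]; apply: enum_val_inj.
  by rewrite -yi -yj.
have pt_near x k (i : 'I_(d k)) y : pt x k i = Some y -> mdist x y <= r.
  by move=> /lftP[xy _]; exact: E_near.
have d_gt0 k : (0 < d k)%N.
  have [x <-] := kind_surj k; apply/card_gt0P; exists (l x); exact: own.
have block_E x y : reflect (E x y) (y \in block pt x (kind x)).
  apply: (iffP (block_mem _ _ _ _)) => [[i /lftP[]//]|xy].
  have [|i il] := rank_of_label (kind x) (l y).
    by rewrite kindP -(labels_E _ _ xy) -kindP own.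
  by exists i; rewrite /pt il; apply/lftP.
have -> : frame_algebra E l = block_algebra kind pt.
  apply/seteqP; split => T [T_E T_inv]; split.
  - by move=> x y /T_E xy; apply/block_E.
  - move=> k i j x y z x' y' z' /lftP[xy yi] /lftP[xz zj] /lftP[xy' yi'].
    move=> /lftP[xz' zj']; apply: T_inv; rewrite ?yi ?zj ?yi' ?zj'//.
      exact: E_trans (E_sym _ _ xy) xz.
    exact: E_trans (E_sym _ _ xy') xz'.
  - by move=> x y /T_E /block_E.
  - move=> x y x' y' xy xy' xx yy.
    have [i il] := rank_of_label _ _ (own x).
    have [|j jl] := rank_of_label (kind x) (l y).
      by rewrite kindP -(labels_E _ _ xy) -kindP own.
    apply: (T_inv (kind x) i j x x y x' x' y'); apply/lftP; rewrite ?il ?jl//.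
exact: (block_algebra_isometric pt_kind pt_self pt_block pt_inj pt_near
  kind_surj d_gt0).
Qed.

(** Labels can be enriched so that they determine any finite-valued function of
    two points of a class: add to nu x the table of q on the class of x, with
    points named by their values under nu. *)
Lemma frame_refinement (n : nat) (K : finType) (E : X -> X -> Prop) (r : R)
    (nu : X -> 'I_n) (q : X -> X -> K) :
  (forall x, E x x) -> (forall x y, E x y -> E y x) ->
  (forall x y z, E x y -> E y z -> E x z) ->
  (forall x y, E x y -> mdist x y <= r) ->
  (forall x y, E x y -> nu x = nu y -> x = y) ->
  exists (L : finType) (l : X -> L), frame E l r /\
    forall x y x' y', E x y -> E x' y' -> l x = l x' -> l y = l y' ->
      q x y = q x' y'.
Proof.
move=> E_refl E_sym E_trans E_near nu_inj.
have [table [tableP tableN]] : exists table : X -> {ffun 'I_n * 'I_n -> option K},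
    (forall x y z, E x y -> E x z -> table x (nu y, nu z) = Some (q y z)) /\
    (forall x i j, table x (i, j) -> exists y z,
      [/\ E x y, E x z, nu y = i & nu z = j]).
  have /choice[f fP] : forall xij : X * ('I_n * 'I_n), exists c : option K,
      (forall y z, E xij.1 y -> E xij.1 z -> (nu y, nu z) = xij.2 ->
        c = Some (q y z)) /\
      (c -> exists y z, [/\ E xij.1 y, E xij.1 z & (nu y, nu z) = xij.2]).
    move=> [x ij] /=.
    have [[y [z [xy xz yz]]]|none] :=
        pselect (exists y z, [/\ E x y, E x z & (nu y, nu z) = ij]).
      exists (Some (q y z)); split => [y' z' xy' xz' yz'|_]; last by exists y, z.
      have same a b : E x a -> E x b -> nu a = nu b -> a = b.
        by move=> xa xb; apply: nu_inj; exact: E_trans (E_sym _ _ xa) xb.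
      move: yz'; rewrite -yz => -[yy zz].
      by rewrite (same y y')// (same z z').
    by exists None; split => // y z xy xz yz; case: none; exists y, z.
  exists (fun x => [ffun ij => f (x, ij)]); split => [x y z xy xz|x i j].
    by rewrite ffunE; have [h _] := fP (x, (nu y, nu z)); exact: h.
  rewrite ffunE; have [_ h] := fP (x, (i, j)) => /h[y [z [xy xz [yi zj]]]].
  by exists y, z.
have table_E x y : E x y -> table x = table y.
  move=> xy; apply/ffunP => -[i j].
  case xij: (table x (i, j)) => [c|].
    have [|a [b [xa xb ai bj]]] := tableN x i j; first by rewrite xij.
    move: xij; rewrite -ai -bj (tableP _ _ _ xa xb) => <-; apply/esym.
    by apply: tableP; apply: E_trans (E_sym _ _ xy) _.
  case yij: (table y (i, j)) => [c|//].
  have [|a [b [ya yb ai bj]]] := tableN y i j; first by rewrite yij.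
  move: xij; rewrite -ai -bj (tableP x a b)//; exact: E_trans xy _.
exists ('I_n * {ffun 'I_n * 'I_n -> option K})%type, (fun x => (nu x, table x)).
split; first split => //.
- by move=> x y xy [nuxy _]; exact: nu_inj.
- move=> x y x' xy [nuxx tablexx].
  have [|a [b [xa xb _ nub]]] := tableN x' (nu x) (nu y).
    by rewrite tablexx (tableP x x y).
  exists b; split => //; rewrite nub -(table_E _ _ xb) tablexx.
  by rewrite (table_E _ _ xy).
move=> x y x' y' xy xy' [nuxx tablexx] [nuyy _].
have := tableP _ _ _ (E_refl x) xy; rewrite tablexx nuxx nuyy.
by rewrite (tableP _ _ _ (E_refl x') xy') => -[].
Qed.

(** Classes of bounded diameter are uniformly finite by bounded geometry; nu
    numbers the points of each class. *)
Lemma asdim0_relation (r : R) : bounded_geometry X ->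
  asymptotic_dimension_zero X -> 0 < r ->
  exists (E : X -> X -> Prop) (n : nat) (nu : X -> 'I_n) (D : R),
    [/\ [/\ forall x, E x x, forall x y, E x y -> E y x &
          forall x y z, E x y -> E y z -> E x z],
        forall x y, mdist x y <= r -> E x y,
        forall x y, E x y -> mdist x y <= D &
        forall x y, E x y -> nu x = nu y -> x = y].
Proof.
move=> bgX asdimX r0; have [P [P_cover P_triv [D P_diam] P_dist]] := asdimX r r0.
pose E x y := exists2 A, P A & A x /\ A y.
have E_refl x : E x x.
  have : [set: X] x by [].
  by rewrite -P_cover => -[A PA Ax]; exists A.
have E_sym x y : E x y -> E y x by move=> [A PA [Ax Ay]]; exists A.
have E_trans x y z : E x y -> E y z -> E x z.
  move=> [A PA [Ax Ay]] [B PB [By Bz]]; exists A => //; split => //.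
  have -> : A = B by apply: P_triv => //; exists y.
  by [].
have E_near x y : E x y -> mdist x y <= `|D| + 1.
  move=> [A PA [Ax Ay]]; have := P_diam A PA => diamA.
  have : ((mdist x y)%:E <= D%:E)%E.
    by apply: le_trans diamA; apply: ereal_sup_ubound; exists (x, y).
  by rewrite lee_fin => xy; have := ler_norm D; lra.
(* bounded geometry speaks of positive radii only *)
have D0 : 0 < `|D| + 1 by rewrite ltr_wpDl.
have [n nX] := bgX _ D0.
have /choice[blk blkP] : forall x, exists A, P A /\ A x.
  by move=> x; have [A PA [Ax _]] := E_refl x; exists A.
have blk_E x y : E x y -> blk x = blk y.
  move=> [A PA [Ax Ay]]; have [Px xx] := blkP x; have [Py yy] := blkP y.
  have -> : blk x = A by apply: P_triv => //; exists x.
  by apply: P_triv => //; exists y.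
have /choice[num numP] : forall A : set X, exists f : X -> 'I_n.+1,
    P A -> forall x y, A x -> A y -> f x = f y -> x = y.
  move=> A; have [[a Aa]|A0] := pselect (A !=set0); last first.
    by exists (fun=> ord0) => _ x y Ax; case: A0; exists x.
  have [PA|nPA] := pselect (P A); last by exists (fun=> ord0).
  have : (A #<= `I_n)%card.
    apply: card_le_trans (nX a); apply: subset_card_le => y Ay.
    by apply: E_near; exists A.
  move=> /pcard_leP[f]; exists (fun x => inord (f x)) => _ x y Ax Ay.
  have small z : A z -> (f z < n.+1)%N.
    by move=> Az; exact: ltnW (@funS _ _ _ _ f z Az).
  move=> /(congr1 (@nat_of_ord _)); rewrite !inordK ?small// => fxy.
  by apply: (@inj _ _ _ f); rewrite ?inE.
exists E, n.+1, (fun x => num (blk x) x), (`|D| + 1); split => //.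
- move=> x y xy; have [Px xx] := blkP x; have [Py yy] := blkP y.
  have [AB|AB] := pselect (blk x = blk y).
    by exists (blk x) => //; split => //; rewrite AB.
  have := P_dist _ _ Px Py AB; rewrite ltNge => /negP[].
  apply: (@le_trans _ _ (mdist x y)%:E); last by rewrite lee_fin.
  by apply: ereal_inf_lbound; exists (x, y).
- move=> x y xy; rewrite (blk_E x y xy) => numxy.
  have [Py yy] := blkP y.
  apply: (numP _ Py) numxy => //; rewrite -(blk_E x y xy).
  by have [] := blkP x.
Qed.

End Frames.

(** * Approximation by labelled partitions *)

Section Approximation.
Context {R : realType} {p : R} {p1 : 1 <= p} {X : metricType R}.
Local Notation Bu := (uniform_roe p1 X).
Let p0 : 0 < p := lt_le_trans ltr01 p1.

(** Entrywise small block diagonal operators with uniformly finite blocks are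
    small: on a block with at most n points each of the n values is at most
    n * eta times the norm of the restriction of the vector. *)
Lemma kernel_op (n : nat) (E : X -> X -> Prop) (nu : X -> 'I_n)
    (m : X -> X -> R[i]) (eta : R) :
  (forall x, E x x) -> (forall x y, E x y -> E y x) ->
  (forall x y z, E x y -> E y z -> E x z) ->
  (forall x y, E x y -> nu x = nu y -> x = y) -> 0 <= eta ->
  (forall x y, E x y -> normc (m x y) <= eta) ->
  exists Z : ell_op p1 X, [/\ forall x y, E x y -> op_entry Z x y = m x y,
    forall x y, ~ E x y -> op_entry Z x y = 0 & `|Z| <= n%:R * (n%:R * eta)].
Proof.
move=> E_refl E_sym E_trans nu_inj eta0 m_eta.
have [lft lftP] := class_lookup E_sym E_trans nu_inj.
pose cls x := pmap (lft x) (enum 'I_n).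
have cls_E x y : y \in cls x <-> E x y.
  rewrite mem_pmap; split => [/mapP[j _ /esym/lftP[]//]|xy].
  apply/mapP; exists (nu y); first by rewrite mem_enum.
  by apply/esym/lftP.
have cls_uniq x : uniq (cls x).
  rewrite /cls; elim: (enum _) (enum_uniq 'I_n) => //= j s IHs /andP[js us].
  case xj: (lft x j) => [y|] /=; last exact: IHs.
  rewrite IHs// andbT mem_pmap; apply/mapP => -[j' j's /esym xj'].
  have [_ yj] := (lftP _ _ _).1 xj; have [_ yj'] := (lftP _ _ _).1 xj'.
  by move: js; rewrite -yj yj' j's.
have cls_size x : (size (cls x) <= n)%N.
  rewrite size_pmap; apply: leq_trans (count_size _ _) _.
  by rewrite size_map -enumT size_enum_ord.
have cls_self x : x \in cls x by apply/cls_E.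
have cls_eq x y : y \in cls x -> cls y =i cls x.
  move=> /cls_E xy z; apply/idP/idP => /cls_E yz; apply/cls_E.
    exact: E_trans xy yz.
  exact: E_trans (E_sym _ _ xy) yz.
pose f (u : ell p1 X) x : R[i]^o := \sum_(y <- cls x) m x y * u y.
pose b := n%:R * (n%:R * eta); have n0 : 0 <= n%:R :> R by [].
have b0 : 0 <= b by rewrite !mulr_ge0.
have sum_const (s : seq X) (c : R) : (size s <= n)%N -> 0 <= c ->
    \sum_(y <- s) c <= n%:R * c.
  move=> sn c0; rewrite big_const_seq count_predT iter_addr_0 -[c *+ _]mulr_natl.
  by rewrite ler_wpM2r// ler_nat.
have f_mass u : (ell_mass p (f u) <= ((b * `|u|) `^ p)%:E)%E.
  apply: (class_domination cls_uniq cls_self cls_eq b0) => x.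
  set S := \sum_(y <- cls x) normc (u y) `^ p.
  have S0 : 0 <= S by apply: sumr_ge0 => y _; exact: powR_ge0.
  pose s := S `^ p^-1; have s0 : 0 <= s by exact: powR_ge0.
  have sS : s `^ p = S by exact: powRVK.
  have u_s y : y \in cls x -> normc (u y) <= s.
    move=> xy; rewrite -(ler_powRp p1) ?normc_ge0// sS /S.
    rewrite (bigD1_seq y)//= lerDl.
    by apply: sumr_ge0 => z _; exact: powR_ge0.
  have f_s z : z \in cls x -> normc (f u z) <= n%:R * (eta * s).
    move=> xz; apply: le_trans (sum_const (cls z) _ (cls_size z) _); last first.
      exact: mulr_ge0.
    have normc_sum (r : seq X) (F : X -> R[i]) :
        normc (\sum_(y <- r) F y) <= \sum_(y <- r) normc (F y).
      elim/big_rec2: _ => [|y a c _ ac]; first by rewrite normc0.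
      by apply: le_trans (le_normcD _ _) _; rewrite lerD2l.
    apply: le_trans (normc_sum _ _) _; rewrite big_seq [leRHS]big_seq.
    apply: ler_sum => y zy; rewrite normcM; apply: ler_pM; rewrite ?normc_ge0//.
      by apply: m_eta; apply/cls_E.
    by apply: u_s; rewrite -(cls_eq _ _ xz).
  apply: (@le_trans _ _ (n%:R * (n%:R * (eta * s)) `^ p)).
    apply: le_trans (sum_const (cls x) _ (cls_size x) (powR_ge0 _ _)).
    rewrite big_seq [leRHS]big_seq; apply: ler_sum => z xz.
    by rewrite (ler_powRp p1) ?normc_ge0 ?mulr_ge0// f_s.
  rewrite -sS -powRM// /b -!mulrA [leRHS]powRM ?mulr_ge0//.
  apply: ler_wpM2r; first exact: powR_ge0.
  have n1 : 1 <= n%:R :> R.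
    rewrite ler1n; apply: leq_trans (cls_size x).
    by case: (cls x) (cls_self x).
  by rewrite -{1}[n%:R]powRr1// ler_powR.
have [|Z ZE Zb] := @ell_op_exists _ _ p1 _ f b b0 _ f_mass.
  move=> x k u v; rewrite /f mulr_sumr -big_split; apply: eq_bigr => y _ /=.
  by rewrite mulrDr; congr (_ + _); rewrite [LHS]mulrCA.
have Z_entry x y : op_entry Z x y = if y \in cls x then m x y else 0.
  rewrite /op_entry ZE /f.
  rewrite (eq_bigr (fun z => m x z * (z == y)%:R)); last by [].
  case: ifPn => [xy|xy].
    rewrite (bigD1_seq y)//= eqxx mulr1 big1 ?addr0// => z /negbTE ->.
    by rewrite mulr0.
  rewrite big_seq big1// => z xz; case: eqP => [zy|_]; last by rewrite mulr0.
  by rewrite -zy xz in xy.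
exists Z; split => // x y xy; rewrite Z_entry.
  by rewrite (cls_E x y).2.
by case: ifP => // /cls_E.
Qed.

(** A grid of mesh eta: the real and the imaginary part are rounded down. *)
Lemma finite_net (c eta : R) : 0 <= c -> 0 < eta ->
  exists (K : finType) (v : K -> R[i]) (code : R[i] -> K),
    forall z, normc z <= c -> normc (z - v (code z)) <= 2 * eta.
Proof.
move=> c0 eta0; pose m := Num.truncn (2 * c / eta).
pose step (a : R) : 'I_m.+1 := inord (Num.truncn ((a + c) / eta)).
pose value (i : 'I_m.+1) : R := i%:R * eta - c.
have stepP a : `|a| <= c -> `|a - value (step a)| <= eta.
  rewrite ler_norml => /andP[ca ac].
  have t0 : 0 <= (a + c) / eta by apply: divr_ge0; [lra|exact: ltW].
  have /andP[lo hi] := truncn_itv t0.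
  have t0' : 0 <= 2 * c / eta by apply: divr_ge0; [lra|exact: ltW].
  have /andP[_ hi'] := truncn_itv t0'.
  have km : (Num.truncn ((a + c) / eta) < m.+1)%N.
    rewrite -(ltr_nat R); apply: le_lt_trans lo (le_lt_trans _ hi').
    by rewrite ler_pM2r ?invr_gt0//; lra.
  rewrite /value /step inordK//.
  move: lo hi; rewrite ler_pdivlMr// ltr_pdivrMr// -natr1 => lo hi.
  by rewrite ger0_norm; lra.
exists ('I_m.+1 * 'I_m.+1)%type, (fun ij => value ij.1 +i* value ij.2),
  (fun z => (step (complex.Re z), step (complex.Im z))) => z zc.
apply: le_trans (normc_le_ReIm _) _.
rewrite [complex.Re (_ - _)]raddfB [complex.Im (_ - _)]raddfB/=.
have := stepP _ (le_trans (normc_ge_Re z) zc).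
have := stepP _ (le_trans (normc_ge_Im z) zc).
by lra.
Qed.

Hypothesis bgX : bounded_geometry X.
Hypothesis asdimX : asymptotic_dimension_zero X.

(** A partition coarse enough for both relations, with labels that record both
    relations and both labellings. *)
Lemma frames_directed (L1 L2 : finType) E1 E2 (l1 : X -> L1) (l2 : X -> L2)
    (r1 r2 : R) : frame E1 l1 r1 -> frame E2 l2 r2 ->
  exists (L : finType) E (l : X -> L) r, [/\ frame E l r,
    @frame_algebra _ _ p1 _ _ E1 l1 `<=` frame_algebra E l &
    @frame_algebra _ _ p1 _ _ E2 l2 `<=` frame_algebra E l].
Proof.
move=> fr1 fr2; pose r := `|r1| + `|r2| + 1.
have r_gt0 : 0 < r by rewrite ltr_wpDl// addr_ge0.
have [E [n [nu [D [[E_refl E_sym E_trans] r_E E_D nu_inj]]]]] :=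
  asdim0_relation bgX asdimX r_gt0.
pose q x y := ((`[< E1 x y >], l1 x, l1 y), (`[< E2 x y >], l2 x, l2 y)).
have [L [l [frL lq]]] := frame_refinement q E_refl E_sym E_trans E_D nu_inj.
have sub (L' : finType) E' (l' : X -> L') r' : frame E' l' r' -> r' <= r ->
    (forall x y x' y', E x y -> E x' y' -> l x = l x' -> l y = l y' ->
      [/\ `[< E' x y >] = `[< E' x' y' >], l' x = l' x' & l' y = l' y']) ->
    @frame_algebra _ _ p1 _ _ E' l' `<=` frame_algebra E l.
  move=> fr' r'r lq' T [T_E T_inv]; split.
    by move=> x y /T_E /(frame_near fr') xy; apply/r_E/(le_trans xy).
  move=> x y x' y' xy xy' lx ly; have [EE lx' ly'] := lq' x y x' y' xy xy' lx ly.
  have [E'xy|nE'] := pselect (E' x y).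
    apply: T_inv => //; apply/asboolP; rewrite -EE; exact/asboolP.
  have nE'' : ~ E' x' y' by move=> /asboolP; rewrite -EE => /asboolP.
  have zero a c : ~ E' a c -> op_entry T a c = 0.
    by move=> ac; apply/eqP; apply: contra_notT ac; exact: T_E.
  by rewrite !zero.
exists L, E, l, D; split => //.
  apply: (sub _ _ _ _ fr1) => [|x y x' y' xy xy' lx ly].
    by rewrite /r; have := ler_norm r1; have := normr_ge0 r2; lra.
  by have [-> -> ->] := lq x y x' y' xy xy' lx ly.
apply: (sub _ _ _ _ fr2) => [|x y x' y' xy xy' lx ly].
  by rewrite /r; have := ler_norm r2; have := normr_ge0 r1; lra.
by have [_ _ _ -> -> ->] := lq x y x' y' xy xy' lx ly.
Qed.

(** Round the entries of a finite propagation approximant to a finite net and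
    refine the labels by the rounded entries. *)
Lemma frames_dense (a : Bu) (e : R) : 0 < e ->
  exists (L : finType) E (l : X -> L) r, frame E l r /\
    exists2 b : Bu, frame_algebra E l b & `|a - b| < e.
Proof.
move=> e0; have e2 : 0 < e / 2 by rewrite divr_gt0.
have : roe_pred (roe_op a) by case: (a).
move=> /asboolP /(_ _ e2) [S /finite_propagationP[rho S_rho] aS].
have rho0 : 0 < `|rho| + 1 by rewrite ltr_wpDl.
have [E [n [nu [D [[E_refl E_sym E_trans] r_E E_D nu_inj]]]]] :=
  asdim0_relation bgX asdimX rho0.
have S_E x y : op_entry S x y != 0 -> E x y.
  move=> /S_rho xy; apply: r_E; apply: (le_trans xy).
  by have := ler_norm rho; lra.
(* rounding entries by 2 eta costs n * (n * (2 eta)) < c * eta in norm *)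
pose c := 2 * (n%:R * n%:R) + 1 : R.
have c0 : 0 < c by rewrite ltr_wpDl// !mulr_ge0.
pose eta := e / 2 / c; have eta0 : 0 < eta by rewrite divr_gt0.
have [K [v [code codeP]]] := finite_net (opnorm_ge0 S) eta0.
pose q x y := code (op_entry S x y).
have [L [l [frL lq]]] := frame_refinement q E_refl E_sym E_trans E_D nu_inj.
have [||Z [ZE Z0 Z_le]] := @kernel_op n E nu
  (fun x y => op_entry S x y - v (q x y)) (2 * eta) E_refl E_sym E_trans nu_inj.
- by rewrite mulr_ge0// ltW.
- by move=> x y _; apply: codeP; exact: op_entry_le.
have SZ_E x y : E x y -> op_entry (S - Z) x y = v (q x y).
  move=> xy; rewrite -[LHS]/(op_entry S x y - op_entry Z x y) ZE//.
  by rewrite opprB addrCA subrr addr0.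
have SZ_0 x y : op_entry (S - Z) x y != 0 -> E x y.
  move=> SZ; apply: contrapT => nE; move/eqP: SZ; apply.
  rewrite -[LHS]/(op_entry S x y - op_entry Z x y) Z0// subr0.
  by apply/eqP; apply: contra_notT nE; exact: S_E.
have SZ_fin : finite_propagation (S - Z).
  by apply/finite_propagationP; exists D => x y /SZ_0; exact: E_D.
pose b : Bu := UniformRoe (finite_propagation_roe SZ_fin).
exists L, E, l, D; split => //; exists b.
  split=> [|x y x' y' xy xy' lx ly]; first exact: SZ_0.
  by rewrite [LHS](SZ_E _ _ xy) [RHS](SZ_E _ _ xy') (lq x y x' y').
have -> : `|a - b| = `|(roe_op a - S) + Z|.
  have -> : (roe_op a - S) + Z = roe_op a - (S - Z) by rewrite opprB addrA addrAC.
  by [].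
apply: le_lt_trans (ler_normD _ _) _; rewrite [e]splitr.
apply: (ltr_leD aS); apply: (le_trans Z_le).
rewrite (_ : n%:R * (n%:R * (2 * eta)) = 2 * (n%:R * n%:R) * eta); last by ring.
apply: (@le_trans _ _ (c * eta)); first by rewrite ler_wpM2r ?ltW// ltrDl.
by rewrite /eta mulrC divfK// gt_eqF.
Qed.

Lemma asdim0_limit : is_inductive_limit_of (@isometric_to_matrix_sum R p p1 X).
Proof.
exists [set D | exists (L : finType) E (l : X -> L) r,
  frame E l r /\ D = frame_algebra E l]; split.
- move=> _ [L [E [l [r [fr ->]]]]]; have iso := frame_isometric fr (p1 := p1).
  by split => //; exact: isometric_subalgebra.
- have [L [E [l [r [fr _]]]]] := frames_dense 0 ltr01.
  by exists (frame_algebra E l), L, E, l, r.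
- move=> _ _ [L1 [E1 [l1 [r1 [fr1 ->]]]]] [L2 [E2 [l2 [r2 [fr2 ->]]]]].
  have [L [E [l [r [fr sub1 sub2]]]]] := frames_directed fr1 fr2.
  by exists (frame_algebra E l); split => //; exists L, E, l, r.
- move=> a e e0; have [L [E [l [r [fr [b Db ab]]]]]] := frames_dense a e0.
  by exists b => //; exists (frame_algebra E l) => //; exists L, E, l, r.
Qed.

End Approximation.

Theorem theoremE (R : realType) (X : metricType R) (p : R) (p1 : 1 <= p) :
  bounded_geometry X ->
  [<-> asymptotic_dimension_zero X;
       is_inductive_limit_of (@isometric_to_matrix_sum R p p1 X);
       has_cancellation (uniform_roe p1 X)].
Proof.
move=> bgX; tfae.
- exact: asdim0_limit.
- exact: limit_cancellation.
- exact: cancellation_asdim0.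
Qed.
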